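(* Let $\mathcal G$ be any compact metric graph, and let $p>6$. Then the set of bifurcation points of the problem $$-u''+\lambda u=|u|^{p-2}u\ \text{ on every edge } e\in\mathcal E,\qquad \sum_{e\succ \mathrm v}u_e'(\mathrm v)=0\ \text{ at every vertex } \mathrm v\in\mathcal V,$$ is exactly $\{\lambda_j(\mathcal G): j\in\mathbb N,\ j\ge1\}$.
   Context: A compact metric graph $\mathcal G=(\mathcal E,\mathcal V)$ is a connected metric graph with finitely many edges, each edge $e$ being identified with a bounded interval $[0,\ell_e]$, $\ell_e>0$. A function $u:\mathcal G\to\mathbb R$ is a family $\{u_e\}_{e\in\mathcal E}$ with $u_e$ defined on $[0,\ell_e]$. $H^1(\mathcal G)$ is the set of continuous $u:\mathcal G\to\mathbb R$ with $u_e\in H^1(0,\ell_e)$ for every $e$, with norm $\|u\|_{H^1(\mathcal G)}^2=\int_{\mathcal G}(|u'|^2+|u|^2)\,dx$. The notation $e\succ\mathrm v$ means that the edge $e$ is incident at $\mathrm v$, and $u_e'(\mathrm v)$ stands for $u_e'(0)$ or $-u_e'(\ell_e)$ according to whether $\mathrm v$ is identified with $0$ or $\ell_e$ (the sum involves derivatives away from the vertex; this is the Kirchhoff condition). $0=\lambda_1(\mathcal G)<\lambda_2(\mathcal G)\le\lambda_3(\mathcal G)\le\cdots$ are the eigenvalues (with multiplicity) of $-\frac{d^2}{dx^2}$ on $\mathcal G$ with Kirchhoff conditions at the vertices. A number $\lambda^*\in\mathbb R$ is a bifurcation point of the problem if there exists a sequence $\{(\lambda_k,u_k)\}\subset\mathbb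 R\times H^1(\mathcal G)$ such that $u_k\not\equiv0$ solves the problem with $\lambda=\lambda_k$, $-\lambda_k\to\lambda^*$ and $\|u_k\|_{H^1(\mathcal G)}\to0$. *)

(* Defs.v *)
From HB Require Import structures.
From mathcomp Require Import all_boot all_order all_algebra.
From mathcomp Require Import all_classical all_reals all_analysis.

Set Implicit Arguments.
Unset Strict Implicit.
Unset Printing Implicit Defensive.

Import Order.TTheory GRing.Theory Num.Theory.
Import numFieldNormedType.Exports.

Local Open Scope classical_set_scope.
Local Open Scope ring_scope.

(* Loops and multiple edges are allowed.  The edge [e] is the interval
   [0, len e]; the point 0 is the vertex [endpoint e false] and the point
   [len e] is the vertex [endpoint e true]. *)
Record multigraph := Multigraph {
  vertex : finType;
  edge : finType;
  endpoint : edge -> bool -> vertex }.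

Definition adjacent (M : multigraph) : rel (vertex M) := fun v w =>
  [exists e : edge M, exists b : bool,
    (endpoint e b == v) && (endpoint e (~~ b) == w)].

Record compact_metric_graph (R : realType) := CompactMetricGraph {
  graph :> multigraph;
  len : edge graph -> R;
  len_gt0 : forall e, 0 < len e;
  edge_inhabited : (0 < #|edge graph|)%N;
  graph_connected : forall v w : vertex graph, connect (@adjacent graph) v w }.

Section SobolevInterval.
Variable R : realType.
Implicit Types (l : R) (u g phi : R -> R).

Local Notation mu := (@lebesgue_measure R).

(* Square integrable on (0, l); values outside the interval are irrelevant. *)
Definition square_integrable l u : Prop :=
  measurable_fun `]0, l[ u /\
  mu.-integrable `]0, l[ (fun x => (u x ^+ 2)%:E).

(* C^1 functions with compact support in (0, l), extended by 0 to R. *)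
Definition test_function l phi : Prop :=
  [/\ forall x, derivable phi x 1,
      continuous (derive1 phi) &
      exists a b, [/\ 0 < a, b < l & forall x, x \notin `[a, b] -> phi x = 0]].

Definition is_weak_derivative l u g : Prop :=
  square_integrable l g /\
  forall phi, test_function l phi ->
    \int[mu]_(x in `]0, l[) (u x * derive1 phi x) =
    - \int[mu]_(x in `]0, l[) (g x * phi x).

Definition in_H1_interval l u : Prop :=
  square_integrable l u /\ exists g, is_weak_derivative l u g.

(* A choice of weak derivative, which is unique almost everywhere in (0, l);
   meaningful only under [in_H1_interval l u]. *)
Definition weak_derivative l u : R -> R :=
  xget (cst 0) [set g | is_weak_derivative l u g].

End SobolevInterval.

Section MetricGraph.
Variables (R : realType) (G : compact_metric_graph R).

Local Notation mu := (@lebesgue_measure R).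

(* A function on G is a family (u_e); only the values of [u e] on
   [0, len e] are meaningful. *)
Definition graph_function := edge G -> R -> R.

Implicit Types u : graph_function.

Definition end_value u (e : edge G) (b : bool) : R :=
  if b then u e (len e) else u e 0.

Definition graph_continuous u : Prop :=
  (forall e, {within `[0, len e], continuous (u e)}) /\
  (forall e b e' b', endpoint e b = endpoint e' b' ->
     end_value u e b = end_value u e' b').

Definition graph_nonzero u : Prop :=
  exists e x, x \in `[0, len e] /\ u e x != 0.

Definition in_H1 u : Prop :=
  graph_continuous u /\ forall e, in_H1_interval (len e) (u e).

Definition H1_norm u : R :=
  Num.sqrt (\sum_(e : edge G) \int[mu]_(x in `]0, len e[)
    (weak_derivative (len e) (u e) x ^+ 2 + u e x ^+ 2)).

Definition diff_quotient (f : R -> R) (a : R) : R -> R :=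
  fun h => h^-1 * (f (a + h) - f a).

Definition end_derivable u (e : edge G) (b : bool) : Prop :=
  if b then cvg (diff_quotient (u e) (len e) h @[h --> 0^'-])
  else cvg (diff_quotient (u e) 0 h @[h --> 0^'+]).

(* u_e'(v) for v = endpoint e b: the one-sided derivative of u_e taken in the
   direction away from the vertex. *)
Definition outward_derivative u (e : edge G) (b : bool) : R :=
  if b then - lim (diff_quotient (u e) (len e) h @[h --> 0^'-])
  else lim (diff_quotient (u e) 0 h @[h --> 0^'+]).

(* The sum is over incidences, so a loop at v contributes both of its ends. *)
Definition kirchhoff u : Prop :=
  (forall e b, end_derivable u e b) /\
  forall v : vertex G,
    \sum_(d : edge G * bool | endpoint d.1 d.2 == v)
      outward_derivative u d.1 d.2 = 0.

Definition twice_derivable_on_edges u : Prop :=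
  forall e x, x \in `]0, len e[ ->
    derivable (u e) x 1 /\ derivable (derive1 (u e)) x 1.

Definition eigenfunction (m : R) u : Prop :=
  [/\ graph_continuous u, twice_derivable_on_edges u, kirchhoff u,
      graph_nonzero u &
      forall e x, x \in `]0, len e[ -> - derive1n 2 (u e) x = m * u e x].

Definition lin_indep (n : nat) (phi : 'I_n -> graph_function) : Prop :=
  forall c : 'I_n -> R,
    (forall e x, x \in `[0, len e] -> \sum_(i < n) c i * phi i e x = 0) ->
    forall i, c i = 0.

(* [lambda_ j], j >= 1, lists in nondecreasing order the eigenvalues of
   -d^2/dx^2 with Kirchhoff conditions: each real m occurs in the list exactly
   as many times as the dimension of its eigenspace (zero times if m is not an
   eigenvalue).  The term [lambda_ 0] is not used. *)
Definition eigenvalue_sequence (lambda_ : nat -> R) : Prop :=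
  (forall i j, (0 < i)%N -> (i <= j)%N -> lambda_ i <= lambda_ j) /\
  (forall (m : R) (n : nat),
     (exists phi : 'I_n -> graph_function,
        (forall i, eigenfunction m (phi i)) /\ lin_indep phi) <->
     (exists s : 'I_n -> nat,
        injective s /\ forall i, (0 < s i)%N /\ lambda_ (s i) = m)).

Definition solves_NLS (p lam : R) u : Prop :=
  [/\ in_H1 u, twice_derivable_on_edges u, kirchhoff u &
      forall e x, x \in `]0, len e[ ->
        - derive1n 2 (u e) x + lam * u e x = `|u e x| `^ (p - 2) * u e x].

Definition bifurcation_point (p lstar : R) : Prop :=
  exists (lam : nat -> R) (u : nat -> graph_function),
    [/\ forall k, graph_nonzero (u k) /\ solves_NLS p (lam k) (u k),
        - lam k @[k --> \oo] --> lstar &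
        H1_norm (u k) @[k --> \oo] --> (0 : R)].

End MetricGraph.

(* Main.v *)
(* Write L u = - u'' - m u, with the vertex conditions, and mu = lambda + m, so
   that the problem is L u + mu u = |u|^(p-2) u.

   If m is not an eigenvalue, L has a bounded inverse for the sup norm, hence
   sup|u| <= C (sup|u|^(p-2) + |mu|) sup|u|, which excludes small solutions for
   small mu; the H^1 norm controls sup|u|.

   If m is an eigenvalue, let K = ker L and, for mu > 0 small, rescale u = r U
   with mu = r^(p-2), so that L U = mu (|U|^(p-2) U - U).  For y in a fixed ball
   of K a contraction gives the unique small w(y) orthogonal to K such that
   U = y + w(y) solves the equation modulo K.  The reduced energy A(y) has
   differential k |-> - <|U|^(p-2) U - U, k>, is negative on the boundary of the
   ball (the potential |U|^p / p dominates) and positive at some small y, so its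
   maximum over the ball is an interior critical point, i.e. a nonzero solution.
   The bounds on U are uniform in mu, so u tends to 0 with r.

   L is inverted through explicit fundamental solutions on the edges: solving
   the vertex conditions is a finite linear system, and Green's identity
   identifies the obstruction with orthogonality to K. *)

Require Import Defs.
From HB Require Import structures.
From mathcomp Require Import all_boot all_order all_algebra.
From mathcomp Require Import all_classical all_reals all_analysis.
From mathcomp Require Import measurable_realfun ring lra.
Import Order.TTheory GRing.Theory Num.Theory.
Import numFieldNormedType.Exports.
Local Open Scope classical_set_scope.
Local Open Scope ring_scope.

Set Implicit Arguments.
Unset Strict Implicit.
Unset Printing Implicit Defensive.

(** * Calculus on the line *)

(** The eigenvalue may be multiple, so bifurcation from a simple eigenvalue does not apply, and a
    variational argument on K takes its place. The rescaling makes it nondegenerate: the action of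
    U, divided by mu, tends as mu -> 0 to the function |y|^2 / 2 - int |y|^p / p on K, positive near
    0 and negative far out in every direction, and w(y) perturbs it only by O(mu). One
    finite-dimensional maximum thus serves every multiplicity. The map w is never differentiated. At
    a maximiser a nonzero gradient is excluded by a finite ascent step, for which a lower bound on
    A(y') - A(y) with quadratic error suffices. That bound rests on the Lipschitz estimate for
    |a|^(p-2) a, the convexity of |a|^p / p and the self-adjointness of L. Uniformity in mu needs
    constants independent of the right-hand side, so each linear estimate is stated with one
    constant for all q. *)

Section Calculus.
Variable R : realType.
Implicit Types (l x y : R) (f g F : R -> R).
Local Notation mu := (@lebesgue_measure R).

Lemma is_derive_continuous f (df : R -> R) :
  (forall x, is_derive x 1 f (df x)) -> continuous f.
Proof.
by move=> H x; apply/differentiable_continuous/derivable1_diffP; apply: ex_derive.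
Qed.

Lemma continuous_mul f g : continuous f -> continuous g ->
  continuous (fun x => f x * g x).
Proof. by move=> cf cg x; apply: continuousM; [exact: cf|exact: cg]. Qed.

Lemma continuous_add f g : continuous f -> continuous g ->
  continuous (fun x => f x + g x).
Proof. by move=> cf cg x; apply: continuousD; [exact: cf|exact: cg]. Qed.

Lemma continuous_sub f g : continuous f -> continuous g ->
  continuous (fun x => f x - g x).
Proof. by move=> cf cg x; apply: continuousB; [exact: cf|exact: cg]. Qed.

Lemma continuous_cmul (k : R) f : continuous f -> continuous (fun x => k * f x).
Proof. by move=> cf; apply: (@continuous_mul (cst k)) => //; exact: cst_continuous. Qed.

Lemma continuous_integrable f (a b : R) : continuous f ->
  mu.-integrable `[a, b] (EFin \o f).
Proof.
move=> cf; apply: continuous_compact_integrable; first exact: segment_compact.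
exact: continuous_subspaceT.
Qed.

Lemma is_derive_eq0_const f (a b : R) :
  (forall x, x \in `]a, b[ -> is_derive x 1 f 0) ->
  forall x y, x \in `]a, b[ -> y \in `]a, b[ -> f x = f y.
Proof.
move=> fd x y; wlog xy : x y / x <= y.
  move=> W xab yab; case: (leP x y) => [|/ltW] h; first exact: W.
  by apply/esym; apply: W.
move=> xab yab.
have sub z : z \in `[x, y] -> z \in `]a, b[.
  move: xab yab; rewrite !in_itv /= => /andP[ax _] /andP[_ yb] /andP[xz zy].
  by rewrite (lt_le_trans ax xz) (le_lt_trans zy yb).
have df z : z \in `]x, y[ -> is_derive z 1 f ((fun=> 0) z).
  move=> zxy; apply/fd/sub; move: zxy; rewrite !in_itv /= => /andP[u v].
  by rewrite !ltW.
have cf : {within `[x, y], continuous f}.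
  apply: derivable_within_continuous => z /sub/fd dz.
  exact: (@ex_derive _ _ _ _ _ _ _ dz).
have [c _] := MVT_segment xy df cf.
by rewrite mul0r => /eqP; rewrite subr_eq0 => /eqP.
Qed.

(** The integral is differentiated to the right of its base point; the base -1 leaves an overlap
    around 0 with the reflected construction. *)
Lemma antiderivative_right f : continuous f ->
  exists F, forall x, -1 < x -> is_derive x 1 F (f x).
Proof.
move=> cf; exists (fun x => \int[mu]_(t in `[-1, x]) f t) => x x1.
have xx : x < x + 1 by rewrite ltrDl.
have [dF F'] := @continuous_FTC1_closed R f (-1) x (x + 1) xx
   (continuous_integrable _ _ cf) x1 (cf x).
by rewrite -F' derive1E; apply: derivableP.
Qed.

(** The left half comes from [x |-> f (- x)] by reflection. On ]-1, 1[ the two antiderivatives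
    differ by a constant, so near every point the function glued at 0 coincides with one of them, up
    to a constant. *)
Lemma antiderivative f : continuous f ->
  exists F, F 0 = 0 /\ forall x, is_derive x 1 F (f x).
Proof.
move=> cf; have [G dG] := antiderivative_right cf.
have [H dH] : exists F, forall x, -1 < x -> is_derive x 1 F (f (- x)).
  apply: (@antiderivative_right (fun x => f (- x))) => x.
  by apply: continuous_comp; [exact: opp_continuous|exact: cf].
pose K x := - H (- x).
have dK x : x < 1 -> is_derive x 1 K (f x).
  move=> x1; have /dH dHx : -1 < - x by rewrite ltrN2.
  have := is_deriveN (is_derive1_comp dHx (is_deriveNid x 1)).
  by rewrite opprK /GRing.scale /= mulrN1 opprK.
have GK x : x \in `]-1, 1[ -> G x - G 0 = K x - K 0.
  move=> x1; suff : G x - K x = G 0 - K 0 by lra.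
  apply: (@is_derive_eq0_const (fun z => G z - K z) (-1) 1) => //; last first.
    by rewrite in_itv /=; lra.
  move=> z; rewrite in_itv /= => /andP[z1 z2].
  by have := is_deriveB (dG _ z1) (dK _ z2); rewrite subrr.
exists (fun x => if 0 <= x then G x - G 0 else K x - K 0); split.
  by rewrite lexx subrr.
have dG' x : -1 < x -> is_derive x 1 (fun x => G x - G 0) (f x).
  by move=> /dG h; have := is_deriveB h (is_derive_cst (G 0) x 1); rewrite subr0.
have dK' x : x < 1 -> is_derive x 1 (fun x => K x - K 0) (f x).
  by move=> /dK h; have := is_deriveB h (is_derive_cst (K 0) x 1); rewrite subr0.
move=> x; have [x0|x0] := ltP (-1) x.
- have [x0'|x0'] := ltP x 0.
    apply: (near_eq_is_derive _ (dK' _ _)); last by lra.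
    near=> z; rewrite leNgt; have -> : z < 0 by near: z; exact: lt_nbhsl.
    by [].
  apply: (near_eq_is_derive _ (dG' _ _)); last by lra.
  near=> z; case: ifPn => //; rewrite -ltNge => z0; apply/GK.
  rewrite in_itv /= (lt_trans z0) // andbT; near: z; exact: lt_nbhsr.
- apply: (near_eq_is_derive _ (dK' _ _)); last by lra.
  near=> z; rewrite leNgt; have -> : z < 0 by near: z; apply: lt_nbhsl; lra.
  by [].
Unshelve. all: by end_near. Qed.

End Calculus.

Section Integral.
Variable R : realType.
Implicit Types (l x y : R) (f g F : R -> R).
Local Notation mu := (@lebesgue_measure R).

Definition integral_0to l f : R := \int[mu]_(x in `[0, l]) f x.

Lemma integral_0to_FTC l f F : 0 < l -> continuous f ->
  (forall x, is_derive x 1 F (f x)) -> integral_0to l f = F l - F 0.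
Proof.
move=> l0 cf dF; rewrite /integral_0to /Rintegral.
have cF := is_derive_continuous dF.
rewrite (@continuous_FTC2 R f F 0 l l0) //.
  exact: continuous_subspaceT.
split; first by move=> x _; apply: ex_derive.
  exact: cvg_at_right_filter (cF 0).
exact: cvg_at_left_filter (cF l).
by move=> x _; rewrite derive1E; apply: derive_val.
Qed.

Lemma integral_0toD l f g : continuous f -> continuous g ->
  integral_0to l (fun x => f x + g x) = integral_0to l f + integral_0to l g.
Proof. by move=> cf cg; apply: RintegralD => //; exact: continuous_integrable. Qed.

Lemma integral_0toZ l (k : R) f : continuous f ->
  integral_0to l (fun x => k * f x) = k * integral_0to l f.
Proof. by move=> cf; apply: RintegralZl => //; exact: continuous_integrable. Qed.

Lemma le_integral_0to l f g : continuous f -> continuous g ->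
  (forall x, 0 <= x <= l -> f x <= g x) -> integral_0to l f <= integral_0to l g.
Proof.
move=> cf cg fg; apply: le_Rintegral => //; exact: continuous_integrable.
Qed.

Lemma eq_integral_0to l f g :
  (forall x, 0 <= x <= l -> f x = g x) -> integral_0to l f = integral_0to l g.
Proof.
by move=> fg; apply: eq_Rintegral => x; rewrite inE /= in_itv; exact: fg.
Qed.

Lemma integral_0to_cst l (k : R) : 0 < l -> integral_0to l (fun=> k) = k * l.
Proof.
move=> l0; rewrite /integral_0to Rintegral_cst //= lebesgue_measure_itv /= lte_fin l0.
by rewrite -EFinD /= subr0.
Qed.

(** The antiderivative is nondecreasing with equal values at both ends, hence constant, and its
    derivative [f] vanishes inside; continuity reaches the endpoints. *)
Lemma integral_0to_eq0 l f : 0 < l -> continuous f ->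
  (forall x, 0 <= x <= l -> 0 <= f x) -> integral_0to l f = 0 ->
  forall x, 0 <= x <= l -> f x = 0.
Proof.
move=> l0 cf f0; have [F [F0 dF]] := antiderivative cf.
rewrite (integral_0to_FTC l0 cf dF) F0 subr0 => Fl.
have cF := is_derive_continuous dF.
have Finc x y : 0 <= x -> x <= y -> y <= l -> F x <= F y.
  move=> x0 xy yl.
  have [z|z zxy] := MVT_segment xy (fun z _ => dF z).
    exact: continuous_subspaceT.
  move/eqP; rewrite subr_eq => /eqP ->; rewrite lerDr mulr_ge0 ?subr_ge0 //.
  by apply: f0; move: zxy; rewrite in_itv /= => /andP[? ?]; lra.
have FE x : 0 <= x <= l -> F x = 0.
  move=> /andP[x0 xl]; apply/eqP; rewrite eq_le -{1}Fl -{1}F0.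
  by rewrite !Finc // -F0 Finc.
have foo x : x \in `]0, l[ -> f x = 0.
  move=> x0l; have <- : 'D_1 F x = f x by apply: derive_val.
  have : is_derive x 1 F 0.
    apply: (near_eq_is_derive _ (is_derive_cst (0 : R) x 1)).
    near=> z; apply/esym/FE.
    have : z \in `]0, l[.
      near: z; apply: near_in_itvoo; exact: x0l.
    by rewrite in_itv /= => /andP[? ?]; lra.
  by move=> h; apply: derive_val.
move=> x /andP[x0 xl]; have [xl'|lx] := ltP x l.
  have fx := cvg_at_right_filter (cf x).
  apply: (cvg_unique _ fx); first exact: norm_hausdorff.
  apply: cvg_near_cst; near=> z; apply: foo; rewrite in_itv /=; apply/andP; split.
    by apply: (le_lt_trans x0); near: z; exact: nbhs_right_gt.
  by near: z; exact: nbhs_right_lt.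
have fx := cvg_at_left_filter (cf x).
apply: (cvg_unique _ fx); first exact: norm_hausdorff.
apply: cvg_near_cst; near=> z; apply: foo; rewrite in_itv /=; apply/andP; split.
  by near: z; apply: nbhs_left_gt; rewrite (lt_le_trans l0).
by apply: lt_le_trans xl; near: z; exact: nbhs_left_lt.
Unshelve. all: by end_near. Qed.

End Integral.

(** * Fundamental solutions of - w'' = m w *)

Section CosSin.
Variable R : realType.

Lemma is_derive1_scale (f : R -> R) (k x d : R) :
  is_derive (k * x) 1 f d -> is_derive x 1 (fun y => f (k * y)) (k * d).
Proof.
move=> fd.
have h : is_derive x 1 (fun y : R => k * y) k.
  by have := is_deriveZ k (is_derive_id x (1 : R)); rewrite /GRing.scale /= mulr1.
by have := is_derive1_comp fd h; rewrite mulrC.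
Qed.

(** Trigonometric, affine or hyperbolic functions according to the sign of [m]. A bifurcation point
    is a priori any real, so negative [m] must be covered; afterwards only these four properties are
    used. *)
Lemma exists_cos_sin (m : R) : exists c s : R -> R,
  [/\ c 0 = 1, s 0 = 0, forall x : R, is_derive x 1 c (- m * s x) &
      forall x : R, is_derive x 1 s (c x)].
Proof.
have [m0|m0|->] := ltrgt0P m; last first.
- exists (fun=> 1), id; split => //.
    by move=> x; rewrite oppr0 mul0r; exact: is_derive_cst.
  by move=> x; exact: is_derive_id.
- set k := Num.sqrt (- m).
  have k2 : k * k = - m by rewrite -expr2 sqr_sqrtr // oppr_ge0 ltW.
  have k0 : k != 0 by rewrite sqrtr_eq0 -ltNge oppr_gt0.
  have de (a x : R) : is_derive x 1 (fun y => expR (a * y)) (a * expR (a * x)).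
    exact: is_derive1_scale.
  exists (fun x => 2^-1 * expR (k * x) + 2^-1 * expR (- k * x)).
  exists (fun x => (2 * k)^-1 * expR (k * x) - (2 * k)^-1 * expR (- k * x)).
  split; first by rewrite !mulr0 expR0; lra.
  + by rewrite !mulr0 subrr.
  + move=> x; apply: is_derive_eq (is_deriveD (is_deriveZ 2^-1 (de k x))
      (is_deriveZ 2^-1 (de (- k) x))) _.
    by rewrite /GRing.scale /= -k2; field.
  + move=> x; apply: is_derive_eq (is_deriveB (is_deriveZ (2 * k)^-1 (de k x))
      (is_deriveZ (2 * k)^-1 (de (- k) x))) _.
    by rewrite /GRing.scale /=; field.
- set k := Num.sqrt m.
  have k2 : k * k = m by rewrite -expr2 sqr_sqrtr // ltW.
  have k0 : k != 0 by rewrite sqrtr_eq0 -ltNge.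
  exists (fun x => cos (k * x)), (fun x => k^-1 * sin (k * x)); split.
  + by rewrite mulr0 cos0.
  + by rewrite mulr0 sin0 mulr0.
  + move=> x; apply: is_derive_eq (is_derive1_scale (is_derive_cos (k * x))) _.
    by rewrite -k2; field.
  + move=> x; apply: is_derive_eq (is_deriveZ k^-1 (is_derive1_scale (is_derive_sin (k * x)))) _.
    by rewrite /GRing.scale /=; field.
Qed.

(** The left-hand side is the Wronskian c s' - c' s. *)
Lemma cos_sin_sqr (m : R) (c s : R -> R) : c 0 = 1 -> s 0 = 0 ->
  (forall x : R, is_derive x 1 c (- m * s x)) -> (forall x : R, is_derive x 1 s (c x)) ->
  forall x, c x * c x + m * (s x * s x) = 1.
Proof.
move=> c0 s0 dc ds x.
have -> : 1 = c 0 * c 0 + m * (s 0 * s 0) by rewrite c0 s0; ring.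
apply: (@is_derive_0_is_cst _ (fun x => c x * c x + m * (s x * s x))) => y.
apply: is_derive_eq (is_deriveD (is_deriveM (dc y) (dc y))
  (is_deriveZ m (is_deriveM (ds y) (ds y)))) _.
by rewrite /GRing.scale /=; ring.
Qed.

End CosSin.

Section Clamp.
Variable R : realType.
Implicit Types (l x : R) (f : R -> R).

(** A retraction of R onto [0, l]: composing with it extends a function continuous on an edge to one
    continuous on R. *)
Definition clamp l x : R := Num.min l (Num.max 0 x).

Lemma clampE l x : 0 <= x <= l -> clamp l x = x.
Proof. by move=> /andP[x0 xl]; rewrite /clamp max_r // min_r. Qed.

Lemma clamp_in l x : 0 <= l -> 0 <= clamp l x <= l.
Proof. by move=> l0; rewrite /clamp le_min l0 le_max lexx /= ge_min lexx. Qed.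

Lemma clamp_continuous l : continuous (clamp l).
Proof.
move=> x; apply: (@continuous_min _ _ (cst l) (fun x => Num.max 0 x)).
  exact: cst_continuous.
by apply: (@continuous_max _ _ (cst 0) id); [exact: cst_continuous|].
Qed.

Lemma within_continuous_clamp l f : 0 <= l -> {within `[0, l], continuous f} ->
  continuous (f \o clamp l).
Proof.
move=> l0 cf x.
have cin := clamp_in x l0.
apply: (@cvg_comp _ _ _ (clamp l) f _ (within `[0, l] (nbhs (clamp l x)))).
  move=> B; rewrite /within /= => nB.
  have h : \forall z \near x, clamp l z \in `[0, l] -> B (clamp l z).
    by exact: (@clamp_continuous l x _ nB).
  suff : \forall z \near x, B (clamp l z) by [].
  by apply: filterS h => z; apply; rewrite in_itv /= clamp_in.
rewrite nbhs_subspace_in; first exact: cf.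
by rewrite /= in_itv.
Qed.

End Clamp.

(** * Green's identity and the Fredholm alternative on the graph *)

(** Row vectors orthogonal to the right kernel of [A] lie in its row space. The matrix [T], a
    pseudo-inverse, is chosen before [b], so the solution z = b T is bounded by a fixed multiple of
    [b]. *)
Lemma fredholm_alternative (K : fieldType) (I J : finType) (A : I -> J -> K) :
  exists T : J -> I -> K, forall b : J -> K,
    (forall y : J -> K, (forall i, \sum_j A i j * y j = 0) ->
       \sum_j b j * y j = 0) ->
    forall j, \sum_i (\sum_j' b j' * T j' i) * A i j = b j.
Proof.
pose M := \matrix_(i < #|I|, j < #|J|) A (enum_val i) (enum_val j).
have sumr (H : finType) (F : 'I_#|H| -> K) : \sum_k F k = \sum_h F (enum_rank h).
  rewrite (reindex (@enum_rank H)) //; exact/onW_bij/enum_rank_bij.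
exists (fun j i => pinvmx M (enum_rank j) (enum_rank i)) => b bP j.
pose B := \row_(j < #|J|) b (enum_val j).
have BM : (B <= M)%MS.
  (* The columns of [cokermx M] lie in the right kernel of [M], so the hypothesis on [b] applies to
     each of them. *)
  rewrite submxE; apply/eqP/rowP => k; rewrite !mxE sumr.
  under eq_bigr do rewrite mxE enum_rankK.
  apply: bP => i; have := mulmx_coker M.
  move=> /matrixP/(_ (enum_rank i) k); rewrite !mxE sumr => h; rewrite -[RHS]h.
  by apply: eq_bigr => j' _; rewrite !mxE !enum_rankK.
have := mulmxKpV BM; move=> /matrixP/(_ 0 (enum_rank j)).
rewrite !mxE sumr enum_rankK => <-; apply: eq_bigr => i _; rewrite !mxE sumr !enum_rankK.
by congr (_ * _); apply: eq_bigr => j' _; rewrite !mxE !enum_rankK.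
Qed.

Section Graph.
Variables (R : realType) (G : compact_metric_graph R).
Implicit Types (u v w q : edge G -> R -> R) (e : edge G) (d : edge G * bool).

Definition ip u v : R := \sum_e integral_0to (len e) (fun x => u e x * v e x).

Definition bounded_by (M : R) u := forall e x, 0 <= x <= len e -> `|u e x| <= M.

Definition out_value (w1 : edge G -> R -> R) e (b : bool) : R :=
  if b then - w1 e (len e) else w1 e 0.

Definition vertex_continuous w := forall e b e' b',
  endpoint e b = endpoint e' b' -> end_value w e b = end_value w e' b'.

Definition vertex_balanced (w1 : edge G -> R -> R) := forall v : vertex G,
  \sum_(d : edge G * bool | endpoint d.1 d.2 == v) out_value w1 d.1 d.2 = 0.

(** Among the incidences at one vertex the common value of [w] factors out, and what remains is the
    balanced sum. *)
Lemma sum_out_end_eq0 w w1 : vertex_continuous w -> vertex_balanced w1 ->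
  \sum_d out_value w1 d.1 d.2 * end_value w d.1 d.2 = 0.
Proof.
move=> cw bw; rewrite (partition_big (fun d => endpoint d.1 d.2) predT) //=.
apply: big1 => v _.
have [/= d0 /eqP d0v|no] := pickP (fun d : edge G * bool => endpoint d.1 d.2 == v); last first.
  by apply: big_pred0 => d; exact: no.
rewrite (eq_bigr (fun d => out_value w1 d.1 d.2 * end_value w d0.1 d0.2)).
  by rewrite -mulr_suml bw mul0r.
by move=> d /eqP dv; congr (_ * _); apply: cw; rewrite dv.
Qed.

Variable m : R.

(* The equation [- w'' - m w = q] is imposed on all of R and not only on the
   edges, so that no one-sided derivatives are needed at the vertices. *)
Definition ode q w w1 :=
  (forall e (x : R), is_derive x 1 (w e) (w1 e x)) /\
  (forall e (x : R), is_derive x 1 (w1 e) (- m * w e x - q e x)).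

Definition kirchhoff_sol q w w1 :=
  [/\ ode q w w1, vertex_continuous w & vertex_balanced w1].

Lemma ode_continuous q w w1 : ode q w w1 ->
  (forall e, continuous (w e)) /\ (forall e, continuous (w1 e)).
Proof.
by move=> [dw dw1]; split=> e; [exact: is_derive_continuous (dw e)|
  exact: is_derive_continuous (dw1 e)].
Qed.

(** On each edge w v1 - w1 v has derivative q v - w q', the terms in [m] cancelling; the signs in
    [out_value] turn its increments into the sum over incidences. *)
Lemma green q q' w w1 v v1 : (forall e, continuous (q e)) ->
  (forall e, continuous (q' e)) -> ode q w w1 -> ode q' v v1 ->
  ip q v - ip w q' = \sum_d (out_value w1 d.1 d.2 * end_value v d.1 d.2 -
                             end_value w d.1 d.2 * out_value v1 d.1 d.2).
Proof.
move=> cq cq' ow ov.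
have [cw cw1] := ode_continuous ow; have [cv cv1] := ode_continuous ov.
rewrite -(pair_big predT predT (fun e b => out_value w1 e b * end_value v e b -
                             end_value w e b * out_value v1 e b)) /=.
rewrite /ip -sumrB; apply: eq_bigr => e _; rewrite big_bool /=.
pose F x := w e x * v1 e x - w1 e x * v e x.
have dF (x : R) : is_derive x 1 F (q e x * v e x + -1 * (w e x * q' e x)).
  apply: is_derive_eq (is_deriveB (is_deriveM (ow.1 e x) (ov.2 e x))
     (is_deriveM (ow.2 e x) (ov.1 e x))) _.
  by rewrite /GRing.scale /=; ring.
have cqv := continuous_mul (cq e) (cv e).
have cwq := continuous_mul (cw e) (cq' e).
have := integral_0to_FTC (len_gt0 e) (continuous_add cqv (continuous_cmul (k := -1) cwq)) dF.
rewrite integral_0toD //; last exact: continuous_cmul.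
by rewrite integral_0toZ // mulN1r => ->; rewrite /F; ring.
Qed.

(** Self-adjointness of L: under the vertex conditions both boundary sums in [green] vanish. *)
Lemma kirchhoff_sol_sym q q' w w1 v v1 : (forall e, continuous (q e)) ->
  (forall e, continuous (q' e)) -> kirchhoff_sol q w w1 -> kirchhoff_sol q' v v1 ->
  ip q v = ip w q'.
Proof.
move=> cq cq' [ow cw bw] [ov cv bv]; apply/eqP; rewrite -subr_eq0.
rewrite (green cq cq' ow ov) sumrB sum_out_end_eq0 // sub0r oppr_eq0.
by under eq_bigr do rewrite mulrC; rewrite sum_out_end_eq0.
Qed.

End Graph.

(** * Initial value problems on the edges *)

Section GraphOde.
Variables (R : realType) (G : compact_metric_graph R).
Implicit Types (u v w q : edge G -> R -> R) (e : edge G) (d : edge G * bool).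

Lemma len_le_sum e : len e <= \sum_(e' : edge G) len e'.
Proof.
rewrite (bigD1 e) //= lerDl sumr_ge0 // => e' _; exact/ltW/len_gt0.
Qed.

Lemma continuous_bounded_by u : (forall e, continuous (u e)) ->
  exists2 M, 0 <= M & bounded_by M u.
Proof.
move=> cu.
have /choice[M MP] e : exists M, forall x, 0 <= x <= len e -> `|u e x| <= M.
  have [|c _ cP] := @EVT_max R (fun x => `|u e x|) 0 (len e) (ltW (len_gt0 e)).
    apply: continuous_subspaceT => x.
    by apply: continuous_comp; [exact: cu|exact: norm_continuous].
  by exists `|u e c| => x xl; apply: cP; rewrite in_itv.
have M0 e : 0 <= M e.
  by apply: le_trans (MP e 0 _) => //; rewrite lexx ltW ?len_gt0.
exists (\sum_e M e) => [|e x xl]; first exact: sumr_ge0.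
by apply: (le_trans (MP e x xl)); rewrite (bigD1 e) //= lerDl sumr_ge0.
Qed.

Lemma antiderivative_bounded (l B : R) (f F : R -> R) : F 0 = 0 ->
  (forall x : R, is_derive x 1 F (f x)) -> (forall x, 0 <= x <= l -> `|f x| <= B) ->
  forall x, 0 <= x <= l -> `|F x| <= B * l.
Proof.
move=> F0 dF fB x /andP[x0 xl].
have cF := continuous_subspaceT (is_derive_continuous dF).
have [z zx] := MVT_segment x0 (fun z _ => dF z) (cF _).
rewrite F0 !subr0 => ->; rewrite normrM (ger0_norm x0).
move: zx; rewrite in_itv /= => /andP[z0 zx].
have fz : `|f z| <= B by apply: fB; lra.
by apply: ler_pM.
Qed.

Variables (m : R) (c s : R -> R).
Hypotheses (c0 : c 0 = 1) (s0 : s 0 = 0)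
  (dc : forall x : R, is_derive x 1 c (- m * s x))
  (ds : forall x : R, is_derive x 1 s (c x)).

(** Variation of constants: w = D c - C s, where C' = c q, D' = s q and both vanish at 0. In the
    derivative of w1 the coefficient of [q] is the Wronskian c^2 + m s^2 = 1, up to sign. *)
Lemma ode_zero_data : exists2 C, 0 <= C & forall q, (forall e, continuous (q e)) ->
  exists w w1, [/\ ode m q w w1, forall e, w e 0 = 0, forall e, w1 e 0 = 0 &
    forall M, 0 <= M -> bounded_by M q -> bounded_by (C * M) w /\ bounded_by (C * M) w1].
Proof.
have cc := is_derive_continuous dc; have cs := is_derive_continuous ds.
have [K K0 cK] := @continuous_bounded_by (fun=> c) (fun=> cc).
have [K' K0' sK] := @continuous_bounded_by (fun=> s) (fun=> cs).
pose L := \sum_(e : edge G) len e.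
have L0 : 0 <= L by apply: sumr_ge0 => e _; exact/ltW/len_gt0.
exists (2 * (K + K') * ((K + K') * L) * (1 + `|m|)) => [|q cq].
  by rewrite !mulr_ge0 ?addr_ge0.
have /choice[C CP] e : exists F, F 0 = 0 /\ forall x : R, is_derive x 1 F (c x * q e x).
  exact/antiderivative/continuous_mul.
have /choice[D DP] e : exists F, F 0 = 0 /\ forall x : R, is_derive x 1 F (s x * q e x).
  exact/antiderivative/continuous_mul.
exists (fun e x => D e x * c x - C e x * s x).
exists (fun e x => - m * (D e x * s x) - C e x * c x); split.
- split=> e x.
    apply: is_derive_eq (is_deriveB (is_deriveM ((DP e).2 x) (dc x))
       (is_deriveM ((CP e).2 x) (ds x))) _.
    by rewrite /GRing.scale /=; ring.
  apply: is_derive_eq (is_deriveB (is_deriveZ (- m) (is_deriveM ((DP e).2 x) (ds x)))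
       (is_deriveM ((CP e).2 x) (dc x))) _.
  by rewrite /GRing.scale /= -[X in _ = _ - X]mul1r -(cos_sin_sqr c0 s0 dc ds x); ring.
- by move=> e; rewrite (CP e).1 (DP e).1 !mul0r subrr.
- by move=> e; rewrite (CP e).1 (DP e).1 !mul0r mulr0 subrr.
- move=> M M0 qM.
  have bnd (K1 : R) f F : 0 <= K1 -> K1 <= K + K' -> bounded_by K1 (fun _ : edge G => f) ->
     (forall e, F e 0 = 0 /\ forall x : R, is_derive x 1 (F e) (f x * q e x)) ->
     forall e x, 0 <= x <= len e -> `|F e x| <= (K + K') * L * M.
    move=> K10 K1K fK FP e x xl.
    apply: (@le_trans _ _ (K1 * M * len e)).
      apply: (antiderivative_bounded (FP e).1 (FP e).2) xl => y yl.
      by rewrite normrM ler_pM // ?(fK e y yl) ?qM.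
    rewrite mulrAC ler_wpM2r // ler_pM //; first exact/ltW/len_gt0.
    exact: len_le_sum.
  have Cb := bnd K c C K0 _ cK CP; have Db := bnd K' s D K0' _ sK DP.
  have main (a : R) (f g : R -> R) e x : 0 <= x <= len e -> `|a| <= 1 + `|m| ->
      (forall y, 0 <= y <= len e -> `|f y| <= K + K') ->
      (forall y, 0 <= y <= len e -> `|g y| <= K + K') ->
      `|a * (D e x * f x) - C e x * g x| <= 2 * (K + K') * ((K + K') * L) * (1 + `|m|) * M.
    move=> xl am fK gK; apply: (le_trans (ler_normB _ _)).
    rewrite !normrM.
    have C1 : `|C e x| <= (K + K') * L * M by apply: Cb => //; lra.
    have D1 : `|D e x| <= (K + K') * L * M by apply: Db => //; lra.
    have Df : `|D e x| * `|f x| <= (K + K') * L * M * (K + K') by rewrite ler_pM // fK.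
    have Cg : `|C e x| * `|g x| <= (K + K') * L * M * (K + K') by rewrite ler_pM // gK.
    have aDf : `|a| * (`|D e x| * `|f x|) <= (1 + `|m|) * ((K + K') * L * M * (K + K')).
      by rewrite ler_pM // mulr_ge0.
    have Cg' : `|C e x| * `|g x| <= (1 + `|m|) * ((K + K') * L * M * (K + K')).
      by apply: (le_trans Cg); rewrite ler_peMl ?lerDl // !mulr_ge0 ?addr_ge0.
    by apply: (le_trans (lerD aDf Cg')); lra.
  have cKK e y : 0 <= y <= len e -> `|c y| <= K + K'.
    by move=> /cK /le_trans; apply; rewrite lerDl.
  have sKK e y : 0 <= y <= len e -> `|s y| <= K + K'.
    by move=> /sK /le_trans; apply; rewrite lerDr.
  split=> e x xl.
    by rewrite -[D e x * c x]mul1r; apply: main => //; rewrite ?normr1 ?lerDl //;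
      [exact: cKK|exact: sKK].
  by apply: main => //; rewrite ?normrN ?lerDr //; [exact: sKK|exact: cKK].
Qed.

(** The boolean does not name an endpoint here: [z (e, false)] is the value at 0 and [z (e, true)]
    the derivative at 0. *)
Definition hom (z : edge G * bool -> R) e (x : R) : R := z (e, false) * c x + z (e, true) * s x.

Definition hom1 (z : edge G * bool -> R) e (x : R) : R :=
  - m * z (e, false) * s x + z (e, true) * c x.

Lemma ode_hom z : ode m (fun _ _ => 0) (hom z) (hom1 z).
Proof.
split=> e x.
  apply: is_derive_eq (is_deriveD (is_deriveZ (z (e, false)) (dc x))
       (is_deriveZ (z (e, true)) (ds x))) _.
  by rewrite /hom1 /GRing.scale /=; ring.
apply: is_derive_eq (is_deriveD (is_deriveZ (- m * z (e, false)) (ds x))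
       (is_deriveZ (z (e, true)) (dc x))) _.
by rewrite /hom /GRing.scale /=; ring.
Qed.

(** The inverse propagator applied to (w, w1) is constant along the edge; the propagator has
    determinant c^2 + m s^2 = 1. *)
Lemma homogeneous_ode_eq (w w1 : edge G -> R -> R) : ode m (fun _ _ => 0) w w1 ->
  let z d := if d.2 then w1 d.1 0 else w d.1 0 in
  forall e x, w e x = hom z e x /\ w1 e x = hom1 z e x.
Proof.
move=> [dw dw1] z e x.
have A : c x * w e x - s x * w1 e x = w e 0.
  transitivity (c 0 * w e 0 - s 0 * w1 e 0); last by rewrite c0 s0; ring.
  apply: (@is_derive_0_is_cst _ (fun x => c x * w e x - s x * w1 e x)) => y.
  apply: is_derive_eq (is_deriveB (is_deriveM (dc y) (dw e y))
     (is_deriveM (ds y) (dw1 e y))) _.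
  by rewrite /GRing.scale /=; ring.
have B : m * (s x * w e x) + c x * w1 e x = w1 e 0.
  transitivity (m * (s 0 * w e 0) + c 0 * w1 e 0); last by rewrite c0 s0; ring.
  apply: (@is_derive_0_is_cst _ (fun x => m * (s x * w e x) + c x * w1 e x)) => y.
  apply: is_derive_eq (is_deriveD (is_deriveZ m (is_deriveM (ds y) (dw e y)))
     (is_deriveM (dc y) (dw1 e y))) _.
  by rewrite /GRing.scale /=; ring.
have cs1 := cos_sin_sqr c0 s0 dc ds x.
rewrite /hom /hom1 /z /= -A -B; split.
  by rewrite -[LHS]mul1r -cs1; ring.
by rewrite -[LHS]mul1r -cs1; ring.
Qed.

End GraphOde.

(** * The Kirchhoff problem as a finite linear system *)

Section Solvability.
Variables (R : realType) (G : compact_metric_graph R).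
Implicit Types (u v w q : edge G -> R -> R) (e : edge G) (d : edge G * bool).
Variables (m : R) (c s : R -> R).
Hypotheses (c0 : c 0 = 1) (s0 : s 0 = 0)
  (dc : forall x : R, is_derive x 1 c (- m * s x))
  (ds : forall x : R, is_derive x 1 s (c x)).
Local Notation hom := (@hom R G c s).
Local Notation hom1 := (@hom1 R G m c s).
Local Notation ends := (edge G * bool)%type.

Lemma sum_ends (F : ends -> R) : \sum_d F d = \sum_e (F (e, true) + F (e, false)).
Proof.
rewrite (eq_bigr (fun d => F (d.1, d.2))); last by case.
rewrite -(pair_big predT predT (fun e b => F (e, b))) /=.
by apply: eq_bigr => e _; rewrite big_bool.
Qed.

Definition unit_data (d0 d : ends) : R := (d == d0)%:R.

Lemma sum_unit_data (z : ends -> R) d0 : \sum_d z d * unit_data d d0 = z d0.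
Proof.
rewrite (bigD1 d0) //= /unit_data eqxx mulr1 big1 ?addr0 // => d dd0.
by rewrite eq_sym (negPf dd0) mulr0.
Qed.

Lemma homE z e x : hom z e x = \sum_d z d * hom (unit_data d) e x.
Proof.
rewrite /hom; under eq_bigr do rewrite mulrDr !mulrA.
by rewrite big_split /= -!mulr_suml !sum_unit_data.
Qed.

Lemma hom1E z e x : hom1 z e x = \sum_d z d * hom1 (unit_data d) e x.
Proof.
transitivity (- m * s x * \sum_d z d * unit_data d (e, false) +
              c x * \sum_d z d * unit_data d (e, true)).
  by rewrite !sum_unit_data /hom1; ring.
by rewrite !mulr_sumr -big_split; apply: eq_bigr => d _; rewrite /hom1 /=; ring.
Qed.

Lemma end_homE z d : end_value (hom z) d.1 d.2 =
  \sum_d' z d' * end_value (hom (unit_data d')) d.1 d.2.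
Proof. by rewrite /end_value; case: d.2; rewrite homE. Qed.

Lemma out_homE z d : out_value (hom1 z) d.1 d.2 =
  \sum_d' z d' * out_value (hom1 (unit_data d')) d.1 d.2.
Proof.
rewrite /out_value; case: d.2; rewrite hom1E //.
by rewrite -sumrN; apply: eq_bigr => d' _; rewrite mulrN.
Qed.

(* The unknowns are the initial data on the edges together with a value at
   each vertex; the equations say that every end takes the value of its vertex
   and that the outward derivatives balance. *)
Definition vertex_system (i j : ends + vertex G) : R :=
  match i, j with
  | inl d, inl d' => end_value (hom (unit_data d)) d'.1 d'.2
  | inl d, inr v => \sum_(d' | endpoint d'.1 d'.2 == v) out_value (hom1 (unit_data d)) d'.1 d'.2
  | inr v, inl d' => - (endpoint d'.1 d'.2 == v)%:R
  | inr _, inr _ => 0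
  end.

Lemma vertex_systemE (z : ends + vertex G -> R) (j : ends + vertex G) :
  \sum_i z i * vertex_system i j =
  match j with
  | inl d => end_value (hom (z \o inl)) d.1 d.2 - z (inr (endpoint d.1 d.2))
  | inr v => \sum_(d | endpoint d.1 d.2 == v) out_value (hom1 (z \o inl)) d.1 d.2
  end.
Proof.
rewrite big_sumType /=; case: j => [d|v] /=.
  rewrite end_homE; congr (_ + _).
  rewrite (bigD1 (endpoint d.1 d.2)) //= eqxx mulrN1 big1 ?addr0 // => v vd.
  by rewrite eq_sym (negPf vd) oppr0 mulr0.
rewrite [X in _ + X]big1 ?addr0; last by move=> *; rewrite mulr0.
under [RHS]eq_bigr do rewrite out_homE.
rewrite exchange_big /=; apply: eq_bigr => d _.
by rewrite mulr_sumr.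
Qed.

(** Self-adjointness at the level of matrices: the transposed system describes the homogeneous
    Kirchhoff problem again, with [y (inr v)] as the value at [v] and [- y (inl (e, b))] as the
    outward derivative at the end [(e, b)]. *)
Lemma vertex_system_dual (y : ends + vertex G -> R) :
  (forall i, \sum_j vertex_system i j * y j = 0) ->
  let z d := if d.2 then - y (inl (d.1, false)) else y (inr (endpoint d.1 false)) in
  [/\ vertex_continuous (hom z), vertex_balanced (hom1 z),
     forall e b, end_value (hom z) e b = y (inr (endpoint e b)) &
     forall e b, out_value (hom1 z) e b = - y (inl (e, b))].
Proof.
move=> yP z.
have cs1 := cos_sin_sqr c0 s0 dc ds.
(* The equation of index [inl (e, b)] involves the edge [e] alone; it tests with [c] for [b = false]
   and with [s] for [b = true]. *)
have Y0 e b : y (inl (e, false)) * (~~ b)%:R + 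
   y (inl (e, true)) * (if b then s (len e) else c (len e)) +
   y (inr (endpoint e false)) * b%:R -
   y (inr (endpoint e true)) * (if b then c (len e) else - m * s (len e)) = 0.
  have := yP (inl (e, b)); rewrite big_sumType /=.
  under [X in _ + X]eq_bigr do rewrite mulr_suml.
  rewrite [X in _ + X](_ : _ =
      \sum_d out_value (hom1 (unit_data (e, b))) d.1 d.2 * y (inr (endpoint d.1 d.2))); last first.
    rewrite [RHS](partition_big (fun d => endpoint d.1 d.2) predT) //=.
    by apply: eq_bigr => v _; apply: eq_bigr => d /eqP ->.
  rewrite -big_split /=.
  rewrite sum_ends (bigD1 e) //= [X in _ + X]big1 ?addr0; last first.
    by move=> e' e'e; rewrite /hom /hom1 /unit_data !xpair_eqE (negPf e'e) /=; ring.
  rewrite /hom /hom1 /unit_data !xpair_eqE eqxx /= c0 s0.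
  by case: b => /= <-; ring.
have z0 e : end_value (hom z) e false = y (inr (endpoint e false)).
  by rewrite /= /hom /z /= c0 s0 mulr0 mulr1 addr0.
have z1 e : out_value (hom1 z) e false = - y (inl (e, false)).
  by rewrite /= /hom1 /z /= c0 s0 mulr0 mulr1 add0r.
(* [yf] and [vf] carry the data from [len e] back to 0. As [hom z] carries them forward again, the
   Wronskian identity recovers the data at [len e]. *)
have yf e : y (inl (e, false)) =
    - (y (inl (e, true)) * c (len e)) - m * s (len e) * y (inr (endpoint e true)).
  by have := Y0 e false; rewrite /= mulr1 mulr0 addr0; lra.
have vf e : y (inr (endpoint e false)) =
    c (len e) * y (inr (endpoint e true)) - y (inl (e, true)) * s (len e).
  by have := Y0 e true; rewrite /= mulr1 mulr0 add0r; lra.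
have zt e : end_value (hom z) e true = y (inr (endpoint e true)).
  by rewrite /= /hom /z /= yf vf -[RHS]mul1r -(cs1 (len e)); ring.
have zt1 e : out_value (hom1 z) e true = - y (inl (e, true)).
  by rewrite /= /hom1 /z /= yf vf -[y (inl (e, true)) in RHS]mul1r -(cs1 (len e)); ring.
have zv e b : end_value (hom z) e b = y (inr (endpoint e b)) by case: b.
have zo e b : out_value (hom1 z) e b = - y (inl (e, b)) by case: b.
split=> //; first by move=> e b e' b' eb; rewrite !zv eb.
move=> v; have := yP (inr v); rewrite big_sumType /= [X in _ + X]big1 ?addr0; last first.
  by move=> *; rewrite mul0r.
under [X in _ -> X = _]eq_bigr do rewrite zo.
rewrite [X in _ -> X = _]big_mkcond /= => h; rewrite -[RHS]h; apply: eq_bigr => -[e b] _ /=.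
by case: eqP => _; rewrite ?mulN1r // mulNr mul0r oppr0.
Qed.

(** The solution with zero initial data is corrected by a homogeneous one that repairs the vertex
    conditions. Orthogonality of [q] to the kernel is what makes the finite system for the
    correction solvable. *)
Lemma kirchhoff_sol_exists : exists2 C, 0 <= C &
  forall q, (forall e, continuous (q e)) ->
  (forall v v1, kirchhoff_sol m (fun _ _ => 0) v v1 -> ip q v = 0) ->
  exists w w1, kirchhoff_sol m q w w1 /\
    forall M, 0 <= M -> bounded_by M q -> bounded_by (C * M) w.
Proof.
have [C C0 CP] := @ode_zero_data R G m c s c0 s0 dc ds.
have [T TP] := fredholm_alternative vertex_system.
have cc := is_derive_continuous dc; have cs := is_derive_continuous ds.
have [K K0 cK] := @continuous_bounded_by R G (fun=> c) (fun=> cc).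
have [K' K0' sK] := @continuous_bounded_by R G (fun=> s) (fun=> cs).
(* [N * M] will bound the defect [b]: an end value costs [C * M], and a vertex sum has at most
   [#|{: ends}|] terms of that size. *)
pose N := C * (1 + #|{: ends}|%:R).
have N0 : 0 <= N by rewrite mulr_ge0 // addr_ge0.
pose TT := \sum_(i : ends + vertex G) \sum_j `|T j i|.
have TT0 : 0 <= TT by do 2 apply: sumr_ge0 => ? _.
exists (C + N * TT * (K + K')); first by rewrite addr_ge0 // mulr_ge0 // ?mulr_ge0 // addr_ge0.
move=> q cq qorth; have [w0 [w01 [ow0 w00 w010 w0b]]] := CP q cq.
(* Minus the defect of [w0] in the vertex conditions. *)
pose b (j : ends + vertex G) := match j with
  | inl d => - end_value w0 d.1 d.2
  | inr v => - \sum_(d | endpoint d.1 d.2 == v) out_value w01 d.1 d.2 end.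
have bP (y : ends + vertex G -> R) :
    (forall i, \sum_j vertex_system i j * y j = 0) -> \sum_j b j * y j = 0.
  move=> /vertex_system_dual /=; set z := fun d => _; case=> cz bz zv zo.
  have := qorth (hom z) (hom1 z) (And3 (ode_hom dc ds z) cz bz) => qz.
  have c00 (e : edge G) : continuous (fun _ : R => 0 : R) by exact: cst_continuous.
  (* The pairing of [b] with [y] is the opposite of the boundary sum between [w0] and [hom z]. Both
     integrals in Green's identity vanish, so this sum is 0. *)
  have := green cq c00 ow0 (ode_hom dc ds z).
  rewrite qz sub0r [X in - X](_ : _ = 0) ?oppr0; last first.
    rewrite /ip big1 // => e _; under eq_fun do rewrite mulr0.
    by rewrite integral_0to_cst ?len_gt0 // mul0r.
  move=> gr; rewrite big_sumType /=.
  under [X in _ + X]eq_bigr do rewrite mulNr mulr_suml.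
  rewrite [X in _ + X](_ : _ =
      - \sum_d out_value w01 d.1 d.2 * end_value (hom z) d.1 d.2); last first.
    rewrite (partition_big (fun d => endpoint d.1 d.2) predT) //= -sumrN.
    by apply: eq_bigr => v _; congr (- _); apply: eq_bigr => d /eqP dv; rewrite zv dv.
  rewrite -[RHS]oppr0 [in RHS]gr -sumrN -sumrN -big_split /=.
  by apply: eq_bigr => -[e b'] _ /=; rewrite zo; ring.
pose z i := \sum_j' b j' * T j' i.
have zP := TP b bP; rewrite -/z in zP.
have zj j := etrans (esym (vertex_systemE z j)) (zP j).
exists (fun e x => w0 e x + hom (z \o inl) e x), (fun e x => w01 e x + hom1 (z \o inl) e x).
have [oh1 oh2] := ode_hom dc ds (z \o inl).
have endD e b' : end_value (fun e x => w0 e x + hom (z \o inl) e x) e b' = z (inr (endpoint e b')).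
  have /eqP := zj (inl (e, b')); rewrite subr_eq /= => /eqP h.
  transitivity (end_value w0 e b' + end_value (hom (z \o inl)) e b'); first by case: (b').
  by rewrite h addNKr.
split; first split.
- split=> e x; first exact: is_deriveD (ow0.1 e x) (oh1 e x).
  by apply: is_derive_eq (is_deriveD (ow0.2 e x) (oh2 e x)) _; ring.
- by move=> e b1 e' b1' eb; rewrite !endD eb.
- move=> v; have /= h := zj (inr v).
  transitivity (\sum_(d | endpoint d.1 d.2 == v) 
      (out_value w01 d.1 d.2 + out_value (hom1 (z \o inl)) d.1 d.2)).
    by apply: eq_bigr => -[e []] _ //=; rewrite opprD.
  by rewrite big_split /= h subrr.
move=> M M0 qM; have [w0M w01M] := w0b M M0 qM.
have l0 e : 0 <= len e by exact/ltW/len_gt0.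
have valM e b' : `|end_value w0 e b'| <= C * M.
  by case: b' => /=; apply: w0M; rewrite lexx l0.
have outM e b' : `|out_value w01 e b'| <= C * M.
  by case: b' => /=; rewrite ?normrN; apply: w01M; rewrite lexx l0.
have CM0 : 0 <= C * M by rewrite mulr_ge0.
have bM j : `|b j| <= N * M.
  rewrite /N mulrAC mulrDr mulr1; case: j => [d|v] /=; rewrite normrN.
    by apply: (le_trans (valM _ _)); rewrite lerDl mulr_ge0.
  apply: (le_trans (ler_norm_sum _ _ _)).
  apply: (@le_trans _ _ (\sum_(d : ends) C * M)).
    rewrite [leLHS]big_mkcond; apply: ler_sum => d _; case: ifP => // _; exact: outM.
  by rewrite sumr_const -[leLHS]mulr_natr lerDr.
have zM i : `|z i| <= N * TT * M.
  apply: (le_trans (ler_norm_sum _ _ _)).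
  apply: (@le_trans _ _ (\sum_j N * M * `|T j i|)).
    by apply: ler_sum => j _; rewrite normrM ler_wpM2r.
  rewrite -mulr_sumr mulrAC ler_wpM2r // ler_wpM2l //.
  by rewrite /TT [leRHS](bigD1 i) //= lerDl; do 2 apply: sumr_ge0 => ? _.
move=> e x xl; apply: (le_trans (ler_normD _ _)).
rewrite mulrDl lerD //; first exact: w0M.
apply: (le_trans (ler_normD _ _)); rewrite !normrM mulrAC [leRHS]mulrDr lerD //.
  by rewrite ler_pM // ?zM // (cK e).
by rewrite ler_pM // ?zM // (sK e).
Qed.

End Solvability.

(** * The kernel and the reduced resolvent *)

Section InnerProduct.
Variables (R : realType) (G : compact_metric_graph R).
Implicit Types (u v w q : edge G -> R -> R) (e : edge G).

Definition total_length : R := \sum_(e : edge G) len e.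

Lemma total_length_ge0 : 0 <= total_length.
Proof. by apply: sumr_ge0 => e _; exact/ltW/len_gt0. Qed.

Lemma ipC u v : ip u v = ip v u.
Proof. by apply: eq_bigr => e _; apply: eq_integral_0to => x _; rewrite mulrC. Qed.

Lemma eq_ip u v u' v' : (forall e x, 0 <= x <= len e -> u e x = u' e x) ->
  (forall e x, 0 <= x <= len e -> v e x = v' e x) -> ip u v = ip u' v'.
Proof.
by move=> uu vv; apply: eq_bigr => e _; apply: eq_integral_0to => x xl; rewrite uu ?vv.
Qed.

Lemma ipDl u v w : (forall e, continuous (u e)) -> (forall e, continuous (v e)) ->
  (forall e, continuous (w e)) ->
  ip (fun e x => u e x + v e x) w = ip u w + ip v w.
Proof.
move=> cu cv cw; rewrite -big_split /=; apply: eq_bigr => e _.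
rewrite -integral_0toD; try exact: continuous_mul.
by apply: eq_integral_0to => x _; rewrite mulrDl.
Qed.

Lemma ipZl k u w : (forall e, continuous (u e)) -> (forall e, continuous (w e)) ->
  ip (fun e x => k * u e x) w = k * ip u w.
Proof.
move=> cu cw; rewrite mulr_sumr; apply: eq_bigr => e _.
rewrite -integral_0toZ; last exact: continuous_mul.
by apply: eq_integral_0to => x _; rewrite mulrA.
Qed.

Lemma ip0l w : ip (fun _ _ => 0) w = 0.
Proof.
apply: big1 => e _; under eq_fun do rewrite mul0r.
by rewrite integral_0to_cst ?len_gt0 // mul0r.
Qed.

Lemma ipBl u v w : (forall e, continuous (u e)) -> (forall e, continuous (v e)) ->
  (forall e, continuous (w e)) ->
  ip (fun e x => u e x - v e x) w = ip u w - ip v w.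
Proof.
move=> cu cv cw; rewrite -mulN1r -ipZl // -ipDl //.
  by apply: eq_ip => // e x _; rewrite mulN1r.
by move=> e; apply: continuous_cmul.
Qed.

Lemma continuous_sum_fun n (y : 'I_n -> R) (u : 'I_n -> edge G -> R -> R) e :
  (forall i e, continuous (u i e)) -> continuous (fun x => \sum_i y i * u i e x).
Proof.
move=> cu x; apply: cvg_big => [|i _]; first exact: add_continuous.
exact: (@continuous_cmul _ (y i) _ (cu i e) x).
Qed.

Lemma ip_suml n (y : 'I_n -> R) (u : 'I_n -> edge G -> R -> R) w :
  (forall i e, continuous (u i e)) -> (forall e, continuous (w e)) ->
  ip (fun e x => \sum_i y i * u i e x) w = \sum_i y i * ip (u i) w.
Proof.
elim: n y u => [|n IH] y u cu cw.
  rewrite big_ord0 -[RHS](ip0l w); apply: eq_ip => // e x _; exact: big_ord0.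
rewrite big_ord_recl -IH //; try by move=> i; exact: cu.
rewrite -ipZl //; try exact: cu.
rewrite -ipDl //.
- by apply: eq_ip => // e x _; rewrite big_ord_recl.
- by move=> e; apply: continuous_cmul; exact: cu.
- move=> e; apply: (@continuous_sum_fun n (fun i => y (lift ord0 i)) (fun i => u (lift ord0 i)) e).
  by move=> i; exact: cu.
Qed.

Lemma ip_ge0 u : (forall e, continuous (u e)) -> 0 <= ip u u.
Proof.
move=> cu; apply: sumr_ge0 => e _.
rewrite -[0](mul0r (len e)) -(integral_0to_cst 0 (len_gt0 e)).
apply: le_integral_0to; [exact: cst_continuous|exact: continuous_mul|].
by move=> x _; rewrite -expr2 sqr_ge0.
Qed.

Lemma ip_eq0 u : (forall e, continuous (u e)) -> ip u u = 0 ->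
  forall e x, 0 <= x <= len e -> u e x = 0.
Proof.
move=> cu u0 e x xl.
have sq0 e' y : 0 <= u e' y * u e' y by rewrite -expr2 sqr_ge0.
have ge e' : 0 <= integral_0to (len e') (fun x => u e' x * u e' x).
  rewrite -[0](mul0r (len e')) -(integral_0to_cst 0 (len_gt0 e')).
  by apply: le_integral_0to; [exact: cst_continuous|exact: continuous_mul|].
have := psumr_eq0P (fun e' _ => ge e') u0 => /(_ e isT) ie.
have := integral_0to_eq0 (len_gt0 e) (continuous_mul (cu e) (cu e)) (fun y _ => sq0 e y) ie xl.
by move/eqP; rewrite mulf_eq0 orbb => /eqP.
Qed.

Lemma le_ip u v u' v' : (forall e, continuous (u e)) -> (forall e, continuous (v e)) ->
  (forall e, continuous (u' e)) -> (forall e, continuous (v' e)) ->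
  (forall e x, 0 <= x <= len e -> u e x * v e x <= u' e x * v' e x) -> ip u v <= ip u' v'.
Proof.
move=> cu cv cu' cv' h; apply: ler_sum => e _.
by apply: le_integral_0to; [exact: continuous_mul|exact: continuous_mul|exact: h].
Qed.

Lemma ip_cst (a b : R) : ip (fun (_ : edge G) _ => a) (fun _ _ => b) = a * b * total_length.
Proof.
by rewrite mulr_sumr; apply: eq_bigr => e _; rewrite integral_0to_cst ?len_gt0.
Qed.

Lemma ip_bounded M M' u v : 0 <= M -> 0 <= M' ->
  (forall e, continuous (u e)) -> (forall e, continuous (v e)) ->
  bounded_by M u -> bounded_by M' v -> `|ip u v| <= M * M' * total_length.
Proof.
move=> M0 M'0 cu cv uM vM.
have cc (a : R) (e : edge G) : continuous (fun _ : R => a) by exact: cst_continuous.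
rewrite ler_norml; apply/andP; split.
  rewrite -mulNr -mulNr -ip_cst.
  apply: le_ip; [exact: cc|exact: cc|exact: cu|exact: cv|move=> e x xl].
  rewrite /= mulNr lerNl -mulNr (le_trans (ler_norm _)) // normrM normrN.
  by rewrite ler_pM // ?uM ?vM.
rewrite -ip_cst; apply: le_ip; [exact: cu|exact: cv|exact: cc|exact: cc|move=> e x xl].
by rewrite (le_trans (ler_norm _)) // normrM ler_pM // ?uM ?vM.
Qed.

Lemma vertex_continuous_lin (a b : R) w v : vertex_continuous w -> vertex_continuous v ->
  vertex_continuous (fun e x => a * w e x + b * v e x).
Proof.
move=> cw cv e b1 e' b1' eb; have := cw _ _ _ _ eb; have := cv _ _ _ _ eb.
by rewrite /end_value; case: b1 {eb}; case: b1' => /= -> ->.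
Qed.

Lemma vertex_balanced_lin (a b : R) w v : vertex_balanced w -> vertex_balanced v ->
  vertex_balanced (fun e x => a * w e x + b * v e x).
Proof.
move=> bw bv z.
transitivity (a * \sum_(d : edge G * bool | endpoint d.1 d.2 == z) out_value w d.1 d.2 +
  b * \sum_(d : edge G * bool | endpoint d.1 d.2 == z) out_value v d.1 d.2); last first.
  by rewrite bw bv !mulr0 addr0.
by rewrite !mulr_sumr -big_split; apply: eq_bigr => -[e []] _ /=; ring.
Qed.

Lemma ode_lin m (a b : R) q q' w w1 v v1 : ode m q w w1 -> ode m q' v v1 ->
  ode m (fun e x => a * q e x + b * q' e x) (fun e x => a * w e x + b * v e x)
     (fun e x => a * w1 e x + b * v1 e x).
Proof.
move=> [w2 w3] [v2 v3]; split=> e x.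
  exact: is_derive_eq (is_deriveD (is_deriveZ a (w2 e x)) (is_deriveZ b (v2 e x))) _.
apply: is_derive_eq (is_deriveD (is_deriveZ a (w3 e x)) (is_deriveZ b (v3 e x))) _.
by rewrite /GRing.scale /=; ring.
Qed.

Lemma kirchhoff_sol_lin m (a b : R) q q' w w1 v v1 : kirchhoff_sol m q w w1 ->
  kirchhoff_sol m q' v v1 ->
  kirchhoff_sol m (fun e x => a * q e x + b * q' e x) (fun e x => a * w e x + b * v e x)
     (fun e x => a * w1 e x + b * v1 e x).
Proof.
move=> [ow cw bw] [ov cv bv]; split; first exact: ode_lin.
  exact: vertex_continuous_lin.
exact: vertex_balanced_lin.
Qed.

End InnerProduct.

(** * An orthonormal basis of the kernel *)

Section Kernel.
Variables (R : realType) (G : compact_metric_graph R).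
Implicit Types (u v w q : edge G -> R -> R) (e : edge G).
Variables (m : R) (c s : R -> R).
Hypotheses (c0 : c 0 = 1) (s0 : s 0 = 0)
  (dc : forall x : R, is_derive x 1 c (- m * s x))
  (ds : forall x : R, is_derive x 1 s (c x)).
Local Notation hom := (@hom R G c s).
Local Notation hom1 := (@hom1 R G m c s).
Local Notation ends := (edge G * bool)%type.

(** Kernel elements are encoded by their initial data, which places them in a finite-dimensional
    space; [hom_inj] makes the encoding faithful. *)
Definition kernel_data (z : ends -> R) :=
  vertex_continuous (hom z) /\ vertex_balanced (hom1 z).

Lemma kernel_sol z : kernel_data z ->
  kirchhoff_sol m (fun _ _ => 0) (hom z) (hom1 z).
Proof. by move=> [? ?]; split=> //; exact: ode_hom. Qed.

Lemma sol_kernel w w1 : kirchhoff_sol m (fun _ _ => 0) w w1 ->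
  exists2 z, kernel_data z & w = hom z /\ w1 = hom1 z.
Proof.
move=> [ow cw bw]; have := homogeneous_ode_eq c0 s0 dc ds ow.
set z := fun d => _ => zP; exists z; last first.
  by split; apply/funext => e; apply/funext => x; have [] := zP e x.
split.
  by have -> : hom z = w by apply/funext => e; apply/funext => x; have [->] := zP e x.
by have -> : hom1 z = w1 by apply/funext => e; apply/funext => x; have [_ ->] := zP e x.
Qed.

Lemma continuous_hom z e : continuous (hom z e).
Proof. exact: (ode_continuous (ode_hom dc ds z)).1. Qed.

Lemma hom_lin (a b : R) z z' : hom (fun d => a * z d + b * z' d) =
  fun e x => a * hom z e x + b * hom z' e x.
Proof. by apply/funext => e; apply/funext => x; rewrite /hom; ring. Qed.

Lemma hom1_lin (a b : R) z z' : hom1 (fun d => a * z d + b * z' d) =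
  fun e x => a * hom1 z e x + b * hom1 z' e x.
Proof. by apply/funext => e; apply/funext => x; rewrite /hom1; ring. Qed.

Lemma kernel_lin (a b : R) z z' : kernel_data z -> kernel_data z' ->
  kernel_data (fun d => a * z d + b * z' d).
Proof.
move=> [cz bz] [cz' bz']; split; first by rewrite hom_lin; exact: vertex_continuous_lin.
by rewrite hom1_lin; exact: vertex_balanced_lin.
Qed.

Lemma kernel0 : kernel_data (fun=> 0).
Proof.
have h : hom (fun=> 0) = fun _ _ => 0.
  by apply/funext => e; apply/funext => x; rewrite /hom; ring.
have h1 : hom1 (fun=> 0) = fun _ _ => 0.
  by apply/funext => e; apply/funext => x; rewrite /hom1; ring.
split; first by rewrite h => e b e' b' _; case: b; case: b'.
by rewrite h1 => v; apply: big1 => -[e []] _; rewrite /= ?oppr0.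
Qed.

(** The value at 0 gives the first datum. A nonzero second datum would force [s], hence also its
    derivative [c], to vanish at the midpoint, against c^2 + m s^2 = 1. *)
Lemma hom_inj z : (forall e x, 0 <= x <= len e -> hom z e x = 0) -> forall d, z d = 0.
Proof.
move=> h [e b]; have l0 := len_gt0 e.
have zf : z (e, false) = 0.
  by have := h e 0; rewrite /hom c0 s0 mulr1 mulr0 addr0; apply; rewrite lexx ltW.
case: b => //; apply/eqP; apply: contraT => z0.
have sE x : 0 <= x <= len e -> s x = 0.
  move=> /h; rewrite /hom zf mul0r add0r => /eqP; rewrite mulf_eq0 (negPf z0) /=.
  by move/eqP.
have h2 : (len e) / 2 \in `]0, (len e)[ by rewrite in_itv /=; lra.
have sh : s (len e / 2) = 0 by apply: sE; move: h2; rewrite in_itv /= => /andP[? ?]; lra.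
have ch : c (len e / 2) = 0.
  have <- : 'D_1 s (len e / 2) = c (len e / 2) by apply: derive_val.
  have hd : is_derive (len e / 2) 1 s 0.
    apply: (near_eq_is_derive _ (is_derive_cst (0 : R) (len e / 2) 1)).
    near=> x; apply/esym/sE.
    have : x \in `]0, len e[ by near: x; apply: near_in_itvoo; exact: h2.
    by rewrite in_itv /= => /andP[? ?]; lra.
  by apply: derive_val.
have := cos_sin_sqr c0 s0 dc ds (len e / 2); rewrite ch sh => /eqP.
by rewrite !mul0r mulr0 addr0 eq_sym oner_eq0.
Unshelve. all: by end_near. Qed.

Definition orthonormal_kernel n (phi : 'I_n -> ends -> R) :=
  (forall i, kernel_data (phi i)) /\
  forall i j, ip (hom (phi i)) (hom (phi j)) = (i == j)%:R.

Lemma hom_sum n (y : 'I_n -> R) (phi : 'I_n -> ends -> R) :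
  hom (fun d => \sum_i y i * phi i d) = fun e x => \sum_i y i * hom (phi i) e x.
Proof.
apply/funext => e; apply/funext => x; rewrite /hom !mulr_suml -big_split.
by apply: eq_bigr => i _ /=; ring.
Qed.

Lemma kernel_sum n (y : 'I_n -> R) (phi : 'I_n -> ends -> R) :
  (forall i, kernel_data (phi i)) -> kernel_data (fun d => \sum_i y i * phi i d).
Proof.
elim: n y phi => [|n IH] y phi kphi.
  by rewrite (_ : (fun d => _) = fun=> 0);
    [exact: kernel0|apply/funext => d; rewrite big_ord0].
rewrite (_ : (fun d => _) = fun d => y ord0 * phi ord0 d +
   1 * \sum_i y (lift ord0 i) * phi (lift ord0 i) d).
  by apply: kernel_lin => //; apply: (IH _ (fun i => phi (lift ord0 i))).
by apply/funext => d; rewrite big_ord_recl mul1r.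
Qed.

Lemma ip_hom_sum n (y : 'I_n -> R) (phi : 'I_n -> ends -> R) : orthonormal_kernel phi ->
  forall j, ip (hom (fun d => \sum_i y i * phi i d)) (hom (phi j)) = y j.
Proof.
move=> [kphi ophi] j; rewrite hom_sum ip_suml; try by move=> *; exact: continuous_hom.
rewrite (bigD1 j) //= ophi eqxx mulr1 big1 ?addr0 // => i /negPf ij.
by rewrite ophi ij mulr0.
Qed.

(** More data vectors than ends satisfy a nontrivial linear relation, whose coefficients are
    recovered as inner products and hence vanish. *)
Lemma orthonormal_kernel_size n (phi : 'I_n -> ends -> R) :
  orthonormal_kernel phi -> (n <= #|{: ends}|)%N.
Proof.
move=> ophi; rewrite leqNgt; apply/negP => nE.
pose M := \matrix_(i < n, j < #|{: ends}|) phi i (enum_val j).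
have : kermx M != 0.
  rewrite kermx_eq0 /row_free neq_ltn (leq_ltn_trans _ nE) //; exact: rank_leq_col.
move=> /rowV0Pn[v /sub_kermxP vM /eqP]; apply; apply/rowP => j; rewrite mxE.
rewrite -(ip_hom_sum (fun i => v 0 i) ophi j).
rewrite (_ : (fun d => _) = fun=> 0).
  rewrite (_ : hom _ = fun _ _ => 0) ?ip0l //.
  by apply/funext => e; apply/funext => x; rewrite /hom; ring.
apply/funext => d; move/rowP/(_ (enum_rank d)): vM; rewrite !mxE => h.
by rewrite -[RHS]h; apply: eq_bigr => i _; rewrite mxE enum_rankK.
Qed.

Definition proj n (phi : 'I_n -> ends -> R) q e (x : R) : R :=
  \sum_i ip q (hom (phi i)) * hom (phi i) e x.

Lemma orthonormal_kernel_extend n (phi : 'I_n -> ends -> R) z :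
  orthonormal_kernel phi -> kernel_data z ->
  (forall i, ip (hom z) (hom (phi i)) = 0) -> (exists d, z d != 0) ->
  exists phi' : 'I_n.+1 -> ends -> R, orthonormal_kernel phi'.
Proof.
move=> [kphi ophi] kz zphi [d zd].
have ch := continuous_hom.
pose N := ip (hom z) (hom z).
have N0 : 0 < N.
  rewrite lt_neqAle ip_ge0 ?andbT; last exact: ch.
  apply: contra_neq zd => N0; apply: hom_inj.
  by apply: ip_eq0; [exact: ch|rewrite -/N -N0].
pose k := (Num.sqrt N)^-1.
have kk : k * (k * N) = 1.
  rewrite -[X in _ * (_ * X)](sqr_sqrtr (ltW N0)) /k; field.
  by rewrite sqrtr_eq0 -ltNge.
(* The null second summand gives the shape of [kernel_lin] and [hom_lin]. *)
pose z' d := k * z d + 0 * z d.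
have hz' : hom z' = fun e x => k * hom z e x.
  by rewrite hom_lin; apply/funext => e; apply/funext => x; ring.
have oz' i : ip (hom z') (hom (phi i)) = 0.
  by rewrite hz' ipZl ?zphi ?mulr0 //; exact: ch.
have nz' : ip (hom z') (hom z') = 1.
  have cz e : continuous (fun x => k * hom z e x) by exact: continuous_cmul (ch z e).
  rewrite hz' ipZl; [|exact: ch|exact: cz].
  by rewrite ipC ipZl; [exact: kk|exact: ch|exact: ch].
exists (fun i => if unlift ord0 i is Some j then phi j else z'); split.
  by move=> i; case: unliftP => [j|] _ //; exact: kernel_lin.
move=> i j; case: unliftP => [i'|] ->; case: unliftP => [j'|] ->.
- by rewrite ophi (inj_eq (@lift_inj _ _)).
- by rewrite ipC oz' eq_sym (negPf (neq_lift _ _)).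
- by rewrite oz' (negPf (neq_lift _ _)).
- by rewrite nz' eqxx.
Qed.

(** A family of maximal size spans: otherwise [z] minus its projection would extend it. The size is
    0 exactly when [m] is not an eigenvalue, and the theorem is decided on this alternative. *)
Lemma kernel_basis : exists n (phi : 'I_n -> ends -> R), orthonormal_kernel phi /\
  forall z, kernel_data z -> forall d, z d = \sum_i ip (hom z) (hom (phi i)) * phi i d.
Proof.
pose Q n := `[< exists phi : 'I_n -> ends -> R, orthonormal_kernel phi >].
have Q0 : exists n, Q n.
  by exists 0%N; apply/asboolP; exists (fun _ _ => 0); split=> -[].
have Qb n : Q n -> (n <= #|{: ends}|)%N.
  by move=> /asboolP[phi]; exact: orthonormal_kernel_size.
have [n /asboolP[phi ophi] nmax] := ex_maxnP Q0 Qb.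
exists n, phi; split=> // z kz d; apply/eqP; rewrite -subr_eq0; apply: contraT => nz.
pose y i := ip (hom z) (hom (phi i)).
pose z' d := 1 * z d + -1 * \sum_i y i * phi i d.
have kz' : kernel_data z' by apply: kernel_lin => //; apply: kernel_sum; exact: ophi.1.
have [||phi' ophi'] := orthonormal_kernel_extend ophi kz'.
- have ch := continuous_hom.
  move=> j; rewrite hom_lin ipDl; try by move=> *; apply: continuous_cmul; exact: ch.
    rewrite !ipZl; try by move=> *; exact: ch.
    by rewrite ip_hom_sum // /y; ring.
  by move=> *; exact: ch.
- by exists d; rewrite /z' mul1r mulN1r.
- have /nmax : Q n.+1 by apply/asboolP; exists phi'.
  by rewrite ltnn.
Qed.

End Kernel.

(** * The inverse of L on the orthogonal complement of the kernel *)

Section ReducedResolvent.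
Variables (R : realType) (G : compact_metric_graph R).
Implicit Types (u v w q : edge G -> R -> R) (e : edge G).
Variables (m : R) (c s : R -> R).
Hypotheses (c0 : c 0 = 1) (s0 : s 0 = 0)
  (dc : forall x : R, is_derive x 1 c (- m * s x))
  (ds : forall x : R, is_derive x 1 s (c x)).
Local Notation hom := (@hom R G c s).
Local Notation ends := (edge G * bool)%type.
Variables (n : nat) (phi : 'I_n -> ends -> R).
Hypotheses (ophi : orthonormal_kernel m c s phi)
  (basis : forall z, kernel_data m c s z ->
     forall d, z d = \sum_i ip (hom z) (hom (phi i)) * phi i d).
Local Notation proj := (proj c s phi).

Let ch : forall z e, continuous (hom z e).
Proof. by move=> z e; exact: (continuous_hom dc ds). Qed.

(** The graph of the reduced resolvent: the inverse of L on the complement of K, extended by 0 on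
    K. *)
Definition reduced_sol q w :=
  (exists w1, kirchhoff_sol m (fun e x => q e x - proj q e x) w w1) /\
  forall i, ip w (hom (phi i)) = 0.

Lemma continuous_proj q e : continuous (proj q e).
Proof.
exact: (@continuous_sum_fun R G n _ (fun i => hom (phi i)) e (fun i e' => @ch (phi i) e')).
Qed.

Lemma ip_proj q j : ip (proj q) (hom (phi j)) = ip q (hom (phi j)).
Proof. by rewrite -[proj q]hom_sum (ip_hom_sum dc ds _ ophi). Qed.

Lemma continuous_compl q : (forall e, continuous (q e)) ->
  forall e, continuous (fun x => q e x - proj q e x).
Proof. by move=> cq e; apply: continuous_sub => //; exact: continuous_proj. Qed.

Lemma kernel_bounded : exists2 B, 0 <= B & forall i, bounded_by B (hom (phi i)).
Proof.
have /choice[B BP] i : exists B, 0 <= B /\ bounded_by B (hom (phi i)).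
  by have [B B0 BP] := continuous_bounded_by (fun e => @ch (phi i) e); exists B.
exists (\sum_i B i) => [|i e x xl]; first by apply: sumr_ge0 => i _; case: (BP i).
apply: (le_trans ((BP i).2 e x xl)); rewrite (bigD1 i) //= lerDl sumr_ge0 // => j _.
by case: (BP j).
Qed.

Lemma proj_bounded : exists2 C, 0 <= C & forall q M, (forall e, continuous (q e)) ->
  0 <= M -> bounded_by M q -> bounded_by (C * M) (proj q).
Proof.
have [B B0 BP] := kernel_bounded.
exists (n%:R * (B * total_length G * B)).
  by rewrite !mulr_ge0 // total_length_ge0.
move=> q M cq M0 qM e x xl; apply: (le_trans (ler_norm_sum _ _ _)).
apply: (@le_trans _ _ (\sum_(i < n) M * B * total_length G * B)).
  apply: ler_sum => i _; rewrite normrM ler_pM // ?BP //.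
  by apply: ip_bounded => //; exact: ch.
by rewrite sumr_const card_ord -mulr_natl; lra.
Qed.

Lemma reduced_sol_continuous q w : reduced_sol q w -> forall e, continuous (w e).
Proof. by move=> [[w1 [ow _ _]] _]; exact: (ode_continuous ow).1. Qed.

Lemma proj_sub q q' : (forall e, continuous (q e)) -> (forall e, continuous (q' e)) ->
  forall e x, proj (fun e x => q e x - q' e x) e x = proj q e x - proj q' e x.
Proof.
move=> cq cq' e x; rewrite -sumrB; apply: eq_bigr => i _.
by rewrite ipBl // ?mulrBl //; exact: ch.
Qed.

Lemma reduced_sol_sub q q' w w' : (forall e, continuous (q e)) ->
  (forall e, continuous (q' e)) -> reduced_sol q w -> reduced_sol q' w' ->
  reduced_sol (fun e x => q e x - q' e x) (fun e x => w e x - w' e x).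
Proof.
move=> cq cq' rw rw'.
have cw := reduced_sol_continuous rw; have cw' := reduced_sol_continuous rw'.
case: rw rw' => [[w1 kw] wo] [[w1' kw'] wo']; split; last first.
  by move=> i; rewrite ipBl // ?wo ?wo' ?subrr //; exact: ch.
exists (fun e x => 1 * w1 e x + -1 * w1' e x).
rewrite (_ : (fun e x => w e x - w' e x) = fun e x => 1 * w e x + -1 * w' e x); last first.
  by apply/funext => e; apply/funext => x; ring.
rewrite (_ : (fun e x => _ - proj _ _ _) = fun e x => 1 * (q e x - proj q e x) +
    -1 * (q' e x - proj q' e x)); first exact: kirchhoff_sol_lin.
by apply/funext => e; apply/funext => x; rewrite proj_sub //; ring.
Qed.

Lemma reduced_sol0_eq0 w : reduced_sol (fun _ _ => 0) w -> forall e x, w e x = 0.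
Proof.
move=> [[w1 kw] wo]; move: kw.
rewrite (_ : (fun e x => _) = fun _ _ => 0); last first.
  apply/funext => e; apply/funext => x; rewrite /proj big1 ?subrr // => i _.
  by rewrite ip0l mul0r.
move=> /(sol_kernel c0 s0 dc ds)[z kz [wz _]] e x.
have z0 d : z d = 0.
  by rewrite (basis kz) big1 // => i _; rewrite -wz wo mul0r.
by rewrite wz /hom !z0; ring.
Qed.

Lemma reduced_sol_exists : exists2 C, 0 <= C &
  forall q, (forall e, continuous (q e)) -> exists w, reduced_sol q w /\
    forall M, 0 <= M -> bounded_by M q -> bounded_by (C * M) w.
Proof.
have [C C0 CP] := @kirchhoff_sol_exists R G m c s c0 s0 dc ds.
have [C' C'0 C'P] := proj_bounded.
(* The two factors [1 + C'] are the costs of removing the kernel component from [w] and from [q]. *)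
exists ((1 + C') * (C * (1 + C'))); first by rewrite !mulr_ge0 ?addr_ge0.
move=> q cq; have cq' := continuous_compl cq.
have [|w [w1 [kw wM]]] := CP _ cq'.
  move=> v v1 /(sol_kernel c0 s0 dc ds)[z kz [-> _]].
  have zE : z = fun d => \sum_i ip (hom z) (hom (phi i)) * phi i d.
    by apply/funext => d; exact: basis.
  have -> : hom z = fun e x => \sum_i ip (hom z) (hom (phi i)) * hom (phi i) e x.
    by rewrite -hom_sum -zE.
  rewrite ipC ip_suml //; try by move=> *; exact: ch.
  apply: big1 => i _; rewrite [ip (hom (phi i)) _]ipC ipBl //; try by move=> *; exact: ch.
    by rewrite ip_proj subrr mulr0.
  by move=> e'; exact: continuous_proj.
have cw := (ode_continuous (let: And3 ow _ _ := kw in ow)).1.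
exists (fun e x => w e x - proj w e x); split; first split.
- have := kirchhoff_sol_lin 1 (-1) kw (kernel_sol dc ds (kernel_sum
     (fun i => ip w (hom (phi i))) ophi.1)).
  set w2 := (X in kirchhoff_sol _ _ _ X); move=> kw2; exists w2.
  rewrite (_ : (fun e x => w e x - proj w e x) = fun e x => 1 * w e x + -1 *
     hom (fun d => \sum_i ip w (hom (phi i)) * phi i d) e x); last first.
    by apply/funext => e; apply/funext => x; rewrite hom_sum mul1r mulN1r.
  rewrite (_ : (fun e x => q e x - proj q e x) =
    fun e x => 1 * (q e x - proj q e x) + -1 * 0) //.
  by apply/funext => e; apply/funext => x; ring.
- move=> i; rewrite ipBl; [|exact: cw|move=> e; exact: continuous_proj|exact: ch].
  by rewrite ip_proj subrr.
move=> M M0 qM.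
have qM' : bounded_by ((1 + C') * M) (fun e x => q e x - proj q e x).
  move=> e x xl; apply: (le_trans (ler_normB _ _)).
  by rewrite mulrDl mul1r lerD // ?qM // C'P.
have CM0 : 0 <= (1 + C') * M by rewrite mulr_ge0 ?addr_ge0.
have wM' := wM _ CM0 qM'.
have CCM0 : 0 <= C * ((1 + C') * M) by rewrite mulr_ge0.
move=> e x xl; apply: (le_trans (ler_normB _ _)).
apply: (@le_trans _ _ (C * ((1 + C') * M) + C' * (C * ((1 + C') * M)))); last by lra.
by rewrite lerD // ?wM' // C'P.
Qed.

(** By linearity and uniqueness every reduced solution is the constructed one and inherits its
    bound. *)
Lemma reduced_sol_bounded : exists2 C, 0 <= C &
  forall q w M, (forall e, continuous (q e)) -> 0 <= M -> bounded_by M q ->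
    reduced_sol q w -> bounded_by (C * M) w.
Proof.
have [C C0 CP] := reduced_sol_exists; exists C => // q w M cq M0 qM rw.
have [w' [rw' w'M]] := CP q cq.
have := reduced_sol_sub cq cq rw rw'.
rewrite (_ : (fun e x => q e x - q e x) = fun _ _ => 0); last first.
  by apply/funext => e; apply/funext => x; rewrite subrr.
move=> /reduced_sol0_eq0 h e x xl; have /eqP := h e x.
by rewrite subr_eq0 => /eqP ->; exact: w'M.
Qed.

Lemma ip_compl q w : (forall e, continuous (q e)) -> (forall e, continuous (w e)) ->
  (forall i, ip w (hom (phi i)) = 0) ->
  ip (fun e x => q e x - proj q e x) w = ip q w.
Proof.
move=> cq cw wo; rewrite ipBl //; last by move=> e; exact: continuous_proj.
rewrite [ip (proj q) w]ip_suml //; try by move=> *; exact: ch.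
by rewrite big1 ?subr0 // => i _; rewrite [ip (hom (phi i)) _]ipC wo mulr0.
Qed.

(** The kernel components removed from [q] and [q'] are invisible to [w'] and [w], so this reduces
    to [kirchhoff_sol_sym]. *)
Lemma reduced_sol_sym q q' w w' : (forall e, continuous (q e)) ->
  (forall e, continuous (q' e)) -> reduced_sol q w -> reduced_sol q' w' ->
  ip q w' = ip w q'.
Proof.
move=> cq cq' rw rw'.
have cw := reduced_sol_continuous rw; have cw' := reduced_sol_continuous rw'.
case: rw rw' => [[w1 kw] wo] [[w1' kw'] wo'].
rewrite -(ip_compl cq cw' wo') [RHS]ipC -(ip_compl cq' cw wo) [RHS]ipC.
by apply: kirchhoff_sol_sym kw kw'; exact: continuous_compl.
Qed.

End ReducedResolvent.

(** * The nonlinearity *)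

Section Nonlinearity.
Variable R : realType.
Implicit Types (a b x y B r : R).

Definition locally_lipschitz (g : R -> R) := forall B, 0 <= B ->
  exists2 K, 0 <= K & forall a b, `|a| <= B -> `|b| <= B -> `|g a - g b| <= K * `|a - b|.

Lemma locally_lipschitz_continuous (g : R -> R) : locally_lipschitz g -> continuous g.
Proof.
move=> lg x; have [|K K0 KP] := lg (`|x| + 1); first by rewrite addr_ge0.
apply/cvgrPdist_lt => eps eps0; near=> y.
have xy : `|x - y| < Num.min 1 (eps / (K + 1)).
  near: y; apply: cvgr_dist_lt => //.
  by rewrite lt_min ltr01 divr_gt0 // ltr_wpDl.
move: xy; rewrite lt_min => /andP[xy1 xye].
have yB : `|y| <= `|x| + 1.
  have -> : y = x - (x - y) by ring.
  by apply: (le_trans (ler_normB _ _)); rewrite lerD // ltW.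
have xB : `|x| <= `|x| + 1 by rewrite lerDl.
apply: (le_lt_trans (KP _ _ xB yB)).
apply: (@le_lt_trans _ _ ((K + 1) * `|x - y|)); first by rewrite ler_wpM2r // lerDl.
by rewrite mulrC -ltr_pdivlMr // ltr_wpDl.
Unshelve. all: by end_near. Qed.

(** The tangent inequality for the convex function x^r at y, obtained from Young's inequality with
    exponents r and r / (r - 1). *)
Lemma powR_convex_tangent r x y : 1 < r -> 0 <= x -> 0 <= y ->
  r * y `^ (r - 1) * x <= x `^ r + (r - 1) * y `^ r.
Proof.
move=> r1 x0 y0; have r0 : 0 < r by lra.
have q0 : 0 < r / (r - 1) by rewrite divr_gt0 //; lra.
have rn0 : r != 0 by lra.
have r1n0 : r - 1 != 0 by lra.
have := @conjugate_powR R x (y `^ (r - 1)) r (r / (r - 1)) x0 (powR_ge0 _ _) r0 q0.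
rewrite -powRrM (_ : (r - 1) * (r / (r - 1)) = r); last by field.
move=> /(_ _)/wrap[]; first by field; rewrite r1n0 rn0.
rewrite -(ler_pM2l r0) => h.
apply: le_trans (_ : r * (x `^ r / r + y `^ r / (r / (r - 1))) <= _); first by lra.
rewrite le_eqVlt; apply/orP; left; apply/eqP; field; by rewrite r1n0 rn0.
Qed.

(** The tangent at the point with the larger value bounds the drop to the smaller one. *)
Lemma powR_locally_lipschitz r : 1 < r -> locally_lipschitz (fun a => `|a| `^ r).
Proof.
move=> r1 B B0; exists (r * B `^ (r - 1)) => [|a b].
  by rewrite mulr_ge0 ?powR_ge0 //; lra.
wlog ab : a b / `|a| `^ r <= `|b| `^ r.
  move=> W aB bB; case: (leP (`|a| `^ r) (`|b| `^ r)) => [h|/ltW h]; first exact: W.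
  by rewrite distrC [`|a - b|]distrC; exact: W.
move=> aB bB; rewrite ler0_norm ?subr_le0 // opprB.
have t := powR_convex_tangent r1 (normr_ge0 a) (normr_ge0 b).
have bb : `|b| `^ r = `|b| `^ (r - 1) * `|b|.
  by rewrite mulrC mulr_powRB1 //; lra.
have k : `|b| `^ (r - 1) <= B `^ (r - 1).
  by rewrite ge0_ler_powR // ?nnegrE //; lra.
have ba : `|b| - `|a| <= `|a - b| by rewrite distrC lerB_dist.
apply: (@le_trans _ _ (r * `|b| `^ (r - 1) * (`|b| - `|a|))); first
  by rewrite mulrBr -[r * _ * `|b|]mulrA -bb; lra.
apply: (@le_trans _ _ (r * `|b| `^ (r - 1) * `|a - b|)).
  by rewrite ler_wpM2l // mulr_ge0 ?powR_ge0 //; lra.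
by rewrite ler_wpM2r // ler_wpM2l //; lra.
Qed.

Variable p : R.
Hypothesis p6 : 6 < p.

Definition nonlin a : R := `|a| `^ (p - 2) * a.

Definition potential a : R := `|a| `^ p / p.

Lemma nonlin0 : nonlin 0 = 0. Proof. by rewrite /nonlin mulr0. Qed.

Lemma potential_ge0 a : 0 <= potential a.
Proof.
have p_gt6 := p6.
by rewrite divr_ge0 ?powR_ge0 //; lra.
Qed.

Lemma powR_normM2 a : `|a| `^ p = `|a| `^ (p - 2) * a ^+ 2.
Proof.
have p_gt6 := p6.
have -> : a ^+ 2 = `|a| * `|a| by rewrite -normrM -expr2 ger0_norm // sqr_ge0.
have e1 : `|a| `^ (p - 1) = `|a| * `|a| `^ (p - 2).
  have -> : p - 2 = p - 1 - 1 by ring.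
  by rewrite mulr_powRB1 //; lra.
by rewrite -(@mulr_powRB1 _ `|a| p) //; [rewrite e1; ring|lra].
Qed.

Lemma nonlin_scale r a : 0 < r -> nonlin (r * a) = r `^ (p - 2) * (r * nonlin a).
Proof.
by move=> r0; rewrite /nonlin normrM (gtr0_norm r0) powRM ?(ltW r0) // -!mulrA [X in _ * X]mulrCA.
Qed.

Lemma nonlin_small B a : 0 <= B -> `|a| <= B -> `|nonlin a| <= B `^ (p - 2) * `|a|.
Proof.
have p_gt6 := p6.
move=> B0 aB; rewrite normrM ler_wpM2r // ger0_norm ?powR_ge0 //.
by rewrite ge0_ler_powR // ?nnegrE //; lra.
Qed.

Lemma nonlin_lipschitz : locally_lipschitz nonlin.
Proof.
have p_gt6 := p6.
move=> B B0; have [|K K0 KP] := @powR_locally_lipschitz (p - 2) _ B B0; first by lra.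
exists (B `^ (p - 2) + K * B) => [|a b aB bB].
  by rewrite addr_ge0 ?powR_ge0 ?mulr_ge0.
have -> : nonlin a - nonlin b = `|a| `^ (p - 2) * (a - b) + (`|a| `^ (p - 2) - `|b| `^ (p - 2)) * b.
  by rewrite /nonlin; ring.
apply: (le_trans (ler_normD _ _)); rewrite !normrM mulrDl lerD //.
  rewrite ler_wpM2r // ger0_norm ?powR_ge0 //.
  by rewrite ge0_ler_powR // ?nnegrE //; lra.
by rewrite mulrAC ler_pM // KP.
Qed.

(** Convexity, in the form of a subgradient inequality. It is the link through which the argument
    uses that [nonlin] is the derivative of [potential]. *)
Lemma potential_tangent a b : potential b + nonlin b * (a - b) <= potential a.
Proof.
have p_gt6 := p6.
have p1 : 1 < p by lra.
have := powR_convex_tangent p1 (normr_ge0 a) (normr_ge0 b).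
have bb : nonlin b * b = `|b| `^ p by rewrite powR_normM2 /nonlin; ring.
have ba : nonlin b * a <= `|b| `^ (p - 1) * `|a|.
  apply: (le_trans (ler_norm _)); rewrite /nonlin !normrM ler_wpM2r //.
  rewrite (ger0_norm (powR_ge0 _ _)) mulrC.
  have -> : p - 2 = p - 1 - 1 by ring.
  by rewrite mulr_powRB1 //; lra.
move=> h; rewrite /potential mulrBr bb.
have p0 : 0 < p by lra.
rewrite -(ler_pM2l p0) mulrDr ![p * (_ / p)]mulrC !divfK ?gt_eqF // mulrBr.
have : p * (nonlin b * a) <= p * (`|b| `^ (p - 1) * `|a|) by rewrite ler_pM2l.
by lra.
Qed.

(** For |a| >= p one has |a|^(p-2) >= |a| >= p, so the potential exceeds a^2. The coefficient 1
    beats the 1/2 of the quadratic term in the energy on large spheres. *)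
Lemma potential_ge_quadratic a : a ^+ 2 - p ^+ 2 <= potential a.
Proof.
have p_gt6 := p6.
have p0 : 0 < p by lra.
have [ap|pa] := ltP `|a| p.
  apply: le_trans (potential_ge0 a); rewrite subr_le0 -[a ^+ 2]ger0_norm ?sqr_ge0 //.
  by rewrite normrX ler_sqr ?nnegrE // ltW.
apply: (@le_trans _ _ (a ^+ 2)); first by rewrite gerBl sqr_ge0.
rewrite /potential powR_normM2 mulrAC ler_peMl ?sqr_ge0 // ler_pdivlMr // mul1r.
apply: (le_trans pa); apply: le1r_powR; lra.
Qed.

(** Here 1 / p <= 1 / 6; against the 1/2 of the quadratic term this leaves 1/3 and makes the energy
    positive near 0. *)
Lemma potential_le_quadratic a : `|a| <= 1 -> potential a <= a ^+ 2 / 6.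
Proof.
have p_gt6 := p6.
move=> a1; rewrite /potential powR_normM2.
have : `|a| `^ (p - 2) <= 1.
  have one : (1 : R) `^ (p - 2) = 1 by rewrite powR1.
  by rewrite -[leRHS]one ge0_ler_powR // ?nnegrE //; lra.
move=> k; apply: ler_pM.
- by rewrite mulr_ge0 ?powR_ge0 ?sqr_ge0.
- by rewrite invr_ge0; lra.
- by rewrite ler_piMl ?sqr_ge0.
- by rewrite lef_pV2 ?posrE; lra.
Qed.

Lemma potential_lipschitz : locally_lipschitz potential.
Proof.
have p_gt6 := p6.
move=> B B0; exists (B `^ (p - 2) * B) => [|a b].
  by rewrite mulr_ge0 ?powR_ge0.
wlog ab : a b / potential a <= potential b.
  move=> W aB bB; case: (leP (potential a) (potential b)) => [h|/ltW h]; first exact: W.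
  by rewrite distrC [`|a - b|]distrC; exact: W.
move=> aB bB; rewrite ler0_norm ?subr_le0 // opprB.
have t := potential_tangent a b.
apply: (@le_trans _ _ (nonlin b * (b - a))); first by lra.
apply: (le_trans (ler_norm _)); rewrite normrM distrC ler_wpM2r //.
by apply: (le_trans (nonlin_small B0 bB)); rewrite ler_wpM2l ?powR_ge0.
Qed.

Lemma continuous_nonlin : continuous nonlin.
Proof. exact/locally_lipschitz_continuous/nonlin_lipschitz. Qed.

Lemma continuous_potential : continuous potential.
Proof. exact/locally_lipschitz_continuous/potential_lipschitz. Qed.

End Nonlinearity.

(** * Lyapunov-Schmidt reduction and maximisation on the kernel *)

Section GeometricConvergence.
Variable R : realType.

Lemma le_geometric (C a b : R) : (forall k : nat, a <= b + C * 2^-1 ^+ k) -> a <= b.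
Proof.
move=> h; apply/ler_addgt0Pr => eps eps0.
have [k hk] : exists k : nat, C * 2^-1 ^+ k < eps.
  exists (Num.bound (`|C| / eps)); set k := Num.bound _.
  have k2 : 0 < 2 ^+ k :> R by rewrite exprn_gt0.
  rewrite exprVn ltr_pdivrMr // mulrC -ltr_pdivrMr //.
  have Ce : 0 <= `|C| / eps by rewrite divr_ge0 // ltW.
  apply: (@le_lt_trans _ _ (`|C| / eps)).
    by rewrite ler_wpM2r ?ler_norm // invr_ge0 ltW.
  apply: (lt_le_trans (archi_boundP Ce)); rewrite -natrX ler_nat -/k.
  by rewrite ltnW // ltn_expl.
by apply: (le_trans (h k)); rewrite lerD2l ltW.
Qed.

(** The intervals of radius 2 C 2^-k around [u k] are nested; the limit is the supremum of their
    left ends. *)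
Lemma geometric_limit (u : nat -> R) (C : R) : 0 <= C ->
  (forall k, `|u k.+1 - u k| <= C * 2^-1 ^+ k) ->
  exists l, forall k, `|l - u k| <= 2 * C * 2^-1 ^+ k.
Proof.
move=> C0 uC; pose a k := u k - 2 * C * 2^-1 ^+ k; pose b k := u k + 2 * C * 2^-1 ^+ k.
have step k : a k <= a k.+1 /\ b k.+1 <= b k.
  have := uC k; rewrite ler_norml /a /b exprS => /andP[h1 h2].
  by split; lra.
have a_mono k j : (k <= j)%N -> a k <= a j.
  move=> /subnKC <-; elim: (j - k)%N => [|i IH]; first by rewrite addn0.
  by rewrite addnS (le_trans IH) // (step _).1.
have b_mono k j : (k <= j)%N -> b j <= b k.
  move=> /subnKC <-; elim: (j - k)%N => [|i IH]; first by rewrite addn0.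
  by rewrite addnS (le_trans _ IH) // (step _).2.
have ab_le k j : a k <= b j.
  apply: (le_trans (a_mono _ _ (leq_maxl k j))).
  apply: (le_trans _ (b_mono _ _ (leq_maxr k j))).
  by rewrite /a /b lerD2l ge0_cp // !mulr_ge0 // exprn_ge0 // invr_ge0.
have ne : range a !=set0 by exists (a 0%N); exists 0%N.
have hs : has_sup (range a).
  by split=> //; exists (b 0%N) => _ [k _ <-]; exact: ab_le.
exists (sup (range a)) => k.
have l1 : a k <= sup (range a) by apply: sup_upper_bound => //; exists k.
have l2 : sup (range a) <= b k by apply: ge_sup => // _ [j _ <-]; exact: ab_le.
by rewrite ler_norml; move: l1 l2; rewrite /a /b => l1 l2; apply/andP; split; lra.
Qed.

End GeometricConvergence.

Section FixedPoint.
Variables (R : realType) (G : compact_metric_graph R).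
Implicit Types (u v w : edge G -> R -> R) (e : edge G).

(** Banach's fixed point theorem on the unit ball for the sup norm over the edges. The fixed point
    equation is obtained on the edges only. *)
Lemma contraction_fixpoint (T : (edge G -> R -> R) -> (edge G -> R -> R)) :
  (forall u, (forall e, continuous (u e)) -> bounded_by 1 u ->
     (forall e, continuous (T u e)) /\ bounded_by 1 (T u)) ->
  (forall u v, (forall e, continuous (u e)) -> (forall e, continuous (v e)) ->
     bounded_by 1 u -> bounded_by 1 v -> forall d, 0 <= d ->
     bounded_by d (fun e x => u e x - v e x) ->
     bounded_by (2^-1 * d) (fun e x => T u e x - T v e x)) ->
  exists u, [/\ forall e, continuous (u e), bounded_by 1 u &
    forall e x, 0 <= x <= len e -> T u e x = u e x].
Proof.
move=> T1 T2.
have l0 e : 0 <= len e by exact/ltW/len_gt0.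
(* Bounds hold on the edges while continuity is asked on R; clamping makes the iterates converge
   uniformly on R. *)
pose S u e x := T u e (clamp (len e) x).
pose U := fix U k := if k is k'.+1 then S (U k') else fun _ _ => 0.
have Uin k : (forall e, continuous (U k e)) /\ bounded_by 1 (U k).
  elim: k => [|k [cU bU]] /=.
    by split=> [e|e x _]; [exact: cst_continuous|rewrite normr0].
  have [cT bT] := T1 _ cU bU; split=> [e x|e x xl].
    by apply: continuous_comp; [exact: clamp_continuous|exact: cT].
  by rewrite /S; apply: bT; rewrite clamp_in.
have half0 k : 0 <= 2^-1 ^+ k :> R by rewrite exprn_ge0 // invr_ge0.
have SS u v d : (forall e, continuous (u e)) -> (forall e, continuous (v e)) ->
    bounded_by 1 u -> bounded_by 1 v -> 0 <= d -> bounded_by d (fun e x => u e x - v e x) ->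
    forall e x, `|S u e x - S v e x| <= 2^-1 * d.
  by move=> cu cv bu bv d0 duv e x; apply: T2 => //; rewrite clamp_in.
have Ud k e x : `|U k.+1 e x - U k e x| <= 1 * 2^-1 ^+ k.
  elim: k e x => [|k IH] e x.
    have [cT bT] := T1 _ (Uin 0%N).1 (Uin 0%N).2.
    by rewrite /= subr0 mulr1; apply: bT; rewrite clamp_in.
  have [cU1 bU1] := Uin k.+1; have [cU bU] := Uin k.
  have d0 : 0 <= 1 * 2^-1 ^+ k :> R by rewrite mulr_ge0.
  rewrite exprS mulrCA; apply: (SS _ _ _ cU1 cU bU1 bU d0 _ e x).
  by move=> e' x' _; exact: IH.
have /choice[u uP] (ex : edge G * R) : exists l, forall k,
    `|l - U k ex.1 ex.2| <= 2 * 1 * 2^-1 ^+ k.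
  by apply: geometric_limit => // k; exact: Ud.
pose V e x := u (e, x).
have VU k e x : `|V e x - U k e x| <= 2 * 2^-1 ^+ k.
  by have := uP (e, x) k; rewrite mulr1.
have cV e : continuous (V e).
  move=> x; apply/cvgrPdist_le => eps eps0.
  have [k hk] : exists k : nat, 2 * 2^-1 ^+ k <= eps / 3.
    apply: contrapT => /forallNP h.
    suff : eps / 3 <= 0 by lra.
    apply: (@le_geometric _ 2) => k; rewrite add0r.
    by have := h k; move/negP; rewrite -ltNge => /ltW.
  near=> y.
  have h1 : `|U k e x - U k e y| <= eps / 3.
    near: y; have := (Uin k).1 e x => /cvgrPdist_le; apply; lra.
  have h2 := VU k e x; have h3 := VU k e y.
  rewrite distrC in h3.
  have -> : V e x - V e y = (V e x - U k e x) + ((U k e x - U k e y) + (U k e y - V e y)).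
    by ring.
  apply: (le_trans (ler_normD _ _)).
  have := ler_normD (U k e x - U k e y) (U k e y - V e y).
  by lra.
have bV : bounded_by 1 V.
  move=> e x xl; apply: (@le_geometric _ 2) => k.
  have -> : V e x = U k e x + (V e x - U k e x) by ring.
  by apply: (le_trans (ler_normD _ _)); rewrite lerD // (Uin k).2.
exists V; split=> // e x xl; apply/eqP; rewrite -subr_eq0 -normr_le0.
apply: (@le_geometric _ 2) => k; rewrite add0r.
have [cU bU] := Uin k.
have TS : T V e x - U k.+1 e x = S V e x - S (U k) e x by rewrite /= /S clampE.
have h1 : `|T V e x - U k.+1 e x| <= 2^-1 * (2 * 2^-1 ^+ k).
  have d0 : 0 <= 2 * 2^-1 ^+ k :> R by rewrite mulr_ge0.
  rewrite TS; apply: (SS _ _ _ cV cU bV bU d0 _ e x).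
  by move=> e' x' _; exact: VU.
have h2 := VU k.+1 e x; rewrite distrC exprS in h2.
have -> : T V e x - V e x = (T V e x - U k.+1 e x) + (U k.+1 e x - V e x) by ring.
by apply: (le_trans (ler_normD _ _)); lra.
Unshelve. all: by end_near. Qed.

End FixedPoint.

(** Excludes a positive maximum on the sphere [normsq y = r]; the second inequality is the one of
    [energy_upper], with q = p^2. *)
Lemma boundary_energy_absurd (R : realFieldType) (E err r q L : R) : 0 < E ->
  err < r - 2 * q * L -> E <= 2^-1 * err - 2^-1 * r + q * L -> False.
Proof. by move=> *; lra. Qed.

(** Keeps y - t g in the ball of squared radius r: N = |y|^2, P = <y, g>, aP = |P|, GG = |g|^2. *)
Lemma ball_step (R : realFieldType) (N r t P aP GG : R) :
  - (2 * t * P) <= 2 * t * aP -> t ^+ 2 * GG <= t * GG -> 0 <= t ->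
  t * (2 * aP + GG + 1) <= r - N -> N - 2 * t * P + t ^+ 2 * GG <= r.
Proof. by move=> *; lra. Qed.

(** A step t along the ascent direction gains t GG and loses at most b (t S)^2, so for such t it
    would beat the maximum E. *)
Lemma gradient_step_absurd (R : realFieldType) (E E' t GG b S : R) :
  0 < t -> 0 < GG -> t * (2 * (b * S ^+ 2 + 1)) <= GG -> E' <= E ->
  - (- t * GG) - b * (t * S) ^+ 2 <= E' - E -> False.
Proof.
move=> t0 G0 h1 h2 h3.
have : t * GG <= t * (t * (b * S ^+ 2)) by rewrite exprMn in h3; lra.
by rewrite ler_pM2l // => h4; lra.
Qed.

(** * The reduced equation and its energy *)

Section Reduction.
Variables (R : realType) (G : compact_metric_graph R).
Implicit Types (u v w q : edge G -> R -> R) (e : edge G).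
Variables (m : R) (c s : R -> R).
Hypotheses (c0 : c 0 = 1) (s0 : s 0 = 0)
  (dc : forall x : R, is_derive x 1 c (- m * s x))
  (ds : forall x : R, is_derive x 1 s (c x)).
Local Notation hom := (@hom R G c s).
Local Notation ends := (edge G * bool)%type.
Variables (n : nat) (phi : 'I_n -> ends -> R).
Hypotheses (ophi : orthonormal_kernel m c s phi)
  (basis : forall z, kernel_data m c s z ->
     forall d, z d = \sum_i ip (hom z) (hom (phi i)) * phi i d).
Local Notation reduced_sol := (@reduced_sol R G m c s n phi).
Variables (p : R) (p6 : 6 < p).
Local Notation f := (nonlin p).
Local Notation F := (potential p).

Definition residual u e (x : R) : R := f (u e x) - u e x.

Definition kernel_fun (y : 'rV[R]_n) : edge G -> R -> R :=
  hom (fun d => \sum_i y 0 i * phi i d).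

(** The l^1 distance suits sup bounds on kernel functions, whereas [normsq] is their squared L^2
    norm by orthonormality. *)
Definition dist1 (y y' : 'rV[R]_n) : R := \sum_i `|y 0 i - y' 0 i|.

Definition normsq (y : 'rV[R]_n) : R := \sum_i y 0 i ^+ 2.

Lemma continuous_residual u : (forall e, continuous (u e)) ->
  forall e, continuous (residual u e).
Proof.
move=> cu e; apply: continuous_sub => //.
by move=> x; apply: continuous_comp; [exact: cu|exact: continuous_nonlin].
Qed.

Lemma continuous_kernel_fun y e : continuous (kernel_fun y e).
Proof. exact: (continuous_hom dc ds). Qed.

(** [C] bounds the reduced resolvent, [Bk] the basis of K, and [rho] is the squared radius of the
    ball. [B] bounds y + v for y in the ball and |v| <= 1, and [K] is a Lipschitz constant of the
    nonlinearity on [-B, B]. [muH] keeps w below 1/2; [muK] makes the fixed point map a contraction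
    of ratio 1/2. *)
Variables (C Bk rho B K mu : R).
Hypotheses (C0 : 0 <= C)
  (CP : forall q w M, (forall e, continuous (q e)) -> 0 <= M -> bounded_by M q ->
    reduced_sol q w -> bounded_by (C * M) w)
  (Bk0 : 0 <= Bk) (BkP : forall i, bounded_by Bk (hom (phi i)))
  (rho0 : 0 <= rho) (B0 : 0 <= B)
  (BE : n%:R * Bk * (rho + 1) + 1 <= B)
  (K0 : 0 <= K)
  (KP : forall a b, `|a| <= B -> `|b| <= B -> `|f a - f b| <= K * `|a - b|)
  (mu0 : 0 < mu) (muH : mu * (C * ((K + 1) * B)) <= 2^-1)
  (muK : mu * (C * (K + 1)) <= 2^-1).

Lemma kernel_fun_dist y y' : bounded_by (Bk * dist1 y y')
  (fun e x => kernel_fun y e x - kernel_fun y' e x).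
Proof.
move=> e x xl; rewrite /kernel_fun !hom_sum -sumrB mulr_sumr.
apply: (le_trans (ler_norm_sum _ _ _)); apply: ler_sum => i _.
by rewrite -mulrBl normrM mulrC ler_pM // BkP.
Qed.

Lemma kernel_fun_bounded y : normsq y <= rho -> bounded_by (B - 1) (kernel_fun y).
Proof.
move=> yr e x xl; rewrite /kernel_fun hom_sum.
apply: (le_trans (ler_norm_sum _ _ _)).
apply: (@le_trans _ _ (\sum_(i < n) (rho + 1) * Bk)).
  apply: ler_sum => i _; rewrite normrM ler_pM // ?BkP //.
  have h : `|y 0 i| ^+ 2 <= rho.
    rewrite -normrX ger0_norm ?sqr_ge0 //; apply: le_trans yr.
    by rewrite /normsq (bigD1 i) //= lerDl sumr_ge0 // => j _; rewrite sqr_ge0.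
  (* From 2 |y_i| <= |y_i|^2 + 1, which avoids the square root of [rho]. *)
  by have := sqr_ge0 (`|y 0 i| - 1); have := rho0; lra.
rewrite sumr_const card_ord -mulr_natl; have := BE; lra.
Qed.

Lemma residual_lipschitz u v d : 0 <= d -> bounded_by B u -> bounded_by B v ->
  bounded_by d (fun e x => u e x - v e x) ->
  bounded_by ((K + 1) * d) (fun e x => residual u e x - residual v e x).
Proof.
move=> d0 uB vB uv e x xl; have /= h := uv e x xl.
have -> : residual u e x - residual v e x = (f (u e x) - f (v e x)) - (u e x - v e x).
  by rewrite /residual; ring.
apply: (le_trans (ler_normB _ _)); rewrite mulrDl mul1r lerD //.
by apply: (le_trans (KP (uB _ _ xl) (vB _ _ xl))); rewrite ler_wpM2l.
Qed.

Lemma residual_bounded u : bounded_by B u -> bounded_by ((K + 1) * B) (residual u).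
Proof.
move=> uB e x xl.
have z0 : bounded_by B (fun (_ : edge G) _ => 0) by move=> *; rewrite normr0.
have := @residual_lipschitz u (fun _ _ => 0) B B0 uB z0.
rewrite /residual nonlin0 => /(_ _ e x xl); rewrite !subr0; apply => e' x' xl'.
by rewrite subr0; exact: uB.
Qed.

(* After the rescaling [u = r *: U] with [mu = r ^ (p - 2)] the equation reads
   [- U'' - m U = mu * residual U].  Here only its component orthogonal to the
   kernel is imposed; [q] agrees with [mu * residual U] on the edges, and is
   extended continuously to R. *)
Definition auxiliary_sol y w q :=
  [/\ forall e, continuous (q e),
    forall e x, 0 <= x <= len e -> q e x = mu * residual (fun e x => kernel_fun y e x + w e x) e x,
    reduced_sol q w & bounded_by (mu * (C * ((K + 1) * B))) w].

Lemma auxiliary_sol_exists y : normsq y <= rho -> exists w q, auxiliary_sol y w q.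
Proof.
move=> yr.
have [C' _ C'P] := reduced_sol_exists c0 s0 dc ds ophi basis.
(* A choice of reduced solution; at a discontinuous [q] its value is a dummy. *)
have /choice[S SP] q : exists w, (forall e, continuous (q e)) -> reduced_sol q w.
  have [cq|ncq] := pselect (forall e, continuous (q e)); last by exists q.
  by have [w [rw _]] := C'P q cq; exists w.
pose U v e x := kernel_fun y e x + v e x.
pose Q v e x := mu * residual (U v) e x.
have cU v : (forall e, continuous (v e)) -> forall e, continuous (U v e).
  by move=> cv e; apply: continuous_add => //; exact: continuous_kernel_fun.
have cQ v : (forall e, continuous (v e)) -> forall e, continuous (Q v e).
  by move=> cv e; apply: continuous_cmul; apply: continuous_residual; exact: cU.
have UB v : bounded_by 1 v -> bounded_by B (U v).
  move=> v1 e x xl; apply: (le_trans (ler_normD _ _)).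
  by rewrite -[B](subrK 1) lerD ?v1 // kernel_fun_bounded.
have QB v : bounded_by 1 v -> bounded_by (mu * ((K + 1) * B)) (Q v).
  move=> v1 e x xl; rewrite normrM (gtr0_norm mu0) ler_pM2l //.
  by apply: residual_bounded => //; exact: UB.
have KB0 : 0 <= mu * ((K + 1) * B) by rewrite !mulr_ge0 ?addr_ge0 // ltW.
have SB v : (forall e, continuous (v e)) -> bounded_by 1 v ->
    bounded_by (mu * (C * ((K + 1) * B))) (S (Q v)).
  by move=> cv v1; rewrite mulrCA; apply: CP (SP _ (cQ _ cv)) => //; [exact: cQ|exact: QB].
have [||v [cv v1 vfix]] := @contraction_fixpoint R G (fun v => S (Q v)).
- move=> v cv v1; split; first exact: reduced_sol_continuous (SP _ (cQ _ cv)).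
  move=> e x xl; apply: (le_trans (SB _ cv v1 _ _ xl)); apply: (le_trans muH); lra.
- move=> u v cu cv u1 v1 d d0 uv e x xl.
  have Qd : bounded_by (mu * ((K + 1) * d)) (fun e x => Q u e x - Q v e x).
    move=> e' x' xl'; rewrite -mulrBr normrM (gtr0_norm mu0) ler_pM2l //.
    apply: residual_lipschitz => //; [exact: UB|exact: UB|].
    move=> e2 x2 xl2; have -> : U u e2 x2 - U v e2 x2 = u e2 x2 - v e2 x2 by rewrite /U; ring.
    exact: uv.
  have cQd e' : continuous (fun x => Q u e' x - Q v e' x).
    by apply: continuous_sub; exact: cQ.
  have Kd0 : 0 <= mu * ((K + 1) * d) by rewrite !mulr_ge0 ?addr_ge0 // ltW.
  have := CP cQd Kd0 Qd (reduced_sol_sub dc ds (cQ _ cu) (cQ _ cv)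
    (SP _ (cQ _ cu)) (SP _ (cQ _ cv))).
  move=> /(_ e x xl) /le_trans; apply.
  by rewrite mulrCA !mulrA ler_wpM2r // -mulrA.
(* [v] agrees with [S (Q v)] only on the edges, whereas [S (Q v)] satisfies the differential
   equation on R; hence the latter is taken as w. *)
exists (S (Q v)), (Q v); split; [exact: cQ| |exact/SP/cQ|exact: SB].
by move=> e x xl; rewrite /Q /residual /U vfix.
Qed.

Lemma half_bounded w y q : auxiliary_sol y w q -> bounded_by 2^-1 w.
Proof. by move=> [_ _ _ wb] e x xl; apply: le_trans muH; exact: wb. Qed.

Lemma auxiliary_continuous w y q : auxiliary_sol y w q -> forall e, continuous (w e).
Proof. by move=> [_ _ rw _]; exact: reduced_sol_continuous rw. Qed.

Definition total y w e (x : R) : R := kernel_fun y e x + w e x.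

Lemma total_bounded y w q : normsq y <= rho -> auxiliary_sol y w q -> bounded_by B (total y w).
Proof.
move=> yr /half_bounded wb e x xl; apply: (le_trans (ler_normD _ _)).
have := kernel_fun_bounded yr xl; have := wb _ _ xl; lra.
Qed.

Lemma continuous_total y w q : auxiliary_sol y w q -> forall e, continuous (total y w e).
Proof.
move=> /auxiliary_continuous cw e; apply: continuous_add => //; exact: continuous_kernel_fun.
Qed.

Lemma dist1_ge0 y y' : 0 <= dist1 y y'.
Proof. exact: sumr_ge0. Qed.

(** The contraction gives delta <= (D + delta) / 2 for the sup distance delta of w and w', hence
    delta <= D. Sup norms occur as bounds rather than numbers, so the inequality is iterated from a
    crude bound whose excess over D is halved each time. For y = y' this is uniqueness of w on the
    edges. *)
Lemma auxiliary_dist y y' w w' q q' : normsq y <= rho -> normsq y' <= rho ->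
  auxiliary_sol y w q -> auxiliary_sol y' w' q' ->
  bounded_by (Bk * dist1 y y') (fun e x => w e x - w' e x).
Proof.
move=> yr yr' aw aw'; pose D := Bk * dist1 y y'.
have D0 : 0 <= D by rewrite mulr_ge0 ?dist1_ge0.
have UB := total_bounded yr aw; have UB' := total_bounded yr' aw'.
suff main k : bounded_by (D + 2 * 2^-1 ^+ k) (fun e x => w e x - w' e x).
  by move=> e x xl; apply: (@le_geometric _ 2) => k; exact: main.
elim: k => [|k IH].
  move=> e x xl; apply: (le_trans (ler_normB _ _)).
  by have := half_bounded aw xl; have := half_bounded aw' xl; rewrite expr0; lra.
have half0 : 0 <= 2^-1 ^+ k :> R by rewrite exprn_ge0 // invr_ge0.
have d0 : 0 <= D + (D + 2 * 2^-1 ^+ k) by rewrite !addr_ge0 // mulr_ge0.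
have Ud : bounded_by (D + (D + 2 * 2^-1 ^+ k)) (fun e x => total y w e x - total y' w' e x).
  move=> e x xl.
  have -> : total y w e x - total y' w' e x =
    (kernel_fun y e x - kernel_fun y' e x) + (w e x - w' e x) by rewrite /total; ring.
  by apply: (le_trans (ler_normD _ _)); rewrite lerD // ?kernel_fun_dist ?IH.
have hd := residual_lipschitz d0 UB UB' Ud.
case: aw aw' => cq qE rw _ [cq' qE' rw' _].
have qd : bounded_by (mu * ((K + 1) * (D + (D + 2 * 2^-1 ^+ k)))) (fun e x => q e x - q' e x).
  move=> e x xl; rewrite qE // qE' // -mulrBr normrM (gtr0_norm mu0) ler_pM2l //.
  exact: hd.
have M0 : 0 <= mu * ((K + 1) * (D + (D + 2 * 2^-1 ^+ k))).
  by rewrite !mulr_ge0 ?addr_ge0 // ltW.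
have cqq e : continuous (fun x => q e x - q' e x) by exact: continuous_sub.
have := CP cqq M0 qd (reduced_sol_sub dc ds cq cq' rw rw').
move=> h e x xl; apply: (le_trans (h e x xl)).
apply: (@le_trans _ _ (2^-1 * (D + (D + 2 * 2^-1 ^+ k)))); last by rewrite exprS; lra.
by rewrite mulrCA !mulrA ler_wpM2r // -mulrA.
Qed.

Lemma ipDr u v w : (forall e, continuous (u e)) -> (forall e, continuous (v e)) ->
  (forall e, continuous (w e)) -> ip w (fun e x => u e x + v e x) = ip w u + ip w v.
Proof. by move=> cu cv cw; rewrite ipC ipDl // !(ipC _ w). Qed.

Lemma ipBr u v w : (forall e, continuous (u e)) -> (forall e, continuous (v e)) ->
  (forall e, continuous (w e)) -> ip w (fun e x => u e x - v e x) = ip w u - ip w v.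
Proof. by move=> cu cv cw; rewrite ipC ipBl // !(ipC _ w). Qed.

(** Symmetry of the reduced resolvent with the factor mu cancelled; it merges the two cross terms in
    the energy difference. *)
Lemma ip_residual_sym y y' w w' q q' : auxiliary_sol y w q -> auxiliary_sol y' w' q' ->
  ip (residual (total y w)) w' = ip (residual (total y' w')) w.
Proof.
move=> aw aw'; have cU := continuous_total aw; have cU' := continuous_total aw'.
have cw := auxiliary_continuous aw; have cw' := auxiliary_continuous aw'.
case: aw aw' => cq qE rw _ [cq' qE' rw' _].
have := reduced_sol_sym dc ds cq cq' rw rw'.
rewrite [ip w q']ipC.
rewrite (@eq_ip _ _ q w' (fun e x => mu * residual (total y w) e x) w') //.
rewrite (@eq_ip _ _ q' w (fun e x => mu * residual (total y' w') e x) w) //.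
rewrite !ipZl //; try exact: continuous_residual.
by move/mulfI; apply; rewrite gt_eqF.
Qed.

(** The action <L U, U> / (2 mu) + <U, U> / 2 - int F(U). Since L U is mu times the part of the
    residual orthogonal to K, its first term equals <residual U, w> / 2, which contains no
    derivative of U. *)
Definition energy y w : R :=
  2^-1 * ip (residual (total y w)) w + 2^-1 * ip (total y w) (total y w) -
  ip (fun e x => F (total y w e x)) (fun _ _ => 1).

(* The first-order terms in [w] cancel because [w] solves the auxiliary
   equation, so that only the kernel component of the residual survives; this
   makes differentiability of [w] in [y] unnecessary. *)
Lemma energy_lower y y' w w' q q' : normsq y <= rho -> normsq y' <= rho ->
  auxiliary_sol y w q -> auxiliary_sol y' w' q' ->
  - ip (residual (total y w)) (fun e x => kernel_fun y' e x - kernel_fun y e x) -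
    (5 * K + 1) * (Bk * dist1 y' y) ^+ 2 * total_length G <= energy y' w' - energy y w.
Proof.
move=> yr yr' aw aw'; set D := Bk * dist1 y' y.
have D0 : 0 <= D by rewrite mulr_ge0 ?dist1_ge0.
have UB := total_bounded yr aw; have UB' := total_bounded yr' aw'.
have cU := continuous_total aw; have cU' := continuous_total aw'.
have cw := auxiliary_continuous aw; have cw' := auxiliary_continuous aw'.
have cY := @continuous_kernel_fun.
have ch := continuous_residual cU; have ch' := continuous_residual cU'.
have wd := auxiliary_dist yr' yr aw' aw; rewrite -/D in wd.
have Yd := @kernel_fun_dist y' y; rewrite -/D in Yd.
have sym := ip_residual_sym aw aw'.
rewrite /energy; move: sym UB UB' cU cU' ch ch'.
have : forall e x, total y' w' e x - total y w e x =
    (kernel_fun y' e x - kernel_fun y e x) + (w' e x - w e x).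
  by move=> e x; rewrite /total; ring.
move: (total y w) (total y' w') => U U' UE sym UB UB' cU cU' ch ch'.
pose dY e x := kernel_fun y' e x - kernel_fun y e x; rewrite -/dY.
pose dw e x := w' e x - w e x.
pose dU e x := U' e x - U e x.
pose dh e x := residual U' e x - residual U e x.
have cdY e : continuous (dY e) by exact: continuous_sub.
have cdw e : continuous (dw e) by exact: continuous_sub.
have cdU e : continuous (dU e) by exact: continuous_sub.
have cdh e : continuous (dh e) by exact: continuous_sub.
have cf (u : edge G -> R -> R) : (forall e, continuous (u e)) ->
    forall e, continuous (fun x => f (u e x)).
  by move=> cu e x; apply: continuous_comp; [exact: cu|exact: continuous_nonlin].
have cF (u : edge G -> R -> R) : (forall e, continuous (u e)) ->
    forall e, continuous (fun x => F (u e x)).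
  by move=> cu e x; apply: continuous_comp; [exact: cu|exact: continuous_potential].
have c1 (e : edge G) : continuous (fun _ : R => 1 : R) by exact: cst_continuous.
have D2 : 0 <= D + D by rewrite addr_ge0.
have dUD : bounded_by (D + D) dU.
  move=> e x xl; rewrite /dU UE; apply: (le_trans (ler_normD _ _)).
  by rewrite lerD ?Yd ?wd.
have dhD : bounded_by ((K + 1) * (D + D)) dh by exact: residual_lipschitz.
(* With [sym], half of [ip dh dw] is the second-order part of the first energy term and contributes
   K + 1 to the constant; the Lipschitz error in [t4'] contributes 4 K, whence 5 K + 1. *)
have t1 : ip dh dw =
    ip (residual U') w' - ip (residual U') w - ip (residual U) w' + ip (residual U) w.
  by rewrite ipBl // !ipBr //; ring.
have t1' : `|ip dh dw| <= (K + 1) * (D + D) * D * total_length G.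
  by apply: ip_bounded => //; rewrite mulr_ge0 ?addr_ge0.
have t2 : ip dU dU = ip U' U' - 2 * ip U U' + ip U U.
  by rewrite ipBl // !ipBr // (ipC U' U); ring.
have t2' := ip_ge0 cdU.
(* Convexity with the tangent at the new point U' replaces a Taylor expansion of F; [t4] then moves
   the slope back to U. *)
have t3 : ip (fun e x => F (U' e x)) (fun _ _ => 1) - ip (fun e x => F (U e x)) (fun _ _ => 1) <=
    ip (fun e x => f (U' e x)) dU.
  rewrite -ipBl; [|exact: cF|exact: cF|exact: c1].
  apply: le_ip; [by move=> e; apply: continuous_sub; exact: cF|exact: c1|exact: cf|exact: cdU|].
  by move=> e x xl; have := potential_tangent p6 (U e x) (U' e x); rewrite /dU mulr1; lra.
have t4 : ip (fun e x => f (U' e x) - f (U e x)) dU =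
    ip (fun e x => f (U' e x)) dU - ip (fun e x => f (U e x)) dU.
  by rewrite ipBl //; exact: cf.
have t4' : `|ip (fun e x => f (U' e x) - f (U e x)) dU| <= K * (D + D) * (D + D) * total_length G.
  apply: ip_bounded => //; first by rewrite mulr_ge0.
    by move=> e; apply: continuous_sub; exact: cf.
  move=> e x xl; apply: (le_trans (KP (UB' _ _ xl) (UB _ _ xl))).
  by rewrite ler_wpM2l //; exact: dUD.
have t5 : ip (residual U) dU = ip (fun e x => f (U e x)) dU - ip U dU.
  by rewrite ipBl //; exact: cf.
have t6 : ip (residual U) dU = ip (residual U) dY + ip (residual U) dw.
  rewrite -ipDr //; apply: eq_ip => // e x _; exact: UE.
have t7 : ip (residual U) dw = ip (residual U) w' - ip (residual U) w by rewrite ipBr.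
have t8 : ip U dU = ip U U' - ip U U by rewrite ipBr.
have := ler_norm (- ip dh dw); rewrite normrN => n1.
have := ler_norm (ip (fun e x => f (U' e x) - f (U e x)) dU) => n2.
(* The remaining claim is linear in these scalar products, which are abstracted into variables. *)
move: t1 t1' t2 t2' t3 t4 t4' t5 t6 t7 t8 n1 n2 sym; rewrite expr2; clear.
move: (ip dh dw) (ip dU dU) (ip (residual U') w') (ip (residual U') w) (ip (residual U) w')
  (ip (residual U) w) (ip U' U') (ip U U') (ip U U) (ip (residual U) dU) (ip (residual U) dY)
  (ip (residual U) dw) (ip U dU) (ip (fun e x => F (U' e x)) _) (ip (fun e x => F (U e x)) _)
  (ip (fun e x => f (U' e x)) dU) (ip (fun e x => f (U e x)) dU) (ip _ dU) (total_length G).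
by move=> *; lra.
Qed.

Lemma ip_kernel_fun y y' : ip (kernel_fun y) (kernel_fun y') = \sum_i y 0 i * y' 0 i.
Proof.
rewrite /kernel_fun [hom (fun d => \sum_i y 0 i * _)]hom_sum ip_suml;
  try by move=> *; exact: (continuous_hom dc ds).
by apply: eq_bigr => i _; rewrite ipC (ip_hom_sum dc ds _ ophi).
Qed.

Lemma ip_total y w q : auxiliary_sol y w q ->
  ip (total y w) (total y w) = normsq y + ip w w.
Proof.
move=> aw; have cw := auxiliary_continuous aw; have cY := @continuous_kernel_fun y.
have Yw : ip (kernel_fun y) w = 0.
  rewrite /kernel_fun hom_sum ip_suml //; last by move=> *; exact: (continuous_hom dc ds).
  by case: aw => _ _ [_ wo] _; apply: big1 => i _; rewrite ipC wo mulr0.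
rewrite ipDl //; last exact: continuous_total aw.
have D v : (forall e, continuous (v e)) -> ip v (total y w) = ip v (kernel_fun y) + ip v w.
  by move=> cv; exact: ipDr.
rewrite !D // (ipC w (kernel_fun y)) Yw ip_kernel_fun addr0 add0r; congr (_ + _).
Qed.

(** A bound for the coupling term <residual U, w>. It is of order mu because w is. *)
Definition energy_error : R := mu * (C * ((K + 1) * B) * ((K + 1) * B) * total_length G).

Lemma ip_residual_small y w q : normsq y <= rho -> auxiliary_sol y w q ->
  `|ip (residual (total y w)) w| <= energy_error.
Proof.
move=> yr aw; have cw := auxiliary_continuous aw.
have KB0 : 0 <= (K + 1) * B by rewrite mulr_ge0 ?addr_ge0.
have rb := residual_bounded (total_bounded yr aw).
have m0 : 0 <= mu * (C * ((K + 1) * B)) by rewrite mulr_ge0 ?(ltW mu0) // mulr_ge0.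
case: (aw) => _ _ _ wb.
have := ip_bounded KB0 m0 (continuous_residual (continuous_total aw)) cw rb wb.
by rewrite /energy_error; lra.
Qed.

Lemma ip_square u : ip u u = ip (fun e x => u e x ^+ 2) (fun _ _ => 1).
Proof. by apply: eq_bigr => e _; apply: eq_integral_0to => x _; rewrite mulr1 expr2. Qed.

(** [potential_ge_quadratic] turns + |U|^2 / 2 into - |U|^2 / 2, and |U|^2 >= |y|^2 by
    Pythagoras. *)
Lemma energy_upper y w q : normsq y <= rho -> auxiliary_sol y w q ->
  energy y w <= 2^-1 * energy_error - 2^-1 * normsq y + p ^+ 2 * total_length G.
Proof.
move=> yr aw; have cU := continuous_total aw; have cw := auxiliary_continuous aw.
have := ip_residual_small yr aw; have := ler_norm (ip (residual (total y w)) w).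
have UU := ip_total aw; have ww := ip_ge0 cw.
have c1 (k : R) (e : edge G) : continuous (fun _ : R => k : R) by exact: cst_continuous.
have c2 e : continuous (fun x => total y w e x ^+ 2).
  by have := continuous_mul (cU e) (cU e); under eq_fun do rewrite -expr2.
have : ip (total y w) (total y w) - p ^+ 2 * total_length G <=
    ip (fun e x => F (total y w e x)) (fun _ _ => 1).
  rewrite -[p ^+ 2]mulr1 -ip_cst ip_square -ipBl; [|exact: c2|exact: c1|exact: c1].
  apply: le_ip; [|exact: c1| |exact: c1|].
  - by move=> e; apply: continuous_sub => //; exact: c1.
  - by move=> e x; apply: continuous_comp; [exact: cU|exact: continuous_potential].
  - by move=> e x _; rewrite !mulr1; exact: potential_ge_quadratic.
rewrite /energy; lra.
Qed.

(** The coefficient 1/3 is 1/2 - 1/6, the latter from [potential_le_quadratic]. *)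
Lemma energy_lower_small y w q : normsq y <= rho -> auxiliary_sol y w q ->
  bounded_by 1 (total y w) -> normsq y / 3 - 2^-1 * energy_error <= energy y w.
Proof.
move=> yr aw U1; have cU := continuous_total aw; have cw := auxiliary_continuous aw.
have := ip_residual_small yr aw; have := ler_norm (- ip (residual (total y w)) w).
rewrite normrN; have UU := ip_total aw; have ww := ip_ge0 cw.
have c1 (k : R) (e : edge G) : continuous (fun _ : R => k : R) by exact: cst_continuous.
have c2 e : continuous (fun x => total y w e x ^+ 2).
  by have := continuous_mul (cU e) (cU e); under eq_fun do rewrite -expr2.
have : ip (fun e x => F (total y w e x)) (fun _ _ => 1) <= 6^-1 * ip (total y w) (total y w).
  rewrite ip_square -ipZl; [|exact: c2|exact: c1].
  apply: le_ip; [|exact: c1| |exact: c1|].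
  - by move=> e x; apply: continuous_comp; [exact: cU|exact: continuous_potential].
  - by move=> e; apply: continuous_cmul.
  - by move=> e x xl; rewrite !mulr1 mulrC; apply: potential_le_quadratic => //; exact: U1.
rewrite /energy; lra.
Qed.

Lemma continuous_normsq : continuous normsq.
Proof.
apply: continuous_big => [|i _ y]; first exact: add_continuous.
apply: (@continuous_comp _ _ _ (fun z : 'rV[R]_n => z 0 i) (fun a : R => a ^+ 2)).
  exact: coord_continuous.
exact: exprn_continuous.
Qed.

Lemma continuous_dist1 y : continuous (dist1 ^~ y).
Proof.
apply: continuous_big => [|i _ z]; first exact: add_continuous.
apply: (@continuous_comp _ _ _ (fun z : 'rV[R]_n => z 0 i) (fun a : R => `|a - y 0 i|)).
  exact: coord_continuous.
apply: (@continuous_comp _ _ _ (fun a : R => a - y 0 i) (fun a : R => `|a|)).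
  by apply: continuousB => //; exact: cst_continuous.
exact: norm_continuous.
Qed.

Lemma compact_normsq_ball : compact [set y | normsq y <= rho].
Proof.
apply: bounded_closed_compact.
  exists (rho + 1); split; first exact: num_real.
  move=> M rM y /= yr; apply: ltW; apply: le_lt_trans rM.
  rewrite -[leLHS]/(mx_norm y).
  have [->|/mx_norm_neq0[[i j] /= ->]] := eqVneq (mx_norm y) 0.
    by have := rho0; lra.
  rewrite (ord1 i).
  have h : `|y 0 j| ^+ 2 <= rho.
    rewrite -normrX ger0_norm ?sqr_ge0 //; apply: le_trans yr.
    by rewrite /normsq (bigD1 j) //= lerDl sumr_ge0 // => k _; rewrite sqr_ge0.
  by have := sqr_ge0 (`|y 0 j| - 1); have := rho0; lra.
apply: (@closed_comp _ _ normsq [set a | a <= rho]).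
  by move=> y _; exact: continuous_normsq.
exact: closed_le.
Qed.

(** The index [i0] witnesses a nontrivial kernel, and [t] is the length of the test vector along it.
    [err1] makes the energy positive there, [err2] makes it negative on the sphere. *)
Lemma critical_exists (i0 : 'I_n) (t : R) : 0 < t -> t ^+ 2 <= rho -> Bk * t <= 2^-1 ->
  energy_error < 2 / 3 * t ^+ 2 ->
  energy_error < rho - 2 * p ^+ 2 * total_length G ->
  exists y w q, [/\ normsq y <= rho, auxiliary_sol y w q,
    exists e x, 0 <= x <= len e /\ total y w e x != 0 &
    forall i, ip (residual (total y w)) (hom (phi i)) = 0].
Proof.
move=> t0 tr Bt err1 err2.
(* Outside the ball [W] is a dummy. *)
have /choice[W WP] y : exists w, normsq y <= rho -> exists q, auxiliary_sol y w q.
  have [yr|] := pselect (normsq y <= rho); last by exists (fun _ _ => 0).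
  by have [w [q aw]] := auxiliary_sol_exists yr; exists w => _; exists q.
pose E y := energy y (W y).
have dist1C y y' : dist1 y y' = dist1 y' y by apply: eq_bigr => i _; rewrite distrC.
have L0 := total_length_ge0 G.
have KB0 : 0 <= (K + 1) * B by rewrite mulr_ge0 ?addr_ge0.
pose a := (K + 1) * B * Bk * total_length G.
have a0 : 0 <= a by rewrite !mulr_ge0 ?addr_ge0.
pose b := (5 * K + 1) * Bk ^+ 2 * total_length G.
have b0 : 0 <= b by rewrite !mulr_ge0 ?sqr_ge0 // addr_ge0 // mulr_ge0.
have E_lower y y' : normsq y <= rho -> normsq y' <= rho ->
    - ip (residual (total y (W y))) (fun e x => kernel_fun y' e x - kernel_fun y e x) -
      b * dist1 y' y ^+ 2 <= E y' - E y.
  move=> yr yr'; have [q aw] := WP _ yr; have [q' aw'] := WP _ yr'.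
  apply: le_trans (energy_lower yr yr' aw aw').
  by rewrite /b exprMn; lra.
(* Exchanging y and y' gives the opposite inequality, so this one-sided bound yields continuity of
   [E] on the ball. *)
have E_lip y y' : normsq y <= rho -> normsq y' <= rho ->
    - (a * dist1 y' y + b * dist1 y' y ^+ 2) <= E y' - E y.
  move=> yr yr'; have [q aw] := WP _ yr.
  have D0 : 0 <= Bk * dist1 y' y by rewrite mulr_ge0 ?dist1_ge0.
  have cdY e : continuous (fun x => kernel_fun y' e x - kernel_fun y e x).
    by apply: continuous_sub; exact: continuous_kernel_fun.
  apply: le_trans (E_lower _ _ yr yr'); rewrite opprD lerD2r lerN2.
  have -> : a * dist1 y' y = (K + 1) * B * (Bk * dist1 y' y) * total_length G by rewrite /a; ring.
  apply: le_trans (ler_norm _) _; apply: ip_bounded => //.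
  - exact: continuous_residual (continuous_total aw).
  - exact: residual_bounded (total_bounded yr aw).
  - exact: kernel_fun_dist.
clearbody a b.
have cE : {within [set y | normsq y <= rho], continuous E}.
  apply/subspace_continuousP => y /= yr; apply/cvgrPdist_lt => eps eps0.
  near=> z.
  have zr : normsq z <= rho by near: z; apply: withinT.
  have zd : dist1 z y < Num.min 1 (eps / (a + b + 1)).
    near: z; apply: cvg_within.
    have d0 : dist1 y y = 0 by apply: big1 => i _; rewrite subrr normr0.
    have h : dist1 z y @[z --> y] --> (0 : R).
      by have := @continuous_dist1 y y; rewrite /continuous_at d0.
    apply: (cvgr_lt _ h); rewrite lt_min ltr01 divr_gt0 //.
    by rewrite ltr_wpDl // addr_ge0.
  move: zd; rewrite lt_min => /andP[zd1].
  rewrite ltr_pdivlMr; last by rewrite ltr_wpDl // addr_ge0.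
  have d0 := dist1_ge0 z y.
  have dd : dist1 z y ^+ 2 <= dist1 z y by rewrite expr2 ler_piMl // ltW.
  have bdd : b * dist1 z y ^+ 2 <= b * dist1 z y by rewrite ler_wpM2l.
  have := E_lip _ _ yr zr; have := E_lip _ _ zr yr; rewrite (dist1C y z).
  move=> h1 h2 h3; rewrite /from_subspace ltr_norml.
  have small : a * dist1 z y + b * dist1 z y ^+ 2 < eps.
    apply: le_lt_trans h3; rewrite mulrDr mulr1 mulrDr [_ * a]mulrC [_ * b]mulrC -addrA lerD2l.
    by apply: (le_trans bdd); rewrite lerDl.
  rewrite -ltrN2 in small.
  by rewrite (lt_le_trans small h1) -(ltrN2 _ (E y - E z)) opprB (lt_le_trans small h2).
have ne : [set y | normsq y <= rho] !=set0.
  exists 0 => /=; rewrite /normsq big1 // => i _; by rewrite mxE expr0n.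
have [y] := EVT_max_rV ne compact_normsq_ball cE.
rewrite inE /= => yr ymax.
have [q aw] := WP _ yr.
pose y1 : 'rV[R]_n := \row_i (t * (i == i0)%:R).
have y1E : normsq y1 = t ^+ 2.
  rewrite /normsq (bigD1 i0) //= big1 ?addr0; first by rewrite mxE eqxx mulr1.
  by move=> i /negPf ii; rewrite mxE ii mulr0 expr0n.
have y1r : normsq y1 <= rho by rewrite y1E.
have [q1 aw1] := WP _ y1r.
have Epos : 0 < E y1.
  have U1 : bounded_by 1 (total y1 (W y1)).
    move=> e x xl; apply: (le_trans (ler_normD _ _)).
    have := half_bounded aw1 xl.
    have := @kernel_fun_dist y1 0 e x xl.
    have -> : kernel_fun 0 e x = 0.
      by rewrite /kernel_fun hom_sum big1 // => i _; rewrite mxE mul0r.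
    have -> : dist1 y1 0 = t.
      rewrite /dist1 (bigD1 i0) //= big1 ?addr0.
        by rewrite !mxE eqxx mulr1 subr0 gtr0_norm.
      by move=> i /negPf ii; rewrite !mxE ii mulr0 subr0 normr0.
    by rewrite subr0; lra.
  by have := energy_lower_small y1r aw1 U1; rewrite y1E -/(E y1); lra.
have Ey : 0 < E y by apply: lt_le_trans Epos _; apply: ymax; rewrite inE.
exists y, (W y), q; split=> //.
  (* If U vanished on the edges, all three energy terms would be 0, contrary to [Ey]. *)
  apply: contrapT => h.
  have U0 e x : 0 <= x <= len e -> total y (W y) e x = 0.
    by move=> xl; apply: contrapT => /eqP n0; apply: h; exists e, x.
  move: Ey; rewrite /E /energy.
  rewrite (@eq_ip _ _ (residual _) _ (fun _ _ => 0) (W y)) //; last first.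
    by move=> e x xl; rewrite /residual U0 // nonlin0 subr0.
  rewrite (@eq_ip _ _ (total _ _) _ (fun _ _ => 0) (fun _ _ => 0)) //.
  rewrite (@eq_ip _ _ (fun e x => F _) _ (fun _ _ => 0) (fun _ _ => 1)) //; last first.
    move=> e x xl; rewrite U0 // /potential normr0 powR0 ?mul0r //.
    by rewrite gt_eqF //; have := p6; lra.
  by rewrite !ip0l !mulr0 addr0 subr0 ltxx.
have yint : normsq y < rho.
  rewrite lt_neqAle yr andbT; apply/eqP => yE.
  by have := energy_upper yr aw; rewrite -/(E y) yE;
    exact: boundary_energy_absurd Ey err2.
pose g i := ip (residual (total y (W y))) (hom (phi i)).
pose GG := \sum_i g i ^+ 2.
have GG0 : 0 <= GG by apply: sumr_ge0 => i _; exact: sqr_ge0.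
suff : GG = 0.
  move=> /psumr_eq0P h i; apply/eqP; rewrite -sqrf_eq0; apply/eqP.
  by apply: h => // j _; exact: sqr_ge0.
apply/eqP; apply: contraT => Gn0.
have Gp : 0 < GG by rewrite lt_neqAle eq_sym Gn0.
pose S := \sum_i `|g i|.
pose k7 := b * S ^+ 2.
have k70 : 0 <= k7 by rewrite mulr_ge0 // sqr_ge0.
pose P := \sum_i y 0 i * g i.
(* The bound 1 gives tau^2 <= tau, the second keeps the step in the ball, and the third makes the
   quadratic loss smaller than the gain. *)
pose tau := Num.min 1 (Num.min ((rho - normsq y) / (2 * `|P| + GG + 1)) (GG / (2 * (k7 + 1)))).
have den1 : 0 < 2 * `|P| + GG + 1 by rewrite ltr_wpDl // addr_ge0 // mulr_ge0.
have den2 : 0 < 2 * (k7 + 1) by rewrite mulr_gt0 // ltr_wpDl.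
have tau0 : 0 < tau.
  by rewrite /tau !lt_min ltr01 (divr_gt0 Gp den2) divr_gt0 // subr_gt0.
have tau1 : tau <= 1 by rewrite /tau ge_min lexx.
have tau2 : tau * (2 * `|P| + GG + 1) <= rho - normsq y.
  by rewrite -ler_pdivlMr // /tau !ge_min lexx !orbT.
have tau3 : tau * (2 * (k7 + 1)) <= GG.
  by rewrite -ler_pdivlMr // /tau !ge_min lexx !orbT.
(* The reduced energy has gradient - g, so - g points uphill. *)
pose y' : 'rV[R]_n := \row_i (y 0 i - tau * g i).
have y'r : normsq y' <= rho.
  have -> : normsq y' = normsq y - 2 * tau * P + tau ^+ 2 * GG.
    rewrite /normsq /P /GG !mulr_sumr -sumrB -big_split /=.
    by apply: eq_bigr => i _; rewrite mxE; ring.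
  have h1 : - (2 * tau * P) <= 2 * tau * `|P|.
    by rewrite -mulrN ler_wpM2l ?mulr_ge0 ?(ltW tau0) // -normrN ler_norm.
  have h2 : tau ^+ 2 * GG <= tau * GG.
    by rewrite expr2 -mulrA ler_piMl // mulr_ge0 // ltW.
  exact: ball_step h1 h2 (ltW tau0) tau2.
have := E_lower _ _ yr y'r; have : E y' <= E y by apply: ymax; rewrite inE.
have -> : dist1 y' y = tau * S.
  rewrite /S mulr_sumr; apply: eq_bigr => i _; rewrite mxE addrAC subrr sub0r normrN.
  by rewrite normrM (gtr0_norm tau0).
have -> : ip (residual (total y (W y)))
    (fun e x => kernel_fun y' e x - kernel_fun y e x) = - tau * GG.
  have -> : (fun e x => kernel_fun y' e x - kernel_fun y e x) =
      fun e x => \sum_i (- tau * g i) * hom (phi i) e x.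
    apply/funext => e; apply/funext => x; rewrite /kernel_fun !hom_sum -sumrB.
    by apply: eq_bigr => i _; rewrite mxE; ring.
  rewrite ipC ip_suml; [|by move=> *; exact: (continuous_hom dc ds)|].
    by rewrite mulr_sumr; apply: eq_bigr => i _; rewrite ipC -/(g i); ring.
  exact/continuous_residual/(continuous_total aw).
by move=> h1 /(gradient_step_absurd tau0 Gp tau3 h1).
Unshelve. all: by end_near. Qed.

End Reduction.

(** * Choice of constants and the family of rescaled solutions *)

Section Branch.
Variables (R : realType) (G : compact_metric_graph R).

Lemma total_length_gt0 : 0 < total_length G.
Proof.
have /card_gt0P[e _] := edge_inhabited G.
by apply: lt_le_trans (len_gt0 e) _; exact: len_le_sum.
Qed.

Lemma solution_branch (m : R) (c s : R -> R) n (phi : 'I_n -> edge G * bool -> R) (p : R) :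
  c 0 = 1 -> s 0 = 0 -> (forall x : R, is_derive x 1 c (- m * s x)) ->
  (forall x : R, is_derive x 1 s (c x)) -> orthonormal_kernel m c s phi ->
  (forall z, kernel_data m c s z ->
     forall d, z d = \sum_i ip (hom c s z) (hom c s (phi i)) * phi i d) ->
  (0 < n)%N -> 6 < p ->
  exists mu0 M : R, [/\ 0 < mu0, 0 <= M & forall mu, 0 < mu -> mu <= mu0 ->
    exists U U1 q : edge G -> R -> R, [/\ kirchhoff_sol m q U U1,
      forall e x, 0 <= x <= len e -> q e x = mu * (nonlin p (U e x) - U e x),
      bounded_by M U & exists e x, 0 <= x <= len e /\ U e x != 0]].
Proof.
move=> c0 s0 dc ds ophi basis n0 p6.
have [C C0 CP] := reduced_sol_bounded c0 s0 dc ds ophi basis.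
have [Bk Bk0 BkP] := kernel_bounded dc ds phi.
have L0 := total_length_gt0.
(* Leaves rho - 2 p^2 L = 2 p^2 L > 0 as room for [energy_error] on the sphere, L being the total
   length. *)
pose rho := 4 * p ^+ 2 * total_length G.
have p2 : 0 < p ^+ 2 by rewrite exprn_gt0 //; lra.
have rho0 : 0 < rho by rewrite mulr_gt0 // mulr_gt0.
pose B := n%:R * Bk * (rho + 1) + 1.
have B0 : 0 <= B by rewrite addr_ge0 // !mulr_ge0 // addr_ge0 // ltW.
have [K K0 KP] := nonlin_lipschitz p6 B0.
pose K6 := C * ((K + 1) * B) * ((K + 1) * B) * total_length G.
have K10 : 0 <= K + 1 by rewrite addr_ge0.
have K60 : 0 <= K6 by rewrite !mulr_ge0 // ltW.
(* The last entry makes the test kernel function at most 1/2; with |w| <= 1/2 this puts the test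
   function in the range |U| <= 1 of [potential_le_quadratic]. *)
pose t := Num.min 1 (Num.min rho (2 * (Bk + 1))^-1).
have Bk1 : 0 < 2 * (Bk + 1) by rewrite mulr_gt0 // ltr_wpDl.
have t0 : 0 < t by rewrite !lt_min ltr01 rho0 invr_gt0.
have t1 : t <= 1 by rewrite ge_min lexx.
have tr : t ^+ 2 <= rho.
  apply: (@le_trans _ _ t); first by rewrite expr2 ler_piMl // ltW.
  by rewrite !ge_min lexx orbT.
have Bt : Bk * t <= 2^-1.
  have : t * (2 * (Bk + 1)) <= 1.
    by rewrite -ler_pdivlMr // mul1r !ge_min lexx !orbT.
  by lra.
have t20 : 0 < t ^+ 2 by rewrite exprn_gt0.
(* The three entries serve [muH] and [muK], then [err1], then [err2]; [X] below dominates each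
   quantity that mu multiplies there. *)
pose d := Num.min 2^-1 (Num.min (3^-1 * t ^+ 2) (p ^+ 2 * total_length G)).
have d0 : 0 < d by rewrite !lt_min invr_gt0 ltr0n mulr_gt0 ?invr_gt0 // mulr_gt0.
pose X := C * ((K + 1) * B) + C * (K + 1) + K6 + 1.
have CK0 : 0 <= C * ((K + 1) * B) by rewrite !mulr_ge0.
have CK1 : 0 <= C * (K + 1) by rewrite mulr_ge0.
have X0 : 0 < X by rewrite /X; lra.
exists (d / X), B; split=> //; first by rewrite divr_gt0.
move=> mu mu0; rewrite ler_pdivlMr // => muX.
have muY Y : Y <= X -> mu * Y <= d by move=> YX; apply: le_trans muX; rewrite ler_wpM2l // ltW.
have d1 : d <= 2^-1 by rewrite ge_min lexx.
have d2 : d <= 3^-1 * t ^+ 2 by rewrite !ge_min lexx orbT.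
have d3 : d <= p ^+ 2 * total_length G by rewrite !ge_min lexx !orbT.
have pL : 0 < p ^+ 2 * total_length G by rewrite mulr_gt0.
have muH : mu * (C * ((K + 1) * B)) <= 2^-1.
  by apply: le_trans (muY _ _) d1; rewrite /X; lra.
have muK : mu * (C * (K + 1)) <= 2^-1.
  by apply: le_trans (muY _ _) d1; rewrite /X; lra.
have muE : energy_error G C B K mu <= d by apply: muY; rewrite /X -/K6; lra.
have err1 : energy_error G C B K mu < 2 / 3 * t ^+ 2 by lra.
have err2 : energy_error G C B K mu < rho - 2 * p ^+ 2 * total_length G.
  by rewrite /rho; lra.
have BE : n%:R * Bk * (rho + 1) + 1 <= B by [].
have [y [w [q [yr aw Un0 crit]]]] := critical_exists c0 s0 dc ds ophi basis p6 C0 CP Bk0 BkP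
   (ltW rho0) B0 BE K0 KP mu0 muH muK (Ordinal n0) t0 tr Bt err1 err2.
have UB := total_bounded BkP (ltW rho0) BE muH yr aw.
have cU := continuous_total dc ds aw.
case: (aw) => cq qE [[w1 kw] wo] _.
(* Criticality says that [q] has no kernel component, so the equation modulo K is the full
   equation. *)
have q0 : (fun e x => q e x - proj c s phi q e x) = q.
  apply/funext => e; apply/funext => x; rewrite /proj big1 ?subr0 // => i _.
  rewrite (@eq_ip _ _ q _ (fun e x => mu * residual p (total c s phi y w) e x)
    (hom c s (phi i))) //.
  rewrite ipZl ?crit ?mulr0 ?mul0r //; first exact: (continuous_residual p6 cU).
  by move=> e'; exact: (continuous_hom dc ds).
rewrite q0 in kw.
have := kirchhoff_sol_lin 1 1 kw (kernel_sol dc ds (kernel_sum (fun i => y 0 i) ophi.1)).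
set U1 := (X in kirchhoff_sol _ _ _ X) => kU.
exists (total c s phi y w), U1, q; split=> //.
have <- : (fun e x => 1 * q e x + 1 * 0) = q.
  by apply/funext => e; apply/funext => x; ring.
rewrite (_ : total c s phi y w = fun e x => 1 * w e x + 1 *
  hom c s (fun d => \sum_i y 0 i * phi i d) e x) //.
by apply/funext => e; apply/funext => x; rewrite !mul1r addrC.
Qed.

End Branch.

(** * Classical solutions and weak derivatives *)

Section ClassicalSolutions.
Variables (R : realType) (G : compact_metric_graph R).
Implicit Types (u v w q : edge G -> R -> R) (e : edge G).

Lemma is_derive_diff_quotient (W : R -> R) (a d : R) : is_derive a 1 W d ->
  diff_quotient W a h @[h --> 0^'] --> d.
Proof.
move=> dW; have /cvg_ex[l Wl] : derivable W a 1 by apply: ex_derive.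
have <- : l = d.
  have : 'D_1 W a = d by apply: derive_val.
  by move=> <-; apply/esym; apply: cvg_lim Wl.
apply: cvg_trans Wl; apply: near_eq_cvg; near=> h.
by rewrite /diff_quotient /GRing.scale /= mulr1 [h + a]addrC.
Unshelve. all: by end_near. Qed.

Lemma end_derivative u W (W1 : edge G -> R -> R) :
  (forall e (x : R), is_derive x 1 (W e) (W1 e x)) ->
  (forall e x, 0 <= x <= len e -> u e x = W e x) ->
  forall e b, end_derivable u e b /\ outward_derivative u e b = out_value W1 e b.
Proof.
move=> dW uW e b; have l0 := len_gt0 e.
have u0 : diff_quotient (u e) 0 h @[h --> 0^'+] --> W1 e 0.
  have := cvg_dnbhs_at_right (is_derive_diff_quotient (dW e 0)).
  apply: cvg_trans; apply: near_eq_cvg; near=> h.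
  have h0 : 0 < h by near: h; exact: nbhs_right_gt.
  have hl : h < len e by near: h; exact: nbhs_right_lt.
  by rewrite /diff_quotient add0r !uW ?lexx ?(ltW h0) ?(ltW l0) ?(ltW hl).
have ul : diff_quotient (u e) (len e) h @[h --> 0^'-] --> W1 e (len e).
  have := cvg_dnbhs_at_left (is_derive_diff_quotient (dW e (len e))).
  apply: cvg_trans; apply: near_eq_cvg; near=> h.
  have h0 : h < 0 by near: h; exact: nbhs_left_lt.
  have hl : - len e < h by near: h; apply: nbhs_left_gt; rewrite oppr_lt0.
  rewrite /diff_quotient !uW ?lexx ?(ltW l0) //.
  by apply/andP; split; lra.
case: b; rewrite /end_derivable /outward_derivative /=; split.
- by apply/cvg_ex; exists (W1 e (len e)).
- by congr (- _); exact: cvg_lim ul.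
- by apply/cvg_ex; exists (W1 e 0).
- exact: cvg_lim u0.
Unshelve. all: by end_near. Qed.

Lemma is_derive_derive1 (W W1 : R -> R) : (forall x : R, is_derive x 1 W (W1 x)) ->
  derive1 W = W1.
Proof. by move=> dW; apply/funext => x; rewrite derive1E; apply: derive_val. Qed.

Lemma kirchhoff_sol_classical m q w w1 : kirchhoff_sol m q w w1 ->
  [/\ graph_continuous w, twice_derivable_on_edges w, kirchhoff w &
    forall e x, derive1n 2 (w e) x = - m * w e x - q e x].
Proof.
move=> [ow cw bw]; have [dw dw1] := ow; have [cw0 _] := ode_continuous ow.
have ed := end_derivative dw (fun e x _ => erefl).
split.
- by split=> // e; exact: continuous_subspaceT.
- move=> e x _; split; first by apply: ex_derive.
  by rewrite (is_derive_derive1 (dw e)); apply: ex_derive.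
- split=> [e b|v]; first by have [] := ed e b.
  by rewrite -[RHS](bw v); apply: eq_bigr => d _; have [_] := ed d.1 d.2.
- by move=> e x; rewrite /= (is_derive_derive1 (dw e)) (is_derive_derive1 (dw1 e)).
Qed.

Lemma eq_on_closed_interval (l : R) (f g : R -> R) : 0 < l ->
  {within `[0, l], continuous f} -> {within `[0, l], continuous g} ->
  (forall x, x \in `]0, l[ -> f x = g x) -> forall x, 0 <= x <= l -> f x = g x.
Proof.
move=> l0 /(continuous_within_itvP _ l0)[_ f0 fl] /(continuous_within_itvP _ l0)[_ g0 gl] fg.
move=> x /andP[x0 xl].
have [x0' | x0'] := ltP 0 x; last first.
  have -> : x = 0 by apply/le_anti/andP.
  apply: (cvg_unique _ f0); first exact: norm_hausdorff.
  apply: cvg_trans g0; apply: near_eq_cvg; near=> z; apply/esym/fg.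
  by rewrite in_itv /=; apply/andP; split; near: z;
    [exact: nbhs_right_gt|exact: nbhs_right_lt].
have [xl' | xl'] := ltP x l; first by apply: fg; rewrite in_itv /= x0'.
have -> : x = l by apply/le_anti/andP.
apply: (cvg_unique _ fl); first exact: norm_hausdorff.
apply: cvg_trans gl; apply: near_eq_cvg; near=> z; apply/esym/fg.
by rewrite in_itv /=; apply/andP; split; near: z;
    [exact: nbhs_left_gt|exact: nbhs_left_lt].
Unshelve. all: by end_near. Qed.

(** [v] minus a double antiderivative of [g] is affine inside the edge; slope and constant are read
    off at the midpoint, and continuity reaches the endpoints. This passes from the classical
    formulation to [ode] on R. *)
Lemma edge_extension (l : R) (v g : R -> R) : 0 < l ->
  {within `[0, l], continuous v} -> continuous g ->
  (forall x, x \in `]0, l[ -> [/\ derivable v x 1, derivable (derive1 v) x 1 &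
     derive1n 2 v x = g x]) ->
  exists V V1, [/\ forall x : R, is_derive x 1 V (V1 x), forall x : R, is_derive x 1 V1 (g x) &
    forall x, 0 <= x <= l -> v x = V x].
Proof.
move=> l0 cv cg dv.
have [G1 [_ dG1]] := antiderivative cg.
have [G2 [_ dG2]] := antiderivative (is_derive_continuous dG1).
have h2 : (l / 2) \in `]0, l[ by rewrite in_itv /=; lra.
pose k := derive1 v (l / 2) - G1 (l / 2).
have kE x : x \in `]0, l[ -> derive1 v x - G1 x = k.
  move=> xl; apply: (@is_derive_eq0_const _ (fun x => derive1 v x - G1 x) 0 l) => // z zl.
  have [_ /derivableP d2 E] := dv z zl.
  apply: is_derive_eq (is_deriveB d2 (dG1 z)) _.
  by move: E; rewrite /= (derive1E (derive1 v)) => ->; rewrite subrr.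
have dlin (x : R) : is_derive x 1 (fun x : R => k * x) k.
  by have := is_deriveZ k (is_derive_id x (1 : R)); rewrite /GRing.scale /= mulr1.
pose b := v (l / 2) - (G2 (l / 2) + k * (l / 2)).
have bE x : x \in `]0, l[ -> v x - (G2 x + k * x) = b.
  move=> xl; apply: (@is_derive_eq0_const _ (fun x => v x - (G2 x + k * x)) 0 l) => // z zl.
  have [/derivableP d1 _ _] := dv z zl.
  apply: is_derive_eq (is_deriveB d1 (is_deriveD (dG2 z) (dlin z))) _.
  by rewrite -derive1E; have := kE z zl; lra.
have dV (x : R) : is_derive x 1 (fun x => G2 x + k * x + b) (G1 x + k).
  apply: is_derive_eq (is_deriveD (is_deriveD (dG2 x) (dlin x)) (is_derive_cst b x 1)) _.
  by rewrite addr0.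
exists (fun x => G2 x + k * x + b), (fun x => G1 x + k); split=> //.
  move=> x; apply: is_derive_eq (is_deriveD (dG1 x) (is_derive_cst k x 1)) _.
  by rewrite addr0.
apply: eq_on_closed_interval => //.
  by apply: continuous_subspaceT; exact: is_derive_continuous dV.
by move=> x /bE <-; ring.
Qed.

Lemma classical_kirchhoff_sol m (r : R -> R) u : continuous r ->
  graph_continuous u -> twice_derivable_on_edges u -> kirchhoff u ->
  (forall e x, x \in `]0, len e[ -> derive1n 2 (u e) x = - m * u e x - r (u e x)) ->
  exists U U1 q, [/\ kirchhoff_sol m q U U1, forall e, continuous (q e),
    forall e x, 0 <= x <= len e -> u e x = U e x &
    forall e x, 0 <= x <= len e -> q e x = r (U e x)].
Proof.
move=> cr [cu uv] du [ue ku] uE.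
have l0 e := len_gt0 e.
pose t e x := u e (clamp (len e) x).
have ct e : continuous (t e) := within_continuous_clamp (ltW (l0 e)) (cu e).
have cg e : continuous (fun x => - m * t e x - r (t e x)).
  apply: continuous_sub; first exact: continuous_cmul.
  by move=> x; apply: continuous_comp; [exact: ct|exact: cr].
have /choice[VV VP] e : exists VV : (R -> R) * (R -> R),
    [/\ forall x : R, is_derive x 1 VV.1 (VV.2 x),
     forall x : R, is_derive x 1 VV.2 (- m * t e x - r (t e x)) &
     forall x, 0 <= x <= len e -> u e x = VV.1 x].
  have [|V [V1 VP]] := edge_extension (l0 e) (cu e) (cg e); last by exists (V, V1).
  move=> x xl; have [d1 d2] := du e x xl; split=> //.
  rewrite uE // /t clampE //; move: xl; rewrite in_itv /= => /andP[? ?].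
  by rewrite !ltW.
pose U e := (VV e).1; pose U1 e := (VV e).2.
(* Off the edge [q] is whatever makes the equation hold on R; on the edge t = U and it reduces to
   [r (U e x)]. *)
pose q e x := - m * U e x - (- m * t e x - r (t e x)).
have dU e (x : R) : is_derive x 1 (U e) (U1 e x) by have [] := VP e.
have uU e x : 0 <= x <= len e -> u e x = U e x by have [_ _] := VP e; exact.
have ed := end_derivative dU uU.
exists U, U1, q; split=> //; first split.
- split=> // e x; have [_ d _] := VP e; apply: is_derive_eq (d x) _.
  by rewrite /q; ring.
- move=> e b e' b' eb; have := uv _ _ _ _ eb; rewrite /end_value.
  by case: b {eb}; case: b'; rewrite !uU // ?lexx ltW.
- move=> v; rewrite -[RHS](ku v); apply: eq_bigr => d _.
  by have [_ ->] := ed d.1 d.2.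
- move=> e; apply: continuous_sub; last exact: cg.
  by apply: continuous_cmul; exact: is_derive_continuous (dU e).
- move=> e x xl; rewrite /q /t clampE // uU //; ring.
Qed.

End ClassicalSolutions.

(** * Test functions approximating indicators of intervals *)

Section Cutoff.
Variable R : realType.
Implicit Types (x a b : R).

(** T_k = 1 - 1 / (1 + (k + 1) F) with F the square of the positive part. Taking F as an
    antiderivative of 2 max(0, x) gives its C^1 regularity at 0 at once. *)
Lemma smooth_step : exists (T dT : nat -> R -> R),
  [/\ forall k (x : R), is_derive x 1 (T k) (dT k x), forall k, continuous (dT k),
    forall k x, 0 <= T k x <= 1, forall k x, x <= 0 -> T k x = 0 &
    forall x, 0 < x -> T k x @[k --> \oo] --> (1 : R)].
Proof.
have cm : continuous (fun x : R => 2 * Num.max 0 x).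
  apply: continuous_cmul => x.
  by apply: (@continuous_max _ _ (cst 0) id); [exact: cst_continuous|].
have [F [F0 dF]] := antiderivative cm.
have cF := is_derive_continuous dF.
have Fneg x : x <= 0 -> F x = 0.
  move=> x0; have [c] := MVT_segment x0 (fun z _ => dF z) (continuous_subspaceT cF).
  rewrite in_itv /= => /andP[_ c0]; rewrite max_l // mulr0 mul0r F0 sub0r => /eqP.
  by rewrite oppr_eq0 => /eqP.
have Fpos x : 0 < x -> 0 < F x.
  move=> x0; have [c] := MVT x0 (fun z _ => dF z) (continuous_subspaceT cF).
  rewrite in_itv /= => /andP[c0 _]; rewrite (max_r (ltW c0)) F0 !subr0 => ->.
  by rewrite !mulr_gt0.
have F_ge0 x : 0 <= F x.
  by have [/Fneg->//|/Fpos/ltW] := leP x 0.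
have den (k : nat) x : 0 < 1 + k.+1%:R * F x.
  by rewrite ltr_wpDr // mulr_ge0.
have dden (k : nat) x : is_derive x 1 (fun x => 1 + k.+1%:R * F x) (k.+1%:R * (2 * Num.max 0 x)).
  apply: is_derive_eq (is_deriveD (is_derive_cst (1 : R) x 1) (is_deriveZ k.+1%:R (dF x))) _.
  by rewrite add0r.
have cden (k : nat) : continuous (fun x => 1 + k.+1%:R * F x) := is_derive_continuous (dden k).
have cinv (k : nat) : continuous (fun x => (1 + k.+1%:R * F x)^-1).
  by move=> x; apply: (continuousV _ (cden k x)); rewrite gt_eqF.
exists (fun k x => 1 - (1 + k.+1%:R * F x)^-1).
exists (fun k x => (1 + k.+1%:R * F x)^-1 * (1 + k.+1%:R * F x)^-1 * (k.+1%:R * (2 * Num.max 0 x))).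
split.
- move=> k x; have dn0 : 1 + k.+1%:R * F x != 0 by rewrite gt_eqF.
  have h := @is_deriveV _ (fun x => 1 + k.+1%:R * F x) x _ _ dn0 (dden k x).
  have h' : is_derive x 1 (fun x => (1 + k.+1%:R * F x)^-1)
      (- (1 + k.+1%:R * F x) ^- 2 *: (k.+1%:R * (2 * Num.max 0 x))) by exact: h.
  apply: is_derive_eq (is_deriveB (is_derive_cst (1 : R) x 1) h') _.
  rewrite sub0r /GRing.scale /=; move: dn0; set D := 1 + k.+1%:R * F x => dn0.
  by field.
- by move=> k; apply: continuous_mul; [exact: continuous_mul|exact: continuous_cmul].
- move=> k x; rewrite subr_ge0 invf_le1 // lerDl mulr_ge0 //=.
  by rewrite gerBl invr_ge0 ltW.
- by move=> k x /Fneg ->; rewrite mulr0 addr0 invr1 subrr.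
- move=> x /Fpos Fx.
  rewrite -[X in _ --> X]subr0; apply: cvgB; first exact: cvg_cst.
  apply: (@squeeze_cvgr _ _ _ _ (fun=> 0) (fun k => (F x)^-1 * harmonic k)).
  + apply: nearW => k; rewrite invr_ge0 ltW //=.
    rewrite /harmonic /= -invfM lef_pV2 ?posrE ?mulr_gt0 //.
    by rewrite mulrC lerDr.
  + exact: cvg_cst.
  + by rewrite -[X in _ --> X](mulr0 (F x)^-1); apply: cvgMr; exact: cvg_harmonic.
Qed.

(** The product of a step rising at [a] and a reflected step at [b]. *)
Lemma cutoff (l a b : R) : 0 < a -> a < b -> b < l ->
  exists phi : nat -> R -> R, [/\ forall k, test_function l (phi k),
    forall k x, 0 <= phi k x <= 1, forall k, continuous (phi k),
    forall k x, x \notin `]a, b[ -> phi k x = 0 &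
    forall x, x \in `]a, b[ -> phi k x @[k --> \oo] --> (1 : R)].
Proof.
move=> a0 ab bl; have [T [dT [dTT cdT T01 Tneg Tcvg]]] := smooth_step.
have cT k : continuous (T k) := is_derive_continuous (dTT k).
have dl k (x : R) : is_derive x 1 (fun x => T k (x - a)) (dT k (x - a)).
  have h : is_derive x 1 (fun x => x - a) 1.
    by apply: is_derive_eq (is_deriveB (is_derive_id x 1) (is_derive_cst a x 1)) _; rewrite subr0.
  by apply: is_derive_eq (@is_derive1_comp _ (T k) (fun x => x - a) x _ _ (dTT k (x - a)) h) _;
    rewrite mulr1.
have dr k (x : R) : is_derive x 1 (fun x => T k (b - x)) (- dT k (b - x)).
  have h : is_derive x 1 (fun x => b - x) (-1).
    by apply: is_derive_eq (is_deriveB (is_derive_cst b x 1) (is_derive_id x 1)) _; rewrite sub0r.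
  by apply: is_derive_eq (@is_derive1_comp _ (T k) (fun x => b - x) x _ _ (dTT k (b - x)) h) _;
    rewrite mulrN1.
have csub (f : R -> R) : continuous f -> continuous (fun x => f (x - a)).
  move=> cf x; apply: (@continuous_comp _ _ _ (fun x => x - a) f); last exact: cf.
  by apply: continuousB => //; exact: cst_continuous.
have crev (f : R -> R) : continuous f -> continuous (fun x => f (b - x)).
  move=> cf x; apply: (@continuous_comp _ _ _ (fun x => b - x) f); last exact: cf.
  by apply: continuousB => //; exact: cst_continuous.
have zero k x : x \notin `]a, b[ -> T k (x - a) * T k (b - x) = 0.
  rewrite in_itv /= negb_and -!leNgt => /orP[xa|bx].
    by rewrite Tneg ?mul0r // subr_le0.
  by rewrite [X in _ * X]Tneg ?mulr0 // subr_le0.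
have dphi k (x : R) := is_deriveM (dl k x) (dr k x).
exists (fun k x => T k (x - a) * T k (b - x)); split=> //.
- move=> k; split.
  + by move=> x; have h := dphi k x; apply: (@ex_derive _ _ _ _ _ _ _ h).
  + rewrite (is_derive_derive1 (dphi k)); apply: continuous_add.
      apply: continuous_mul; first exact: csub.
      by move=> x; apply: continuousN; exact: crev.
    by apply: continuous_mul; [exact: crev|exact: csub].
  + exists a, b; split=> // x xab; apply: zero; apply: contra xab.
    by rewrite !in_itv /= => /andP[? ?]; rewrite !ltW.
- move=> k x; have /andP[h1 h2] := T01 k (x - a); have /andP[h3 h4] := T01 k (b - x).
  by rewrite mulr_ge0 //= mulr_ile1.
- by move=> k; apply: continuous_mul; [exact: csub|exact: crev].
- move=> x; rewrite in_itv /= => /andP[ax xb].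
  rewrite -[X in _ --> X]mulr1; apply: cvgM; apply: Tcvg; by rewrite subr_gt0.
Qed.

End Cutoff.

(** * Uniqueness of weak derivatives *)

Section WeakDerivative.
Variable R : realType.
Implicit Types (l x : R) (u v g f W : R -> R).
Local Notation mu := (@lebesgue_measure R).

Lemma open_integrable f l : continuous f -> mu.-integrable `]0, l[ (EFin \o f).
Proof.
move=> cf; apply: integrableS (continuous_integrable 0 l cf) => //.
exact: subset_itv_oo_cc.
Qed.

Lemma Rintegral_open f l : continuous f -> \int[mu]_(x in `]0, l[) f x = integral_0to l f.
Proof.
move=> cf; rewrite Rintegral_itv_obnd_cbnd; last exact: open_integrable.
rewrite Rintegral_itv_bndo_bndc //.
by apply: integrableS (continuous_integrable 0 l cf) => //; exact: subset_itv_co_cc.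
Qed.

Lemma square_integrable_integrable l v : square_integrable l v ->
  mu.-integrable `]0, l[ (EFin \o v).
Proof.
move=> [mv iv].
have i1 : mu.-integrable `]0, l[ (EFin \o (fun x => v x ^+ 2 + 1)).
  have i2 := open_integrable l (@cst_continuous _ _ (1 : R)).
  rewrite (_ : EFin \o _ = ((fun x => (v x ^+ 2)%:E) \+ (EFin \o fun=> 1%R))%E).
    by apply: integrableD => //; exact: measurable_itv.
  by apply/funext => x /=; rewrite EFinD.
apply: le_integrable i1 => //; first exact/measurable_EFinP.
move=> x _ /=; rewrite lee_fin [leRHS]ger0_norm; last by rewrite addr_ge0 ?sqr_ge0.
by rewrite -[v x ^+ 2]ger0_norm ?sqr_ge0 // normrX;
  have := sqr_ge0 (`|v x| - 1); have := normr_ge0 (v x); lra.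
Qed.

(** The cutoffs converge to the indicator of ]a, b[ and stay in [0, 1], so dominated convergence
    applies with |g| as the bound. *)
Lemma zero_integrals l g : mu.-integrable `]0, l[ (EFin \o g) ->
  (forall phi, test_function l phi -> \int[mu]_(x in `]0, l[) (g x * phi x) = 0) ->
  forall a b, 0 < a -> a < b -> b < l -> \int[mu]_(x in `]a, b[) g x = 0.
Proof.
move=> ig g0 a b a0 ab bl; have [phi [tphi phi01 cphi phiz phi1]] := cutoff a0 ab bl.
have mg : measurable_fun `]0, l[ g by apply/measurable_EFinP; exact: measurable_int ig.
have sub : `]a, b[ `<=` `]0, l[.
  by move=> x /=; rewrite !in_itv /= => /andP[? ?]; apply/andP; split; lra.
have mphi k : measurable_fun `]0, l[ (phi k).
  exact: measurable_funTS (continuous_measurable_fun (cphi k)).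
pose f_ k x := (g x * phi k x)%:E.
pose f x := ((g \_ `]a, b[) x)%:E.
have mf_ k : measurable_fun `]0, l[ (f_ k).
  by apply/measurable_EFinP; exact: measurable_funM.
have mf : measurable_fun `]0, l[ f.
  apply/measurable_EFinP; apply/measurable_restrict => //.
  by apply: measurable_funS mg => //; exact: subIsetl.
have f_f : {ae mu, forall x, (`]0, l[%classic : set R) x -> f_ ^~ x @ \oo --> f x}.
  apply: aeW => x xl; apply/cvg_EFin; first exact: nearW.
  rewrite patchE; case: ifPn => xab.
    rewrite -[X in _ --> X]mulr1; apply: cvgMr; apply: phi1.
    by rewrite inE in xab.
  apply: cvg_near_cst; apply: nearW => k; rewrite /= phiz ?mulr0 //.
  by apply: contra xab; rewrite inE.
have ig' : mu.-integrable `]0, l[ (fun x => `|g x|%:E).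
  by have := integrable_abse ig; apply: eq_integrable.
have f_g : {ae mu, forall x k, (`]0, l[%classic : set R) x -> (`|f_ k x| <= `|g x|%:E)%E}.
  apply: aeW => x k xl; rewrite lee_fin normrM; have /andP[h1 h2] := phi01 k x.
  by rewrite (ger0_norm h1) ler_piMr.
have [|_ _ cvg] := @dominated_convergence _ _ R mu _ _ f_ f _ mf_ mf f_f ig' f_g.
  exact: measurable_itv.
have f_0 k : (\int[mu]_(x in `]0%R, l[) f_ k x = 0)%E.
  have ifk : mu.-integrable `]0, l[ (f_ k).
    apply: le_integrable ig; [exact: measurable_itv|exact: mf_|].
    move=> x _ /=; rewrite lee_fin normrM; have /andP[h1 h2] := phi01 k x.
    by rewrite (ger0_norm h1) ler_piMr.
  have := g0 _ (tphi k); rewrite /Rintegral => h.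
  by rewrite -[LHS]fineK ?h //; exact: integrable_fin_num.
have fE : (\int[mu]_(x in `]0%R, l[) f x = 0)%E.
  have : ([sequence \int[mu]_(x in `]0%R, l[) f_ n x]_n @ \oo --> (0 : \bar R))%E.
    by apply: cvg_near_cst; apply: nearW => k /=; rewrite f_0.
  by move=> h; apply: cvg_unique cvg h; exact: ereal_hausdorff.
have -> : (`]a, b[ : set R)%classic = `]0, l[ `&` `]a, b[ by apply/esym/setIidPr.
by rewrite Rintegral_mkcondr /Rintegral fE.
Qed.

(** The indefinite integral is constant on ]0, l[, and by Lebesgue differentiation its derivative is
    [g] almost everywhere. *)
Lemma ae_zero l g : mu.-integrable `]0, l[ (EFin \o g) ->
  (forall a b, 0 < a -> a < b -> b < l -> \int[mu]_(x in `]a, b[) g x = 0) ->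
  {ae mu, forall x, x \in `]0, l[ -> g x = 0}.
Proof.
move=> ig g0; pose f := g \_ `]0, l[.
have iT : mu.-integrable setT (EFin \o f).
  by rewrite -restrict_EFin; apply/integrable_restrict => //; rewrite setTI.
have iy (A : set R) : measurable A -> mu.-integrable A (EFin \o f).
  by move=> mA; apply: integrableS iT.
have := @FTC1Ny R f (fun y => iy _ (measurable_itv _))
  (integrable_locally_restrict (measurable_itv _) ig).
apply: filterS; first exact: (ae_filter_ringOfSetsType mu).
move=> x /= [dF F'] xl.
have fx : f x = g x by rewrite /f patchE mem_set.
rewrite -fx -F' derive1E.
have xl' := xl; rewrite in_itv /= in xl'; case/andP: xl' => x0 x1.
have Fz : \forall y \near x, \int[mu]_(t in `]-oo, x]) f t = \int[mu]_(t in `]-oo, y]) f t.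
  have key y z : y \in `]0, l[ -> z \in `]0, l[ -> y < z ->
      \int[mu]_(t in `]-oo, y]) f t = \int[mu]_(t in `]-oo, z]) f t.
    rewrite !in_itv /= => /andP[y0 y1] /andP[z0 z1] yz.
    apply/esym/eqP; rewrite -subr_eq0; apply/eqP.
    rewrite Rintegral_itvB; [|exact: iy|by []|by rewrite bnd_simp ltW].
    rewrite -Rintegral_itv_bndo_bndc; last exact: iy.
    rewrite -[RHS](g0 y z y0 yz z1); apply: eq_Rintegral => t.
    rewrite inE /= in_itv /= => /andP[yt tz].
    rewrite /f patchE mem_set //= in_itv /=; apply/andP; split; lra.
  near=> y; have yl : y \in `]0, l[ by near: y; exact: near_in_itvoo.
  have [xy|yx|->] := ltgtP x y => //; first exact: key.
  by apply/esym/key.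
have := near_eq_is_derive Fz (is_derive_cst (\int[mu]_(t in `]-oo, x]) f t) x 1).
by move=> h; apply: derive_val.
Unshelve. all: by end_near. Qed.

Lemma square_integrable_continuous l v W : continuous W ->
  (forall x, x \in `]0, l[ -> v x = W x) -> square_integrable l v.
Proof.
move=> cW vW; have mW : measurable_fun `]0, l[ W.
  exact: measurable_funTS (continuous_measurable_fun cW).
split; first by apply: eq_measurable_fun mW => x; rewrite inE => xl; rewrite vW.
have cW2 : continuous (fun x => W x ^+ 2).
  by have := continuous_mul cW cW; under eq_fun do rewrite -expr2.
by apply: eq_integrable (open_integrable l cW2) => // x; rewrite inE => xl /=; rewrite vW.
Qed.

Lemma weak_derivative_classical l v W W1 : 0 < l -> continuous W1 ->
  (forall x, is_derive x 1 W (W1 x)) -> (forall x, x \in `]0, l[ -> v x = W x) ->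
  is_weak_derivative l v W1.
Proof.
move=> l0 cW1 dW vW; split; first exact: (square_integrable_continuous cW1).
have cW := is_derive_continuous dW.
move=> phi [dphi cdphi [a [b [a0 bl phi0]]]].
have dphi' x : is_derive x 1 phi (derive1 phi x) by rewrite derive1E; exact: derivableP.
have cphi := is_derive_continuous dphi'.
rewrite (_ : \int[mu]_(x in _) _ = \int[mu]_(x in `]0, l[) (W x * derive1 phi x)); last first.
  by apply: eq_Rintegral => x; rewrite inE => xl; rewrite vW.
rewrite !Rintegral_open; try exact: continuous_mul.
apply/eqP; rewrite -subr_eq0 opprK -integral_0toD; try exact: continuous_mul.
have dP x : is_derive x 1 (fun x => W x * phi x) (W x * derive1 phi x + W1 x * phi x).
  by apply: is_derive_eq (is_deriveM (dW x) (dphi' x)) _; rewrite /GRing.scale /= [phi x * _]mulrC.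
rewrite (integral_0to_FTC l0 _ dP); last by apply: continuous_add; exact: continuous_mul.
rewrite [phi l]phi0 ?[phi 0]phi0 ?mulr0 ?subrr //; rewrite in_itv /= negb_and -!ltNge ?a0 //.
by rewrite bl orbT.
Qed.

(** [weak_derivative] is an arbitrary choice, so computing the norm requires that any choice agrees
    almost everywhere with the classical derivative. *)
Lemma weak_derivative_integral l v W W1 : 0 < l -> continuous W1 ->
  (forall x, is_derive x 1 W (W1 x)) -> (forall x, x \in `]0, l[ -> v x = W x) ->
  in_H1_interval l v /\
  \int[mu]_(x in `]0, l[) (weak_derivative l v x ^+ 2 + v x ^+ 2) =
  integral_0to l (fun x => W1 x ^+ 2 + W x ^+ 2).
Proof.
move=> l0 cW1 dW vW; have cW := is_derive_continuous dW.
have wd := weak_derivative_classical l0 cW1 dW vW.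
have sv := square_integrable_continuous cW vW.
split; first by split=> //; exists W1.
have [sg gP] : is_weak_derivative l v (weak_derivative l v).
  by rewrite /weak_derivative; case: xgetP => // /(_ W1).
set g := weak_derivative l v.
have ig := square_integrable_integrable sg.
have iW1 := open_integrable l cW1.
have id : mu.-integrable `]0, l[ (EFin \o (fun x => g x - W1 x)).
  rewrite (_ : EFin \o _ = ((EFin \o g) \- (EFin \o W1))%E).
    by apply: integrableB => //; exact: measurable_itv.
  by apply/funext => x /=; rewrite EFinB.
have d0 phi : test_function l phi -> \int[mu]_(x in `]0, l[) ((g x - W1 x) * phi x) = 0.
  move=> tphi; have := gP _ tphi; rewrite (wd.2 _ tphi) => /oppr_inj h.
  have [dphi _ [a [b [a0 bl phi0]]]] := tphi.
  have cphi : continuous phi.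
    by move=> x; apply/differentiable_continuous/derivable1_diffP; exact: dphi.
  have iphi (f : R -> R) : mu.-integrable `]0, l[ (EFin \o f) ->
      mu.-integrable `]0, l[ (EFin \o (fun x => f x * phi x)).
    move=> if_; have mf : measurable_fun `]0, l[ f.
      by apply/measurable_EFinP; exact: measurable_int if_.
    have [c _ cP] := @EVT_max R (fun x => `|phi x|) 0 l (ltW l0)
      (continuous_subspaceT (fun x => continuous_comp (cphi x) (@norm_continuous _ _ _))).
    have ic : mu.-integrable `]0, l[ (fun x => `|phi c|%:E * (EFin \o f) x)%E.
      by apply: integrableZl => //; exact: measurable_itv.
    apply: le_integrable ic; first exact: measurable_itv.
      apply/measurable_EFinP; apply: measurable_funM => //.
      exact: measurable_funTS (continuous_measurable_fun cphi).
    move=> x xl /=; rewrite lee_fin !normrM mulrC ler_wpM2r // normr_id.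
    by apply: cP; move: xl; rewrite /= !in_itv /= => /andP[? ?]; rewrite !ltW.
  transitivity (\int[mu]_(x in `]0, l[) (g x * phi x - W1 x * phi x)).
    by apply: eq_Rintegral => x _; rewrite mulrBl.
  by rewrite RintegralB ?h ?subrr //; exact: iphi.
have ae := ae_zero id (zero_integrals id d0).
rewrite -Rintegral_open; last first.
  by apply: continuous_add; under eq_fun do rewrite expr2; exact: continuous_mul.
rewrite /Rintegral; congr fine; apply: ae_eq_integral => //.
- apply/measurable_EFinP; apply: measurable_funD; apply: measurable_funX; first exact: sg.1.
  exact: sv.1.
- apply/measurable_EFinP; apply: measurable_funTS; apply: continuous_measurable_fun.
  by apply: continuous_add; under eq_fun do rewrite expr2; exact: continuous_mul.
move: ae; apply: filterS; first exact: (ae_filter_ringOfSetsType mu).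
move=> x h xl; have := h xl; move/eqP; rewrite subr_eq0 => /eqP ->.
by rewrite vW.
Qed.

End WeakDerivative.

(** * Bifurcation points and eigenvalues *)

Section SobolevBounds.
Variable R : realType.

(** At some point W1 equals (W l - W 0) / l, and from there it varies by at most Q l. This bounds
    the H^1 norm of the rescaled solutions uniformly in mu. *)
Lemma derivative_bound (l M Q : R) (W W1 W2 : R -> R) : 0 < l ->
  (forall x : R, is_derive x 1 W (W1 x)) -> (forall x : R, is_derive x 1 W1 (W2 x)) ->
  (forall x, 0 <= x <= l -> `|W x| <= M) -> (forall x, 0 <= x <= l -> `|W2 x| <= Q) ->
  forall x, 0 <= x <= l -> `|W1 x| <= 2 * M / l + Q * l.
Proof.
move=> l0 dW dW1 WM W2Q x xl.
have [c] := MVT l0 (fun z _ => dW z) (continuous_subspaceT (is_derive_continuous dW)).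
rewrite in_itv /= subr0 => /andP[c0 cl] cE.
have W1c : `|W1 c| <= 2 * M / l.
  rewrite ler_pdivlMr // -[X in _ * X](gtr0_norm l0) -normrM -cE.
  have h1 : `|W l| <= M by apply: WM; rewrite lexx ltW.
  have h2 : `|W 0| <= M by apply: WM; rewrite lexx ltW.
  by apply: (le_trans (ler_normB _ _)); lra.
have Q0 : 0 <= Q by apply: le_trans (W2Q x xl).
have diff y z : 0 <= y -> y <= z -> z <= l -> `|W1 z - W1 y| <= Q * l.
  move=> y0 yz zl.
  have [d] := MVT_segment yz (fun z _ => dW1 z) (continuous_subspaceT (is_derive_continuous dW1)).
  rewrite in_itv /= => /andP[yd dz] ->; rewrite normrM ler_pM //.
    by apply: W2Q; rewrite (le_trans y0 yd) (le_trans dz zl).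
  by rewrite ger0_norm ?subr_ge0 //; lra.
have -> : W1 x = W1 c + (W1 x - W1 c) by ring.
apply: (le_trans (ler_normD _ _)); rewrite lerD //.
case/andP: xl => x0 xl; have [cx|xc] := leP c x; first exact: diff (ltW c0) cx xl.
by rewrite distrC; exact: diff x0 (ltW xc) (ltW cl).
Qed.

(** The embedding of H^1 into the bounded functions: W(x)^2 exceeds W(y)^2 by at most the full
    integral, and averaging over y gives the claim. *)
Lemma sup_le_sobolev (l : R) (W W1 : R -> R) : 0 < l -> continuous W1 ->
  (forall x : R, is_derive x 1 W (W1 x)) -> forall x, 0 <= x <= l ->
  W x ^+ 2 <= (l^-1 + 1) * integral_0to l (fun y => W1 y ^+ 2 + W y ^+ 2).
Proof.
move=> l0 cW1 dW x /andP[x0 xl]; have cW := is_derive_continuous dW.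
have csq (f : R -> R) : continuous f -> continuous (fun y => f y ^+ 2).
  by move=> cf; under eq_fun do rewrite expr2; exact: continuous_mul.
pose g y := W1 y ^+ 2 + W y ^+ 2.
have cg : continuous g by apply: continuous_add; exact: csq.
have g0 y : 0 <= g y by rewrite addr_ge0 ?sqr_ge0.
have [E [E0 dE]] := antiderivative cg.
have El := integral_0to_FTC l0 cg dE; rewrite E0 subr0 in El; rewrite -/g El.
have mono (F f : R -> R) : (forall z : R, is_derive z 1 F (f z)) ->
    (forall z, 0 <= f z) -> forall y z, y <= z -> F y <= F z.
  move=> dF f0 y z yz; rewrite -subr_ge0.
  have [c _ ->] := MVT_segment yz (fun z _ => dF z)
    (continuous_subspaceT (is_derive_continuous dF)).
  by rewrite mulr_ge0 // subr_ge0.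
have Emono := mono E g dE g0.
have dW2 (y : R) : is_derive y 1 (fun y => W y ^+ 2) (2 * (W y * W1 y)).
  have -> : (fun y => W y ^+ 2) = (fun y => W y * W y) by apply/funext => z; rewrite expr2.
  by apply: is_derive_eq (is_deriveM (dW y) (dW y)) _; rewrite /GRing.scale /=; ring.
(* The derivatives of E - W^2 and E + W^2 are the squares of W - W1 and W + W1, so W^2 varies no
   more than E. *)
have up := mono (fun y => E y - W y ^+ 2) (fun y => g y - 2 * (W y * W1 y))
  (fun y => is_deriveB (dE y) (dW2 y)).
have dn := mono (fun y => E y + W y ^+ 2) (fun y => g y + 2 * (W y * W1 y))
  (fun y => is_deriveD (dE y) (dW2 y)).
have diff y : 0 <= y <= l -> W x ^+ 2 <= W y ^+ 2 + E l.
  move=> /andP[y0 yl]; have [yx|/ltW xy] := leP y x.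
    have h := up _ _ _ yx; have h2 := Emono _ _ xl; have h3 := Emono _ _ y0; rewrite E0 in h3.
    suff : E y - W y ^+ 2 <= E x - W x ^+ 2 by lra.
    by apply: h => z; rewrite /g; have := sqr_ge0 (W z - W1 z); lra.
  have h := dn _ _ _ xy; have h2 := Emono _ _ yl; have h3 := Emono _ _ x0; rewrite E0 in h3.
  suff : E x + W x ^+ 2 <= E y + W y ^+ 2 by lra.
  by apply: h => z; rewrite /g; have := sqr_ge0 (W z + W1 z); lra.
have cc (k : R) : continuous (fun _ : R => k) by exact: cst_continuous.
have : W x ^+ 2 * l <= integral_0to l (fun y => W y ^+ 2) + E l * l.
  rewrite -!integral_0to_cst // -integral_0toD //; last exact: csq.
  by apply: le_integral_0to => //; apply: continuous_add => //; exact: csq.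
have : integral_0to l (fun y => W y ^+ 2) <= E l.
  rewrite -El; apply: le_integral_0to => //; first exact: csq.
  by move=> y _; rewrite /g lerDr sqr_ge0.
move=> h1 h2; have h3 : W x ^+ 2 * l <= (l^-1 + 1) * E l * l.
  have -> : (l^-1 + 1) * E l * l = E l + E l * l by field; rewrite gt_eqF.
  by apply: (le_trans h2); rewrite lerD2r.
by rewrite ler_pM2r in h3.
Qed.

Variable G : compact_metric_graph R.
Implicit Types (u U : edge G -> R -> R).

Lemma H1_normE u U U1 : (forall e, continuous (U1 e)) ->
  (forall e (x : R), is_derive x 1 (U e) (U1 e x)) ->
  (forall e x, 0 <= x <= len e -> u e x = U e x) ->
  (forall e, in_H1_interval (len e) (u e)) /\
  H1_norm u = Num.sqrt (\sum_e integral_0to (len e) (fun x => U1 e x ^+ 2 + U e x ^+ 2)).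
Proof.
move=> cU1 dU uU.
have w e := weak_derivative_integral (len_gt0 e) (cU1 e) (dU e) (v := u e).
have uU' e x : x \in `]0, len e[ -> u e x = U e x.
  by rewrite in_itv /= => /andP[? ?]; apply: uU; rewrite !ltW.
split=> [e|]; first by have [] := w e (uU' e).
by congr Num.sqrt; apply: eq_bigr => e _; have [_ ->] := w e (uU' e).
Qed.

Lemma max_attained u : (forall e, continuous (u e)) ->
  exists e0 x0, 0 <= x0 <= len e0 /\ bounded_by `|u e0 x0| u.
Proof.
move=> cu.
have /choice[c cP] e : exists c, 0 <= c <= len e /\
    forall x, 0 <= x <= len e -> `|u e x| <= `|u e c|.
  have [|c cl cm] := @EVT_max R (fun x => `|u e x|) 0 (len e) (ltW (len_gt0 e)).
    apply: continuous_subspaceT => x.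
    by apply: continuous_comp; [exact: cu|exact: norm_continuous].
  by exists c; split=> // x xl; apply: cm; rewrite in_itv.
have /card_gt0P[e1 _] := edge_inhabited G.
have [e0 _ e0P] := @arg_maxP _ _ _ e1 predT (fun e => `|u e (c e)|) isT.
exists e0, (c e0); split; first by case: (cP e0).
by move=> e x xl; apply: le_trans ((cP e).2 x xl) _; exact: e0P.
Qed.

End SobolevBounds.

(** * Bifurcation points are eigenvalues *)

Section BifurcationPoints.
Variables (R : realType) (G : compact_metric_graph R).
Implicit Types (u U q : edge G -> R -> R) (e : edge G).

(** The multiplicity clause for n = 1, since a single nonzero function is linearly independent. *)
Lemma eigenvalue_sequence_range (lambda_ : nat -> R) : eigenvalue_sequence G lambda_ ->
  [set lambda_ j | j in [set j : nat | (1 <= j)%N]] =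
  [set m : R | exists u : graph_function G, eigenfunction m u].
Proof.
move=> [_ mult]; apply/seteqP; split=> [_ [j /= j1 <-]|m [u eu]] /=.
  have [|phi [ephi _]] := (mult (lambda_ j) 1%N).2.
    by exists (fun _ => j); split=> // x y _; rewrite !ord1.
  by exists (phi ord0).
have [|s [_ sP]] := (mult m 1%N).1.
  exists (fun _ => u); split=> // c cu i; rewrite ord1.
  have [_ _ _ [e [x [xl ux]]] _] := eu.
  have := cu e x xl; rewrite big_ord1 => /eqP.
  by rewrite mulf_eq0 (negPf ux) orbF => /eqP.
by have [s1 sE] := sP ord0; exists (s ord0).
Qed.

Lemma kernel_eigenfunction (m : R) (c s : R -> R) n (phi : 'I_n -> edge G * bool -> R) :
  c 0 = 1 -> s 0 = 0 -> (forall x : R, is_derive x 1 c (- m * s x)) ->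
  (forall x : R, is_derive x 1 s (c x)) -> orthonormal_kernel m c s phi -> 'I_n ->
  exists u : graph_function G, eigenfunction m u.
Proof.
move=> c0 s0 dc ds [kphi ophi] i.
have [gc tw ki eq2] := kirchhoff_sol_classical (kernel_sol dc ds (kphi i)).
exists (hom c s (phi i)); split=> //.
  apply: contrapT => h; have := ophi i i; rewrite eqxx.
  rewrite (@eq_ip _ _ _ _ (fun _ _ => 0) (hom c s (phi i))) // ?ip0l.
    by move/eqP; rewrite eq_sym oner_eq0.
  move=> e x xl; apply: contrapT => /eqP n0; apply: h.
  by exists e, x; rewrite in_itv.
by move=> e x _; rewrite eq2 subr0 mulNr opprK.
Qed.

(** With an empty basis the projection is 0, so the reduced resolvent is the full one. *)
Lemma no_kernel_bound (m : R) (c s : R -> R) (phi : 'I_0 -> edge G * bool -> R) :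
  c 0 = 1 -> s 0 = 0 -> (forall x : R, is_derive x 1 c (- m * s x)) ->
  (forall x : R, is_derive x 1 s (c x)) -> orthonormal_kernel m c s phi ->
  (forall z, kernel_data m c s z ->
     forall d, z d = \sum_i ip (hom c s z) (hom c s (phi i)) * phi i d) ->
  exists2 C, 0 <= C & forall q U U1 M, (forall e, continuous (q e)) ->
    kirchhoff_sol m q U U1 -> 0 <= M -> bounded_by M q -> bounded_by (C * M) U.
Proof.
move=> c0 s0 dc ds ophi basis.
have [C C0 CP] := reduced_sol_bounded c0 s0 dc ds ophi basis.
exists C => // q U U1 M cq kU M0 qM; apply: (CP q) => //; split; last by case.
exists U1; rewrite (_ : (fun e x => _) = q) //.
by apply/funext => e; apply/funext => x; rewrite /proj big_ord0 subr0.
Qed.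

Lemma bifurcation_eigenvalue (p m : R) : 6 < p -> bifurcation_point G p m ->
  exists u : graph_function G, eigenfunction m u.
Proof.
move=> p6 [lam [u [sol lamm H1u]]].
have [c [s [c0 s0 dc ds]]] := exists_cos_sin m.
have [n [phi [ophi basis]]] := @kernel_basis R G m c s c0 s0 dc ds.
case: n phi ophi basis => [|n] phi ophi basis; last first.
  exact: (kernel_eigenfunction c0 s0 dc ds ophi ord0).
exfalso.
have [C C0 CP] := no_kernel_bound c0 s0 dc ds ophi basis.
pose K := \sum_(e : edge G) ((len e)^-1 + 1).
have K0 e : (len e)^-1 + 1 <= K.
  rewrite /K (bigD1 e) //= lerDl sumr_ge0 // => e' _.
  by rewrite addr_ge0 // invr_ge0 ltW ?len_gt0.
(* [S] is the maximum of |u k|. The first bound makes it tend to 0, while the second prevents it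
   from being small once [lam k + m] is. *)
have key k : exists S, [/\ 0 < S, S ^+ 2 <= K * H1_norm (u k) ^+ 2 &
    S <= C * ((S `^ (p - 2) + `|lam k + m|) * S)].
  have [[e1 [x1 [xl1 ux1]]] [[gc inH] tw ki eq2]] := sol k.
  (* Moving lam k + m to the right-hand side keeps the operator L, and its constant [C], fixed along
     the sequence. *)
  pose r a := nonlin p a - (lam k + m) * a.
  have cr : continuous r.
    have cid : continuous (fun a : R => a) by move=> a; exact: cvg_id.
    by apply: continuous_sub; [exact: (continuous_nonlin p6)|exact: continuous_cmul].
  have [|U [U1 [q [kU cq uU qE]]]] := @classical_kirchhoff_sol R G m r (u k) cr gc tw ki.
    move=> e x xl; have := eq2 e x xl; rewrite /r /nonlin.
    move: (derive1n 2 _ _) (`|_| `^ _ * _) => D P h.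
    have -> : D = lam k * u k e x - P by rewrite -h; ring.
    ring.
  have [ow _ _] := kU; have [cU cU1] := ode_continuous ow.
  have [e0 [x0 [xl0 Smax]]] := max_attained cU.
  pose S := `|U e0 x0|.
  have S0 : 0 < S.
    have xl1' : 0 <= x1 <= len e1 by move: xl1; rewrite in_itv.
    by apply: lt_le_trans (Smax e1 x1 xl1'); rewrite -uU ?normr_gt0.
  have [_ H1E] := H1_normE cU1 ow.1 uU.
  have pos e : 0 <= integral_0to (len e) (fun x => U1 e x ^+ 2 + U e x ^+ 2).
    by apply: Rintegral_ge0 => x _; rewrite addr_ge0 ?sqr_ge0.
  exists S; split=> //.
    rewrite H1E sqr_sqrtr; last by apply: sumr_ge0 => e _; exact: pos.
    rewrite -normrX ger0_norm ?sqr_ge0 //.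
    apply: (le_trans (sup_le_sobolev (len_gt0 e0) (cU1 e0) (ow.1 e0) xl0)).
    apply: ler_pM => //; first by rewrite addr_ge0 // invr_ge0 ltW ?len_gt0.
    by rewrite [leRHS](bigD1 e0) //= lerDl; apply: sumr_ge0 => e _; exact: pos.
  have M0 : 0 <= (S `^ (p - 2) + `|lam k + m|) * S.
    by rewrite mulr_ge0 ?addr_ge0 ?powR_ge0 // ltW.
  apply: (CP q U U1 _ cq kU M0) xl0 => e x xl.
  rewrite qE // /r; apply: (le_trans (ler_normB _ _)); rewrite [leRHS]mulrDl; apply: lerD.
    apply: (le_trans (nonlin_small p6 (ltW S0) (Smax e x xl))).
    by rewrite ler_wpM2l ?powR_ge0 // Smax.
  by rewrite normrM ler_wpM2l // Smax.
(* For S < min(1, eps) one has S^(p-2) <= S < eps, so the second bound in [key] would give 1 <= 2 C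
   eps < 1. *)
pose eps := (2 * (C + 1))^-1.
have C1 : 0 < 2 * (C + 1) by rewrite mulr_gt0 // ltr_wpDl.
have eps0 : 0 < eps by rewrite invr_gt0.
have epsC : 2 * (C * eps) < 1.
  rewrite /eps mulrA -[_ * _^-1]/(_ / _) ltr_pdivrMr // mul1r ltr_pM2l //.
  by rewrite ltrDl.
pose del := Num.min 1 eps.
have del0 : 0 < del by rewrite lt_min ltr01.
have K1 : 0 <= K.
  by apply: sumr_ge0 => e _; rewrite addr_ge0 // invr_ge0 ltW ?len_gt0.
have lim1 : \forall k \near \oo, `|lam k + m| < eps.
  have h : (- lam k) @[k --> \oo] --> m := lamm.
  have /cvgrPdist_lt/(_ _ eps0) := h; apply: filterS => k.
  by rewrite opprK addrC.
have lim2 : \forall k \near \oo, K * H1_norm (u k) ^+ 2 < del ^+ 2.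
  have h : K * H1_norm (u k) ^+ 2 @[k --> \oo] --> K * (0 * 0).
    by apply: cvgMr; under eq_fun do rewrite expr2; exact: cvgM.
  rewrite !mulr0 in h; apply: (cvgr_lt _ h); rewrite exprn_gt0 //.
have [k [hk1 hk2]] : exists k, `|lam k + m| < eps /\ K * H1_norm (u k) ^+ 2 < del ^+ 2.
  have [N1 _ P1] := lim1; have [N2 _ P2] := lim2; exists (maxn N1 N2).
  by split; [apply: P1; exact: leq_maxl|apply: P2; exact: leq_maxr].
have [S [S0 S2 SC]] := key k.
have Sd : S < del.
  by rewrite -(ltr_pXn2r (n := 2)) ?nnegrE ?(ltW S0) ?(ltW del0) // (le_lt_trans S2).
have [S1 Se] : S < 1 /\ S < eps by move: Sd; rewrite lt_min => /andP.
have Sp : S `^ (p - 2) <= S by apply: ge1r_powR; [rewrite S0 ltW|lra].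
have : S * 1 <= S * (C * (S `^ (p - 2) + `|lam k + m|)) by rewrite mulr1; apply: (le_trans SC); lra.
rewrite ler_pM2l // => h.
have : C * (S `^ (p - 2) + `|lam k + m|) <= C * (eps + eps).
  by rewrite ler_wpM2l // lerD // ltW // (le_lt_trans Sp).
by lra.
Qed.

End BifurcationPoints.

(** * Eigenvalues are bifurcation points *)

Section Eigenvalues.
Variables (R : realType) (G : compact_metric_graph R).
Implicit Types (u U q : edge G -> R -> R) (e : edge G).

(** For n = 0 the bound of [no_kernel_bound] with M = 0 would make the eigenfunction vanish. *)
Lemma eigenfunction_kernel (m : R) (c s : R -> R) n (phi : 'I_n -> edge G * bool -> R)
    (u : graph_function G) : eigenfunction m u ->
  c 0 = 1 -> s 0 = 0 -> (forall x : R, is_derive x 1 c (- m * s x)) ->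
  (forall x : R, is_derive x 1 s (c x)) -> orthonormal_kernel m c s phi ->
  (forall z, kernel_data m c s z ->
     forall d, z d = \sum_i ip (hom c s z) (hom c s (phi i)) * phi i d) -> (0 < n)%N.
Proof.
move=> [gc tw ki [e [x [xl ux]]] eq2] c0 s0 dc ds ophi basis.
case: n phi ophi basis => // phi ophi basis.
have [C C0 CP] := no_kernel_bound c0 s0 dc ds ophi basis.
have [|U [U1 [q [kU cq uU qE]]]] :=
    @classical_kirchhoff_sol R G m (fun=> 0) u (@cst_continuous _ _ (0 : R)) gc tw ki.
  by move=> e' x' xl'; rewrite subr0 mulNr -eq2 // opprK.
have q0 : bounded_by 0 q by move=> e' x' xl'; rewrite qE // normr0.
have xl' : 0 <= x <= len e by move: xl; rewrite in_itv.
have := CP q U U1 0 cq kU (lexx 0) q0 e x xl'.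
by rewrite mulr0 normr_le0 -uU // (negPf ux).
Qed.

Lemma scaled_solution (m p r : R) U U1 q : 6 < p -> 0 < r -> kirchhoff_sol m q U U1 ->
  (forall e x, 0 <= x <= len e -> q e x = r `^ (p - 2) * (nonlin p (U e x) - U e x)) ->
  solves_NLS p (r `^ (p - 2) - m) (fun e x => r * U e x) /\
  H1_norm (fun e x => r * U e x) =
    Num.sqrt (\sum_e integral_0to (len e) (fun x => (r * U1 e x) ^+ 2 + (r * U e x) ^+ 2)).
Proof.
move=> p6 r0 kU qE.
have kr := kirchhoff_sol_lin r 0 kU kU.
have z (w : edge G -> R -> R) : (fun e x => r * w e x + 0 * w e x) = fun e x => r * w e x.
  by apply/funext => e; apply/funext => x; ring.
rewrite !z in kr; have [gc tw ki eq2] := kirchhoff_sol_classical kr.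
have [ow _ _] := kr; have [_ cU1] := ode_continuous ow.
have [inH H1E] := H1_normE cU1 ow.1 (fun e x _ => erefl); split; last exact: H1E.
split=> //= e x xl; have := eq2 e x; rewrite /= => ->.
have xl' : 0 <= x <= len e by move: xl; rewrite in_itv /= => /andP[? ?]; rewrite !ltW.
have h : `|r * U e x| `^ (p - 2) * (r * U e x) = r `^ (p - 2) * (r * nonlin p (U e x)).
  exact: nonlin_scale.
by rewrite h qE //; ring.
Qed.

Lemma eigenvalue_bifurcation (m p : R) (u : graph_function G) : 6 < p ->
  eigenfunction m u -> bifurcation_point G p m.
Proof.
move=> p6 eu.
have [c [s [c0 s0 dc ds]]] := exists_cos_sin m.
have [n [phi [ophi basis]]] := @kernel_basis R G m c s c0 s0 dc ds.
have n0 := eigenfunction_kernel eu c0 s0 dc ds ophi basis.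
have [mu0 [M [mu00 M0 branch]]] := solution_branch c0 s0 dc ds ophi basis n0 p6.
(* With r_k = d / (k + 1) <= 1 this gives r_k^(p-2) <= r_k <= d <= mu0, so [branch] applies for
   every k. *)
pose d := Num.min 1 mu0.
have d0 : 0 < d by rewrite lt_min ltr01.
have d1 : d <= 1 by rewrite ge_min lexx.
have d2 : d <= mu0 by rewrite ge_min lexx orbT.
pose r (k : nat) : R := d * harmonic k.
have h01 k : 0 < harmonic k :> R by rewrite /harmonic /= invr_gt0.
have h1 k : harmonic k <= 1 :> R by rewrite /harmonic /= invf_le1 // ler1n.
have r0 k : 0 < r k by rewrite mulr_gt0.
have r1 k : r k <= 1 by rewrite mulr_ile1 // ltW.
have rd k : r k <= d by rewrite ler_piMr // ltW.
have cvr : r @ \oo --> 0.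
  by rewrite -[X in _ --> X](mulr0 d); apply: cvgMr; exact: cvg_harmonic.
have mu0k k : 0 < r k `^ (p - 2) by rewrite powR_gt0.
have murk k : r k `^ (p - 2) <= r k.
  by apply: ge1r_powR; [rewrite r0 r1|lra].
have muk k : r k `^ (p - 2) <= mu0.
  by apply: (le_trans (murk k)); apply: (le_trans (rd k)).
have /choice[U UP] k : exists UU : (edge G -> R -> R) * (edge G -> R -> R) * (edge G -> R -> R),
    [/\ kirchhoff_sol m UU.2 UU.1.1 UU.1.2,
      forall e x, 0 <= x <= len e ->
        UU.2 e x = r k `^ (p - 2) * (nonlin p (UU.1.1 e x) - UU.1.1 e x),
      bounded_by M UU.1.1 & exists e x, 0 <= x <= len e /\ UU.1.1 e x != 0].
  by have [W [W1 [q WP]]] := branch _ (mu0k k) (muk k); exists (W, W1, q).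
(* Bounds the right-hand side mu (f(U) - U) for all mu <= mu0; through [derivative_bound] it makes
   [M1] a bound on the derivatives independent of k. *)
pose Q := mu0 * (M `^ (p - 2) * M + M).
have Q0 : 0 <= Q.
  by rewrite mulr_ge0 ?(ltW mu00) // addr_ge0 // mulr_ge0 ?powR_ge0.
pose M1 := \sum_(e : edge G) (2 * M / len e + (`|m| * M + Q) * len e).
have M1e e : 0 <= 2 * M / len e + (`|m| * M + Q) * len e.
  have le0 := ltW (len_gt0 e).
  by rewrite addr_ge0 // ?divr_ge0 ?mulr_ge0 // addr_ge0 // mulr_ge0.
have U1b k : bounded_by M1 (U k).1.2.
  have [[ow _ _] qE UM _] := UP k.
  move=> e x xl; apply: (@le_trans _ _ (2 * M / len e + (`|m| * M + Q) * len e)); last first.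
    by rewrite /M1 (bigD1 e) //= lerDl; apply: sumr_ge0 => e' _; exact: M1e.
  apply: (derivative_bound (len_gt0 e) (ow.1 e) (ow.2 e) (UM e) _ xl) => y yl.
  apply: (le_trans (ler_normB _ _)); apply: lerD.
    by rewrite normrM normrN ler_wpM2l // UM.
  rewrite qE // normrM (gtr0_norm (mu0k k)) ler_pM // ?(ltW (mu0k k)) //.
  apply: (le_trans (ler_normB _ _)); apply: lerD; last exact: UM.
  apply: (le_trans (nonlin_small p6 M0 (UM e y yl))).
  by rewrite ler_wpM2l ?powR_ge0 // UM.
have M10 : 0 <= M1 by apply: sumr_ge0 => e _; exact: M1e.
exists (fun k => r k `^ (p - 2) - m), (fun k e x => r k * (U k).1.1 e x); split.
- move=> k; have [kU qE _ [e [x [xl Ux]]]] := UP k; split.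
    by exists e, x; rewrite in_itv; split=> //; rewrite mulf_neq0 // gt_eqF.
  by have [] := scaled_solution p6 (r0 k) kU qE.
- have h : r k `^ (p - 2) @[k --> \oo] --> (0 : R).
    apply: (@squeeze_cvgr _ _ _ _ (fun=> 0) r) => //; last exact: cvg_cst.
    by apply: nearW => k; rewrite powR_ge0 murk.
  have h2 : m - r k `^ (p - 2) @[k --> \oo] --> m - 0 by apply: cvgB h; exact: cvg_cst.
  by rewrite subr0 in h2; under eq_fun do rewrite opprB.
(* A bound for the H^1 norm of every rescaled solution, so that the norm of u_k is at most r_k B. *)
- pose B := Num.sqrt ((M1 ^+ 2 + M ^+ 2) * total_length G).
  apply: (@squeeze_cvgr _ _ _ _ (fun=> 0) (fun k => r k * B)).
  + apply: nearW => k; have [kU qE UM _] := UP k.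
    have [ow _ _] := kU; have [cU cU1] := ode_continuous ow.
    have [_ ->] := scaled_solution p6 (r0 k) kU qE.
    rewrite sqrtr_ge0 /=.
    have -> : r k * B = Num.sqrt (r k ^+ 2 * ((M1 ^+ 2 + M ^+ 2) * total_length G)).
      by rewrite sqrtrM ?sqr_ge0 // sqrtr_sqr gtr0_norm.
    apply: ler_wsqrtr; rewrite mulrA mulr_sumr; apply: ler_sum => e _.
    rewrite -integral_0to_cst ?len_gt0 //; apply: le_integral_0to.
    * have csq (f : R -> R) : continuous f -> continuous (fun x => (r k * f x) ^+ 2).
        move=> cf; under eq_fun do rewrite expr2.
        by apply: continuous_mul; exact: continuous_cmul.
      by apply: continuous_add; apply: csq; [exact: cU1|exact: cU].
    * exact: cst_continuous.
    * move=> x xl; have sm (a : R) : (r k * a) ^+ 2 = r k ^+ 2 * a ^+ 2 by ring.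
      rewrite !sm -mulrDr ler_wpM2l ?sqr_ge0 //.
      have sq (a b : R) : `|a| <= b -> a ^+ 2 <= b ^+ 2.
        move=> ab; rewrite -[a ^+ 2]ger0_norm ?sqr_ge0 // normrX.
        by rewrite lerXn2r // nnegrE // (le_trans _ ab).
      by apply: lerD; apply: sq; [exact: U1b|exact: UM].
  + exact: cvg_cst.
  + by rewrite -[X in _ --> X](mul0r B); apply: cvgMl.
Qed.

End Eigenvalues.

Theorem theorem1p4 (R : realType) (G : compact_metric_graph R)
    (lambda_ : nat -> R) (Hlambda : eigenvalue_sequence G lambda_)
    (p : R) (hp : 6 < p) :
  [set lstar : R | bifurcation_point G p lstar] =
  [set lambda_ j | j in [set j : nat | (1 <= j)%N]].
Proof.
rewrite (eigenvalue_sequence_range Hlambda); apply/seteqP; split=> m /=.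
  exact: bifurcation_eigenvalue.
by move=> [u eu]; exact: eigenvalue_bifurcation eu.
Qed.
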